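(* Every pseudotopological space is weak homotopy equivalent to some pseudotopological CW complex. Thus, every pseudotopological space is weak homotopy equivalent to some (topological) CW complex.
   Context: A pseudotopological space is a pair $(X,q)$ where $X$ is a set and $q$ is a set of pairs $(\mathcal F,x)$, with $\mathcal F$ a filter on $X$ and $x\in X$ (read ''$\mathcal F$ converges to $x$''), such that: (i) the principal ultrafilter $[x]$ converges to $x$ for every $x$; (ii) if $\mathcal F$ converges to $x$ and $\mathcal G\supset\mathcal F$ then $\mathcal G$ converges to $x$; (iii) if $\mathcal F,\mathcal G$ converge to $x$ so does $\mathcal F\cap\mathcal G$; (iv) if every ultrafilter $\mathcal U\supset\mathcal F$ converges to $x$ then $\mathcal F$ converges to $x$. A map $f$ is continuous if $f(\mathcal F)$ converges to $f(x)$ whenever $\mathcal F$ converges to $x$. This gives the category $\mathbf{PsTop}$, which has all small limits and colimits; topological spaces form a full subcategory (a filter converges to $x$ iff it contains the neighborhood filter of $x$). A pseudotopological CW complex is a pseudotopological space $X$ that is the colimit in $\mathbf{PsTop}$ of a sequence $\varnothing=X_{-1}\to X_0\to X_1\to\cdots$ in which, for each $n\ge0$, $X_n$ is a pushout in $\mathbf{PsTop}$ of $X_{n-1}\leftarrow\bigsqcup_{i\in I_n}S^{n-1}\to\bigsqcup_{i\in I_n}D^n$ (with $S^{-1}=\varnothing$, $D^0$ a point). A weak homotopy equivalence is a continuous map of pseudotopological spaces inducing a bijection on path components and isomorphisms on all homotopy groups at all base points; two spaces are weak homotopy equivalent if they are connected by a finite zigzag of weak homotopy equivalences. *)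

(* Defs.v *)
(* MathComp-Analysis *)
From Stdlib Require Export Relations.Relation_Operators.
From HB Require Export structures.
From mathcomp Require Export all_boot all_order all_algebra.
From mathcomp Require Export all_classical all_reals all_analysis.

Set Implicit Arguments.
Unset Strict Implicit.
Unset Printing Implicit Defensive.

Export Order.TTheory GRing.Theory Num.Theory.
Export numFieldNormedType.Exports.

Local Open Scope classical_set_scope.
Local Open Scope ring_scope.

(* Filters are proper: every set in them is nonempty. *)
Record psTop := PsTop {
  pst_carrier :> Type;
  pst_cvg : set_system pst_carrier -> pst_carrier -> Prop;
  pst_cvg_filter : forall F x, pst_cvg F x -> ProperFilter F;
  pst_cvg_principal : forall x, pst_cvg (principal_filter x) x;
  pst_cvg_sub : forall F G x,
    pst_cvg F x -> ProperFilter G -> F `<=` G -> pst_cvg G x;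
  pst_cvg_setI : forall F G x,
    pst_cvg F x -> pst_cvg G x -> pst_cvg (F `&` G) x;
  pst_cvg_ultra : forall F x, ProperFilter F ->
    (forall U, UltraFilter U -> F `<=` U -> pst_cvg U x) -> pst_cvg F x }.

Definition pst_continuous (X Y : psTop) (f : X -> Y) : Prop :=
  forall F x, pst_cvg F x -> pst_cvg (fmap f F) (f x).

Lemma pst_continuous_id (X : psTop) : @pst_continuous X X id.
Proof. by []. Qed.

Lemma pst_continuous_comp (X Y Z : psTop) (f : X -> Y) (g : Y -> Z) :
  pst_continuous f -> pst_continuous g -> @pst_continuous X Z (g \o f).
Proof. by move=> cf cg F x /cf /cg. Qed.

Section topological_spaces.
Variable T : topologicalType.

Let tcvg (F : set_system T) (x : T) := ProperFilter F /\ nbhs x `<=` F.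

Let tcvg_filter F x : tcvg F x -> ProperFilter F.
Proof. by case. Qed.

Let tcvg_principal x : tcvg (principal_filter x) x.
Proof.
split; first exact: principal_filter_proper.
by move=> A /nbhs_singleton Ax; apply/principal_filterP.
Qed.

Let tcvg_sub F G x :
  tcvg F x -> ProperFilter G -> F `<=` G -> tcvg G x.
Proof. by move=> [_ xF] GF FG; split=> //; exact: subset_trans FG. Qed.

Let tcvg_setI F G x : tcvg F x -> tcvg G x -> tcvg (F `&` G) x.
Proof.
move=> [FF xF] [GG xG]; split; last by move=> A xA; split; [exact: xF|exact: xG].
split=> [[F0 _]|]; first exact: filter_not_empty F0.
split; first by split; exact: filterT.
- by move=> A B [FA GA] [FB GB]; split; exact: filterI.
- by move=> A B AB [FA GA]; split; exact: filterS AB _.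
Qed.

Let tcvg_ultra F x : ProperFilter F ->
  (forall U, UltraFilter U -> F `<=` U -> tcvg U x) -> tcvg F x.
Proof.
move=> FF FU; split=> // A xA; apply: contrapT => nFA.
pose G := filter_from F (fun B => B `\` A).
have GF : ProperFilter G.
  apply: filter_from_proper.
    apply: filter_from_filter; first by exists setT; exact: filterT.
    move=> B C FB FC; exists (B `&` C); first exact: filterI.
    by move=> y [[By Cy] nAy].
  move=> B FB; apply: contrapT => B0; apply: nFA.
  apply: filterS FB => y By; apply: contrapT => nAy; apply: B0.
  by exists y.
have [U [UU GU]] := ultraFilterLemma GF.
have FleU : F `<=` U by move=> B FB; apply: GU; exists B => // y [].
have [_ /(_ _ xA) UA] := FU U UU FleU.
have UnA : U (~` A).
  by apply: GU; exists setT; [exact: filterT|move=> y []].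
by apply: (@filter_not_empty _ U); rewrite -(setICr A); exact: filterI.
Qed.

Definition psTop_of_top : psTop :=
  PsTop tcvg_filter tcvg_principal tcvg_sub tcvg_setI tcvg_ultra.

End topological_spaces.

Lemma pst_continuous_top (T U : topologicalType) (f : T -> U) :
  @pst_continuous (psTop_of_top T) (psTop_of_top U) f <-> continuous f.
Proof.
split=> [cf x A fxA|cf F x [FF xF]].
  have [_] := cf (nbhs x) x (conj (nbhs_pfilter x) (@subset_refl _ _)).
  exact.
by split=> [|A /cf fxA]; [exact: fmap_proper_filter|exact: xF].
Qed.

(** CW complexes in a concrete category *)

Record concreteCategory := ConcreteCategory {
  obj :> Type;
  carrier : obj -> Type;
  hom : forall A B : obj, (carrier A -> carrier B) -> Prop;
  hom_id : forall A : obj, hom (fun a : carrier A => a);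
  hom_comp : forall (A B D : obj) (f : carrier A -> carrier B)
      (g : carrier B -> carrier D), hom f -> hom g ->
    @hom A D (fun a => g (f a)) }.

Coercion carrier : obj >-> Sortclass.

Section colimits.
Variable C : concreteCategory.

Definition is_coproduct (I : Type) (A : I -> C) (B : C)
    (inc : forall i, A i -> B) : Prop :=
  (forall i, hom (inc i)) /\
  forall (Z : C) (u : forall i, A i -> Z), (forall i, hom (u i)) ->
    exists! h : B -> Z, hom h /\ forall i, h \o inc i = u i.

Definition is_pushout (A B X Y : C) (f : A -> X) (j : A -> B)
    (k : X -> Y) (g : B -> Y) : Prop :=
  [/\ hom f /\ hom j, hom k /\ hom g, k \o f = g \o j &
  forall (Z : C) (u : X -> Z) (v : B -> Z), hom u -> hom v ->
    u \o f = v \o j ->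
    exists! h : Y -> Z, [/\ hom h, h \o k = u & h \o g = v]].

Definition is_sequential_colimit (X : nat -> C)
    (k : forall n, X n -> X n.+1) (Y : C) (inc : forall n, X n -> Y) : Prop :=
  [/\ forall n, hom (k n), forall n, hom (inc n),
    forall n, inc n.+1 \o k n = inc n &
  forall (Z : C) (u : forall n, X n -> Z), (forall n, hom (u n)) ->
    (forall n, u n.+1 \o k n = u n) ->
    exists! h : Y -> Z, hom h /\ forall n, h \o inc n = u n].

(* [S n] and [D n] stand for S^(n-1) and D^n. *)
Variables (S D : nat -> C) (incl : forall n, S n -> D n).

Definition is_cell_attachment (n : nat) (X Y : C) (k : X -> Y) : Prop :=
  exists (I : Type) (SI DI : C) (inS : I -> S n -> SI) (inD : I -> D n -> DI)
      (j : SI -> DI) (phi : SI -> X) (Phi : DI -> Y),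
    [/\ is_coproduct inS, is_coproduct inD,
      forall i, j \o inS i = inD i \o @incl n &
      is_pushout phi j k Phi].

(* [sk n] stands for X_(n-1), so that [sk 0] is empty. *)
Definition is_CW_complex (X : C) : Prop :=
  exists (sk : nat -> C) (k : forall n, sk n -> sk n.+1)
      (inc : forall n, sk n -> X),
    [/\ sk 0%N -> False, forall n, is_cell_attachment n (k n) &
      is_sequential_colimit k inc].

End colimits.

Definition PsTopCat : concreteCategory :=
  @ConcreteCategory psTop pst_carrier pst_continuous
    pst_continuous_id pst_continuous_comp.

Lemma top_continuous_id (T : topologicalType) : continuous (fun x : T => x).
Proof. by move=> x; exact: cvg_id. Qed.

Lemma top_continuous_comp (T U V : topologicalType) (f : T -> U) (g : U -> V) :
  continuous f -> continuous g -> continuous (fun x => g (f x)).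
Proof. by move=> cf cg x; exact: continuous_comp (cf x) (cg (f x)). Qed.

Definition TopCat : concreteCategory :=
  @ConcreteCategory topologicalType (fun T => T)
    (fun T U f => continuous (f : T -> U))
    top_continuous_id top_continuous_comp.

Section spheres_and_disks.
Variables (R : realType) (n : nat).

(* S^(n-1) in R^n; empty for n = 0 *)
Definition sphere : set 'rV[R]_n := [set x | \sum_i x ord0 i ^+ 2 = 1].

Definition disk : set 'rV[R]_n := [set x | \sum_i x ord0 i ^+ 2 <= 1].

Lemma sphere_sub_disk (x : sphere) : val x \in disk.
Proof. by apply/mem_set; rewrite /disk /= (set_valP x). Qed.

Definition sphere_disk (x : sphere) : disk := Sub (val x) (sphere_sub_disk x).

End spheres_and_disks.

Arguments sphere : clear implicits.
Arguments disk : clear implicits.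

Definition psTop_CW_complex (R : realType) (X : psTop) : Prop :=
  @is_CW_complex PsTopCat
    (fun n => psTop_of_top (sphere R n)) (fun n => psTop_of_top (disk R n))
    (@sphere_disk R) X.

Definition top_CW_complex (R : realType) (X : topologicalType) : Prop :=
  @is_CW_complex TopCat
    (fun n => sphere R n : topologicalType)
    (fun n => disk R n : topologicalType)
    (@sphere_disk R) X.

Section homotopy_groups.
Variable R : realType.

Definition unitI : set R := `[0, 1].

Definition path_related (X : psTop) (x y : X) : Prop :=
  exists g : unitI -> X, [/\ @pst_continuous (psTop_of_top unitI) X g,
    forall t, val t = 0 -> g t = x & forall t, val t = 1 -> g t = y].

Definition path_components (X : psTop) : set (set X) :=
  range (@path_related X).

Arguments path_components : clear implicits.

Definition path_components_map (X Y : psTop) (f : X -> Y) (c : set X) : set Y :=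
  [set y | exists2 x, c x & path_related (f x) y].

Definition cube n : set 'rV[R]_n := [set s | forall i, 0 <= s ord0 i <= 1].

Arguments cube : clear implicits.

Definition cube_boundary n : set (cube n) :=
  [set s : cube n | exists i, val s ord0 i = 0 \/ val s ord0 i = 1].

Definition loop n (X : psTop) (x : X) : set (cube n -> X) :=
  [set a | @pst_continuous (psTop_of_top (cube n)) X a /\
           forall s, cube_boundary s -> a s = x].

Arguments loop n {X} x.

Definition homotopic n (X : psTop) (x : X) (a b : cube n -> X) : Prop :=
  exists H : cube n * unitI -> X,
    [/\ @pst_continuous (psTop_of_top (cube n * unitI)%type) X H,
      forall s t, val t = 0 -> H (s, t) = a s,
      forall s t, val t = 1 -> H (s, t) = b s &
      forall s t, cube_boundary s -> H (s, t) = x].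

Definition homotopy_group n (X : psTop) (x : X) : set (set (cube n -> X)) :=
  [set homotopic x a | a in loop n x].

Arguments homotopy_group n {X} x.

Definition homotopy_group_map n (X Y : psTop) (f : X -> Y) (x : X)
    (c : set (cube n -> X)) : set (cube n -> Y) :=
  [set b | exists2 a, c a & homotopic (f x) (f \o a) b].

Definition set_coord0 n (s : 'rV[R]_n.+1) (t : R) : 'rV[R]_n.+1 :=
  \row_j (if j == ord0 then t else s ord0 j).

(* The default value s of [insubd] is never used: both rescaled points lie in
   the cube. *)
Definition concat n (X : Type) (a b : cube n.+1 -> X) (s : cube n.+1) : X :=
  let t := val s ord0 ord0 in
  if t <= 2^-1 then a (insubd s (set_coord0 (val s) (2 * t)))
  else b (insubd s (set_coord0 (val s) (2 * t - 1))).

Definition homotopy_group_mul n (X : psTop) (x : X)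
    (c d : set (cube n.+1 -> X)) : set (cube n.+1 -> X) :=
  [set l | exists a b, [/\ c a, d b & homotopic x (concat a b) l]].

Definition weak_homotopy_equivalence (X Y : psTop) (f : X -> Y) : Prop :=
  [/\ pst_continuous f,
    set_bij (path_components X) (path_components Y) (path_components_map f) &
    forall n (x : X),
      set_bij (homotopy_group n.+1 x) (homotopy_group n.+1 (f x))
        (homotopy_group_map f x) /\
      forall c d, homotopy_group n.+1 x c -> homotopy_group n.+1 x d ->
        homotopy_group_map f x (homotopy_group_mul x c d) =
        homotopy_group_mul (f x)
          (homotopy_group_map f x c) (homotopy_group_map f x d)].

Definition weak_homotopy_equivalent : psTop -> psTop -> Prop :=
  clos_refl_sym_trans psTop
    (fun X Y => exists f : X -> Y, weak_homotopy_equivalence f).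

End homotopy_groups.

Arguments unitI : clear implicits.
Arguments cube : clear implicits.
Arguments loop R n {X} x.
Arguments homotopy_group R n {X} x.

(* Main.v *)
(* A pseudotopology is the same thing as a relation between ultrafilters and
   points, so in a final structure every convergent ultrafilter comes from a
   single piece; for a cell complex it lives in a single closed cell. Starting
   from the empty space, attach in stage n one n-cell for every commutative
   square from S^(n-1) -> D^n to Y_(n-1) -> X. The colimit Y maps to X, and Y -> X
   has the lifting property against S^(k-1) -> D^k up to homotopy relative to the
   sphere: a map S^(k-1) -> Y is first pushed down into Y_(k-1), where the square
   has a filling cell by construction. Pushing off an n-cell with n >= k uses that
   a map S^(k-1) -> R^n is close to one that avoids 0, by a Lipschitz
   approximation and a pigeonhole count on a grid.
   For the topological statement, Y is compared with its topological modification,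
   which is the CW complex with the same cells because the modification is a left
   adjoint. A map of a compact space to it meets finitely many open cells, and
   real functions separate points, hence it is already continuous into Y. *)

Require Import Defs.
From mathcomp Require Import ring lra zify.

Set Implicit Arguments.
Unset Strict Implicit.
Unset Printing Implicit Defensive.

Local Open Scope classical_set_scope.
Local Open Scope ring_scope.

(** * Ultrafilters and pseudotopologies *)

(** Convergence in a pseudotopological space is not given by neighborhoods, so open covers and
    Lebesgue numbers are not at hand for maps into a complex. Continuity, gluing and compactness are
    therefore tested on ultrafilters: an ultrafilter picks one piece of a finite closed cover of the
    source and one closed cell of the target. One criterion, [weak_lift], serves both statements.
    Cubes and cylinders over cubes are disks, so lifting a loop over a cube gives surjectivity on
    homotopy groups, and lifting a homotopy over a cylinder gives injectivity. The lift commutes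
    with the map to the base only up to homotopy because pushing the boundary sphere down moves it:
    the attached cell bounds the moved sphere, so the disk in the base is first enlarged by the
    track of this motion. For the identity from the complex to its modification the property has a
    simpler cause: a disk in the modification is its own lift. Attaching cells along all squares,
    not along chosen generators, treats surjectivity and injectivity in all degrees at once. *)

Lemma fmap_ultra (A B : Type) (f : A -> B) (U : set_system A) :
  UltraFilter U -> UltraFilter (fmap f U).
Proof.
move=> UU; split=> [|G GF sUG]; first exact: fmap_proper_filter.
rewrite eqEsubset; split=> // S GS.
have [//|UnS] := in_ultra_setVsetC (f @^-1` S) UU.
have /(filterI GS) : G (~` S) by exact: sUG.
by rewrite setICr => /filter_not_empty.
Qed.

Lemma ultra_sub_eq (A : Type) (U V : set_system A) :
  UltraFilter U -> UltraFilter V -> U `<=` V -> V = U.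
Proof. by move=> UU UV UV'; apply: max_filter. Qed.

Lemma ultra_setU (A : Type) (U : set_system A) (P Q : set A) :
  UltraFilter U -> U (P `|` Q) -> U P \/ U Q.
Proof.
move=> UU UPQ; have [|UnP] := in_ultra_setVsetC P UU; first by left.
by right; apply: filterS (filterI UPQ UnP) => x [[]].
Qed.

Lemma ultra_set1 (A : Type) (U : set_system A) (x : A) :
  UltraFilter U -> U [set x] -> U = principal_filter x.
Proof.
move=> UU Ux; apply: ultra_sub_eq; first exact: principal_filter_ultra.
by move=> P /principal_filterP Px; apply: filterS Ux => y ->.
Qed.

Lemma ultra_lift (A B : Type) (f : A -> B) (F : set_system A)
    (V : set_system B) : Filter F -> UltraFilter V ->
  (forall P Q, F P -> V Q -> exists2 x, P x & Q (f x)) ->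
  exists U, [/\ UltraFilter U, F `<=` U & fmap f U = V].
Proof.
move=> FF UV FV.
pose G := filter_from [set PQ | F PQ.1 /\ V PQ.2]
  (fun PQ => PQ.1 `&` f @^-1` PQ.2).
have GF : ProperFilter G.
  apply: filter_from_proper; last first.
    by move=> [P Q] /= [FP VQ]; have [x Px Qx] := FV _ _ FP VQ; exists x.
  apply: filter_from_filter.
    by exists (setT, setT); split; exact: filterT.
  move=> [P Q] [P' Q'] /= [FP VQ] [FP' VQ'].
  exists (P `&` P', Q `&` Q'); first by split; exact: filterI.
  by move=> x [/= [Px P'x] [Qx Q'x]].
have [U [UU GU]] := ultraFilterLemma GF.
exists U; split=> //.
  by move=> P FP; apply: GU; exists (P, setT) => [|x []//]; split=> //; exact: filterT.
apply: ultra_sub_eq => //; first exact: fmap_ultra.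
by move=> Q VQ; apply: GU; exists (setT, Q) => [|x []//]; split=> //; exact: filterT.
Qed.

Lemma ultra_lift_range (A B : Type) (f : A -> B) (V : set_system B) :
  UltraFilter V -> V (range f) -> exists2 U, UltraFilter U & fmap f U = V.
Proof.
move=> UV Vf.
have TF : Filter (fun P : set A => P = setT).
  split=> [//|P Q /= -> ->|P Q PQ /= PT]; first by rewrite setIT.
  by apply/seteqP; split=> // x _; apply: PQ; rewrite PT.
have [|U [UU _ fU]] := @ultra_lift _ _ f _ V TF UV; last by exists U.
move=> P Q -> VQ; have [y [Qy [x _ xy]]] := filter_ex (filterI VQ Vf).
by exists x => //; rewrite xy.
Qed.

(** Ultrafilters with the same image in [B] come from one ultrafilter on the fibre product. It lets
    a single ultrafilter carry both a point of the source and its coordinate in a closed cell. *)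
Lemma ultra_pullback (A B C : Type) (f : A -> B) (q : C -> B)
    (W : set_system A) (V : set_system C) :
  UltraFilter W -> UltraFilter V -> fmap f W = fmap q V ->
  exists W' : set_system (A * C), [/\ UltraFilter W', fmap fst W' = W,
      fmap snd W' = V & W' [set p : A * C | f p.1 = q p.2]].
Proof.
move=> UW UV fq.
pose F := filter_from V (fun Q => [set p | Q p.2 /\ f p.1 = q p.2]).
have FF : Filter F.
  apply: filter_from_filter; first by exists setT; exact: filterT.
  move=> Q Q' VQ VQ'; exists (Q `&` Q'); first exact: filterI.
  by move=> p [[Qp Q'p] e].
have [|U [UU FU UW']] := @ultra_lift _ _ fst F W FF UW.
  move=> P Q [S VS SP] WQ.
  have qS : W (f @^-1` (q @` S)).
    by rewrite -[W _]/(fmap f W (q @` S)) fq /=; apply: filterS VS => c Sc; exists c.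
  have [a [Qa [c Sc qc]]] := filter_ex (filterI WQ qS).
  by exists (a, c) => //; apply: SP; split.
exists U; split=> //; last first.
  by apply: FU; exists setT; [exact: filterT|move=> p []].
apply: ultra_sub_eq => //; first exact: fmap_ultra.
by move=> Q VQ; apply: FU; exists Q => // p [].
Qed.

(** An ultrafilter above the image of [F] is the image of an ultrafilter above [F], and axiom (iv)
    in the target reduces convergence to ultrafilters. *)
Lemma pst_continuousP (X Y : psTop) (f : X -> Y) :
  pst_continuous f <-> forall U x, UltraFilter U -> pst_cvg U x ->
    pst_cvg (fmap f U) (f x).
Proof.
split=> [cf U x _|cf F x Fx]; first exact: cf.
have FF := pst_cvg_filter Fx.
apply: pst_cvg_ultra => V UV FV.
have [|U [UU FU <-]] := @ultra_lift _ _ f F V _ UV.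
  move=> P Q FP VQ; have VfP : V (f @` P).
    by apply: FV; apply: (@filterS _ F _ P) FP => x' Px'; exists x'.
  have [b [Qb [a Pa ab]]] := filter_ex (filterI VQ VfP).
  by exists a => //; rewrite ab.
by apply: cf => //; apply: pst_cvg_sub Fx _ FU.
Qed.

Lemma fmap_principal (A B : Type) (f : A -> B) (x : A) :
  fmap f (principal_filter x) = principal_filter (f x).
Proof.
by apply/seteqP; split=> P /principal_filterP Px; apply/principal_filterP.
Qed.

Lemma fmap_eq_on (A B : Type) (U : set_system A) (C : set A) (f g : A -> B) :
  Filter U -> U C -> (forall x, C x -> f x = g x) -> fmap f U = fmap g U.
Proof.
move=> UF UC fg.
have sub (f' g' : A -> B) : (forall x, C x -> f' x = g' x) ->
    fmap f' U `<=` fmap g' U.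
  move=> fg' P UP; apply: (@filterS _ U _ (C `&` f' @^-1` P)).
    by move=> x [Cx] /=; rewrite fg'.
  exact: filterI.
by apply/seteqP; split; apply: sub => x Cx; rewrite fg.
Qed.

Lemma pst_continuous_eq (X Y : psTop) (f g : X -> Y) :
  f =1 g -> pst_continuous f -> pst_continuous g.
Proof. by move=> /funext->. Qed.

Lemma pst_continuous_cst (X Y : psTop) (y : Y) :
  pst_continuous (fun _ : X => y).
Proof.
apply/pst_continuousP => U x UU _; rewrite (_ : fmap _ U = principal_filter y).
  exact: pst_cvg_principal.
apply: ultra_set1; first exact: fmap_ultra.
by apply: (@filterS _ U _ setT) => //; exact: filterT.
Qed.

Section ultra_psTop.
Variables (C : Type) (L : set_system C -> C -> Prop).
Hypothesis L_principal : forall x, L (principal_filter x) x.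

Let ucvg F x := ProperFilter F /\
  forall U, UltraFilter U -> F `<=` U -> L U x.

Let ucvg_filter F x : ucvg F x -> ProperFilter F. Proof. by case. Qed.

Let ucvg_principal x : ucvg (principal_filter x) x.
Proof.
split=> [|U UU xU]; first exact: principal_filter_proper.
by rewrite (ultra_sub_eq _ _ xU)//; exact: principal_filter_ultra.
Qed.

Let ucvg_sub F G x : ucvg F x -> ProperFilter G -> F `<=` G -> ucvg G x.
Proof.
by move=> [_ FL] GF FG; split=> // U UU GU; apply: FL => //; apply: subset_trans GU.
Qed.

Let ucvg_setI F G x : ucvg F x -> ucvg G x -> ucvg (F `&` G) x.
Proof.
move=> [FF FL] [GF GL]; split.
  split=> [[F0 _]|]; first exact: filter_not_empty F0.
  split; first by split; exact: filterT.
  - by move=> A B [FA GA] [FB GB]; split; exact: filterI.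
  - by move=> A B AB [FA GA]; split; exact: filterS AB _.
(* An ultrafilter above the intersection of two filters lies above one of them: a set [A] of [F]
   missing from [U] forces every [B] of [G] into [U], because the union of [A] and [B] is in both
   filters. *)
move=> U UU FGU; have [FU|/existsNP[A /not_implyP[FA nUA]]] := pselect (F `<=` U).
  exact: FL.
apply: GL => // B GB.
have [//|//] : U A \/ U B.
by apply: ultra_setU; apply: FGU; split; [apply: filterS FA|apply: filterS GB] => y;
  [left|right].
Qed.

Let ucvg_ultra F x : ProperFilter F ->
  (forall U, UltraFilter U -> F `<=` U -> ucvg U x) -> ucvg F x.
Proof. by move=> FF FU; split=> // U UU /(FU U UU)[_]; exact. Qed.

Definition ultra_psTop : psTop :=
  PsTop ucvg_filter ucvg_principal ucvg_sub ucvg_setI ucvg_ultra.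

Lemma ultra_psTopP (U : set_system C) x : UltraFilter U ->
  @pst_cvg ultra_psTop U x <-> L U x.
Proof.
move=> UU; split=> [[_]|LU]; first exact.
by split=> [|V UV UV']; [exact: ultra_proper|rewrite (ultra_sub_eq _ _ UV')].
Qed.

End ultra_psTop.

Section final_psTop.
Variables (J : Type) (X : J -> psTop) (C : Type) (i : forall j, X j -> C).

(** The first disjunct covers points in the image of no piece; axiom (i) must hold there too. *)
Definition final_cvg (V : set_system C) (y : C) : Prop :=
  V = principal_filter y \/
  exists j U x, [/\ UltraFilter U, pst_cvg U x, fmap (@i j) U = V & i x = y].

Lemma final_cvg_principal y : final_cvg (principal_filter y) y.
Proof. by left. Qed.

Definition final_psTop : psTop := ultra_psTop final_cvg_principal.

Lemma final_continuous j : @pst_continuous (X j) final_psTop (@i j).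
Proof.
apply/pst_continuousP => U x UU Ux; apply/ultra_psTopP; first exact: fmap_ultra.
by right; exists j, U, x.
Qed.

Lemma final_continuousP (Z : psTop) (h : C -> Z) :
  @pst_continuous final_psTop Z h <->
  forall j, pst_continuous (h \o @i j).
Proof.
split=> [ch j|ch]; first exact: pst_continuous_comp (@final_continuous j) ch.
apply/pst_continuousP => V y UV /(ultra_psTopP _ UV)[->|[j [U [x [UU Ux <- <-]]]]].
  by rewrite fmap_principal; exact: pst_cvg_principal.
exact: ch.
Qed.

End final_psTop.

Section topological_psTop.
Variable T : topologicalType.

Lemma compact_pst_cvg (U : set_system T) : compact [set: T] ->
  UltraFilter U -> exists x, @pst_cvg (psTop_of_top T) U x.
Proof.
rewrite compact_ultra => /(_ U) cT UU; have [|x [_ Ux]] := cT UU; first exact: filterT.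
by exists x; split=> [|A /Ux//]; exact: ultra_proper.
Qed.

Lemma hausdorff_pst_cvg (U : set_system T) x y : hausdorff_space T ->
  @pst_cvg (psTop_of_top T) U x -> @pst_cvg (psTop_of_top T) U y -> x = y.
Proof.
move=> hT [UU Ux] [_ Uy]; apply: hT => A B /Ux UA /Uy UB.
by have [z ABz] := filter_ex (filterI UA UB); exists z.
Qed.

Lemma closed_pst_cvg (U : set_system T) x (A : set T) : closed A ->
  @pst_cvg (psTop_of_top T) U x -> U A -> A x.
Proof.
move=> cA [UU Ux] UA; apply: cA => B /Ux UB.
exact: filter_ex (filterI UA UB).
Qed.

End topological_psTop.

(** * Attaching cells *)

Section copower.
Variables (I : Type) (A : psTop).

Definition copower : psTop :=
  @final_psTop I (fun=> A) (I * A)%type (fun i a => (i, a)).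

Lemma copower_is_coproduct :
  @is_coproduct PsTopCat I (fun=> A) copower (fun i a => (i, a)).
Proof.
split; first exact: final_continuous.
move=> Z u cu; exists (fun p => u p.1 p.2); split.
  by split=> //; apply/final_continuousP => i; exact: cu.
by move=> h [_ hu]; apply/funext => -[i a] /=; rewrite -hu.
Qed.

End copower.

(** * Attaching a cell for every commutative square *)

Section attach.
Variables (S D : psTop) (incl : S -> D) (X Y : psTop) (f : Y -> X).

Record cell_problem := CellProblem {
  cell_att : S -> Y;
  cell_ext : D -> X;
  cell_att_continuous : pst_continuous cell_att;
  cell_ext_continuous : pst_continuous cell_ext;
  cell_comm : forall s, cell_ext (incl s) = f (cell_att s) }.

Definition open_cell : Type :=
  {p : cell_problem * D | ~ exists s, incl s = p.2}.

(** Since [incl] will be injective, the pushout is, as a set, the disjoint union of [Y] and the open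
    cells. With this model no quotient is taken; the gluing is hidden in [char_map]. *)
Definition attach_carrier : Type := (Y + open_cell)%type.

Definition char_map (i : cell_problem) (d : D) : attach_carrier :=
  match pselect (exists s, incl s = d) with
  | left h => inl (cell_att i (projT1 (cid h)))
  | right h => inr (exist _ (i, d) h)
  end.

Hypothesis incl_inj : injective incl.

Lemma char_map_incl i s : char_map i (incl s) = inl (cell_att i s).
Proof.
rewrite /char_map; case: pselect => [h|[]]; last by exists s.
by case: cid => /= t /incl_inj->.
Qed.

Lemma char_map_inl i d y : char_map i d = inl y ->
  exists2 s, incl s = d & cell_att i s = y.
Proof.
rewrite /char_map; case: pselect => // h [<-].
by exists (projT1 (cid h)) => //; case: cid.
Qed.

Lemma char_map_inr i d o : char_map i d = inr o -> sval o = (i, d).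
Proof. by rewrite /char_map; case: pselect => // h [<-]. Qed.

Lemma char_map_open (o : open_cell) : char_map (sval o).1 (sval o).2 = inr o.
Proof.
case: o => -[i d] /= h; rewrite /char_map; case: pselect => // h'.
by congr (inr (exist _ _ _)); exact: Prop_irrelevance.
Qed.

Definition attach_part (j : option cell_problem) : psTop :=
  if j is Some _ then D else Y.

Definition attach_in (j : option cell_problem) : attach_part j -> attach_carrier :=
  match j with
  | Some i => char_map i
  | None => inl
  end.

Definition attach : psTop := final_psTop attach_in.

Lemma attach_inl_continuous : @pst_continuous Y attach inl.
Proof. exact: (@final_continuous _ attach_part _ attach_in None). Qed.

Lemma char_map_continuous i : @pst_continuous D attach (char_map i).
Proof. exact: (@final_continuous _ attach_part _ attach_in (Some i)). Qed.

Lemma attach_continuousP (Z : psTop) (h : attach_carrier -> Z) :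
  @pst_continuous attach Z h <->
  @pst_continuous Y Z (h \o inl) /\
  forall i, @pst_continuous D Z (h \o char_map i).
Proof.
split=> [/final_continuousP ch|[chY chD]]; last first.
  by apply/final_continuousP => -[i|]; [exact: chD|exact: chY].
by split=> [|i]; [exact: (ch None)|exact: (ch (Some i))].
Qed.

(** The pieces cover the carrier, so the principal case of [final_cvg] is absorbed into the two
    others. *)
Lemma attach_cvgP (V : set_system attach) (z : attach) :
  UltraFilter V -> pst_cvg V z ->
  (exists U y, [/\ UltraFilter U, pst_cvg U y, @fmap Y _ inl U = V & inl y = z]) \/
  (exists i U d,
     [/\ UltraFilter U, pst_cvg U d, fmap (char_map i) U = V & char_map i d = z]).
Proof.
move=> UV /(ultra_psTopP _ UV)[->|[[i|] [U [x [UU Ux UV' xz]]]]]; last 2 first.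
- by right; exists i, U, x.
- by left; exists U, x.
case: z => [y|o].
  left; exists (principal_filter y), y; split=> //.
  - exact: principal_filter_ultra.
  - exact: pst_cvg_principal.
  - exact: fmap_principal.
right; exists (sval o).1, (principal_filter (sval o).2), (sval o).2; split=> //.
- exact: principal_filter_ultra.
- exact: pst_cvg_principal.
- by rewrite fmap_principal char_map_open.
- exact: char_map_open.
Qed.

Definition attach_map (z : attach) : X :=
  match z with
  | inl y => f y
  | inr o => cell_ext (sval o).1 (sval o).2
  end.

Lemma attach_map_char i d : attach_map (char_map i d) = cell_ext i d.
Proof.
rewrite /char_map; case: pselect => //= h.
by rewrite -cell_comm; case: cid => /= s ->.
Qed.

Lemma attach_map_continuous : pst_continuous f -> pst_continuous attach_map.
Proof.
move=> cf; apply/attach_continuousP; split=> [//|i].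
apply: (pst_continuous_eq (f := cell_ext i)); last exact: cell_ext_continuous.
by move=> d /=; rewrite attach_map_char.
Qed.

Lemma attach_is_pushout : pst_continuous incl ->
  @is_pushout PsTopCat (copower cell_problem S) (copower cell_problem D)
    Y attach (fun p => cell_att p.1 p.2) (fun p => (p.1, incl p.2))
    inl (fun p => char_map p.1 p.2).
Proof.
move=> cincl; split.
- split; apply/final_continuousP => i; first exact: cell_att_continuous.
  exact: (pst_continuous_comp cincl
    (@final_continuous _ (fun=> D) _ (fun i a => (i, a)) i)).
- split; first exact: attach_inl_continuous.
  by apply/final_continuousP => i; exact: char_map_continuous.
- by apply/funext => -[i s] /=; rewrite char_map_incl.
move=> Z u v cu cv uv.
pose h (z : attach) : Z := match z with inl y => u y | inr o => v (sval o) end.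
have hchar i d : h (char_map i d) = v (i, d).
  rewrite /char_map; case: pselect => //= -[s sd].
  case: cid => /= t td; rewrite -td.
  exact: (congr1 (fun g => g (i, t)) uv).
exists h; split.
  split=> [||]; last by apply/funext => -[i d]; exact: hchar.
    apply/attach_continuousP; split=> [//|i].
    apply: (pst_continuous_eq (f := fun d => v (i, d))) => [d|].
      by rewrite /= hchar.
    exact: (pst_continuous_comp (@final_continuous _ _ _ _ i) cv).
  by [].
move=> h' [_ hu hv]; apply/funext => -[y|o] /=; first by rewrite -hu.
by rewrite -(char_map_open o) -[LHS](congr1 (fun g => g (sval o)) hv).
Qed.

End attach.

(** * The complex over a given space *)

Section skeleta.
Variables (R : realType) (X : psTop).

Definition empty_psTop : psTop :=
  @ultra_psTop void (fun _ _ => True) (fun=> I).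

(** The cells of a stage are squares over the map to [X], so each stage and its map to [X] are built
    together. As in [is_CW_complex], stage [n] is the skeleton of dimension n - 1. *)
Fixpoint skeleton_over (n : nat) : {Y : psTop & Y -> X} :=
  if n is m.+1 then
    let Y := skeleton_over m in
    existT (fun Y : psTop => Y -> X)
      (@attach (psTop_of_top (sphere R m)) (psTop_of_top (disk R m))
        (@sphere_disk R m) X _ (projT2 Y))
      (@attach_map _ _ _ _ _ _)
  else existT (fun Y : psTop => Y -> X) empty_psTop (of_void X).

Definition skeleton n : psTop := projT1 (skeleton_over n).
Definition skeleton_map n : skeleton n -> X := projT2 (skeleton_over n).
Arguments skeleton_map : clear implicits.

Definition cells n : Type :=
  @cell_problem (psTop_of_top (sphere R n)) (psTop_of_top (disk R n))
    (@sphere_disk R n) X (skeleton n) (skeleton_map n).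

Definition cell_points n : Type :=
  @open_cell (psTop_of_top (sphere R n)) (psTop_of_top (disk R n))
    (@sphere_disk R n) X (skeleton n) (skeleton_map n).

Definition skeleton_incl n (y : skeleton n) : skeleton n.+1 := inl y.

Definition cell_char n (i : cells n) (d : disk R n) : skeleton n.+1 :=
  @char_map (psTop_of_top (sphere R n)) (psTop_of_top (disk R n)) _ _ _ _ i d.

(** Every point of the colimit lies in exactly one open cell. The colimit is therefore modelled by
    the points of all open cells, tagged by dimension, again without a quotient. *)
Fixpoint skeleton_in n : skeleton n -> {n & cell_points n} :=
  match n with
  | 0%N => of_void _
  | m.+1 => fun y => match y with
                     | inl z => skeleton_in z
                     | inr o => existT cell_points m o
                     end
  end.
Arguments skeleton_in : clear implicits.

Definition cw_approx : psTop := final_psTop skeleton_in.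

Definition cw_approx_map (y : cw_approx) : X :=
  skeleton_map (projT1 y).+1 (inr (projT2 y)).

Lemma sphere_disk_inj n : injective (@sphere_disk R n).
Proof. by move=> s t /(congr1 val) st; apply: val_inj. Qed.

Lemma sphere_disk_continuous n :
  @pst_continuous (psTop_of_top (sphere R n)) (psTop_of_top (disk R n))
    (@sphere_disk R n).
Proof.
apply/pst_continuous_top/continuous_comp_initial.
exact: initial_continuous.
Qed.

Lemma skeleton_map_continuous n : pst_continuous (skeleton_map n).
Proof.
elim: n => [|n IHn]; first by move=> F [].
exact: attach_map_continuous.
Qed.

Lemma cw_approx_map_in n y : cw_approx_map (skeleton_in n y) = skeleton_map n y.
Proof.
elim: n y => [[]|n IHn] [y|o] //=; exact: IHn.
Qed.

Lemma cw_approx_map_continuous : pst_continuous cw_approx_map.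
Proof.
apply/final_continuousP => n.
apply: (pst_continuous_eq (f := skeleton_map n)); last exact: skeleton_map_continuous.
by move=> y /=; rewrite cw_approx_map_in.
Qed.

Lemma cw_approx_colimit :
  @is_sequential_colimit PsTopCat skeleton skeleton_incl cw_approx skeleton_in.
Proof.
split=> //.
- by move=> n; exact: attach_inl_continuous.
- by move=> n; exact: (@final_continuous _ skeleton _ skeleton_in n).
move=> Z u cu uk.
pose h (p : cw_approx) : Z := u (projT1 p).+1 (inr (projT2 p)).
have hu n : h \o skeleton_in n = u n.
  apply/funext; elim: n => [[]|n IHn] [y|o] //=.
  by rewrite -[RHS]/((u n.+1 \o @skeleton_incl n) y) uk -IHn.
exists h; split.
  by split=> //; apply/final_continuousP => n; rewrite hu; exact: cu.
by move=> h' [_ h'u]; apply/funext => -[n o]; rewrite /h /= -h'u.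
Qed.

Lemma cw_approx_CW : psTop_CW_complex R cw_approx.
Proof.
exists skeleton, skeleton_incl, skeleton_in; split=> [[]|n|].
- exists (cells n), (copower (cells n) (psTop_of_top (sphere R n))),
    (copower (cells n) (psTop_of_top (disk R n))),
    (fun i s => (i, s)), (fun i d => (i, d)),
    (fun p => (p.1, sphere_disk p.2)),
    (fun p => cell_att p.1 p.2), (fun p => cell_char p.1 p.2).
  split=> //; [exact: copower_is_coproduct|exact: copower_is_coproduct|].
  apply: attach_is_pushout; first exact: sphere_disk_inj.
  exact: sphere_disk_continuous.
- exact: cw_approx_colimit.
Qed.

End skeleta.

Arguments skeleton_map {R X} n y.
Arguments skeleton_in {R X} n y.
Arguments skeleton_incl {R X n} y.

(** * The topological modification *)

(** An alias to carry the topology, so that none is put on the carrier of [X] itself. *)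
Definition tau_type (X : psTop) : Type := X.

Section tau_topology.
Variable X : psTop.

Definition pst_open : set_system X :=
  [set O | forall F x, pst_cvg F x -> O x -> F O].

Let pst_openT : pst_open setT.
Proof. by move=> F x /pst_cvg_filter FF _; exact: filterT. Qed.

Let pst_openI : setI_closed pst_open.
Proof.
move=> O P oO oP F x Fx [Ox Px]; have FF := pst_cvg_filter Fx.
by apply: filterI; [exact: (oO _ _ Fx Ox)|exact: (oP _ _ Fx Px)].
Qed.

Let pst_open_bigU (I : Type) (O : I -> set X) :
  (forall i, pst_open (O i)) -> pst_open (\bigcup_i O i).
Proof.
move=> oO F x Fx [i _ Oix]; have FF := pst_cvg_filter Fx.
by apply: (@filterS _ F _ (O i)) (oO i _ _ Fx Oix) => y; exists i.
Qed.

HB.instance Definition _ := gen_eqMixin (tau_type X).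
HB.instance Definition _ := gen_choiceMixin (tau_type X).
HB.instance Definition _ :=
  isOpenTopological.Build (tau_type X) pst_openT pst_openI pst_open_bigU.

Definition tau : topologicalType := tau_type X.

Lemma tau_openE (O : set tau) : open O = pst_open O.
Proof. by []. Qed.

End tau_topology.

Lemma tau_unit_continuous (X : psTop) : @pst_continuous X (psTop_of_top (tau X)) id.
Proof.
move=> F x Fx; have FF := pst_cvg_filter Fx; split=> // A.
rewrite nbhsE => -[B [oB Bx] BA].
by apply: (@filterS _ F _ B) BA _; exact: oB Fx Bx.
Qed.

(** This is the adjunction: [tau] is left adjoint to the embedding of topological spaces. The
    universal properties below are all transported through it. *)
Lemma tau_continuousP (X : psTop) (T : topologicalType) (h : X -> T) :
  continuous (h : tau X -> T) <-> @pst_continuous X (psTop_of_top T) h.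
Proof.
split=> [ch|ch].
  apply: (pst_continuous_comp (@tau_unit_continuous X)).
  by apply/pst_continuous_top.
apply/continuousP => O oO; rewrite tau_openE => F x Fx Ohx.
have [_] := ch F x Fx; apply.
exact: open_nbhs_nbhs.
Qed.

Lemma tau_map_continuous (X Y : psTop) (f : X -> Y) :
  pst_continuous f -> continuous (f : tau X -> tau Y).
Proof.
move=> cf; apply/tau_continuousP.
exact: pst_continuous_comp cf (@tau_unit_continuous Y).
Qed.

Lemma tau_top_continuous (T : topologicalType) (Y : psTop) (f : T -> Y) :
  @pst_continuous (psTop_of_top T) Y f -> continuous (f : T -> tau Y).
Proof.
move=> cf; apply/pst_continuous_top.
exact: pst_continuous_comp cf (@tau_unit_continuous Y).
Qed.

(** The summands are spheres or disks, already topological, and must stay literally the same for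
    [top_CW_complex]; only the total space is modified. *)
Lemma tau_coproduct (I : Type) (A : topologicalType) (B : psTop)
    (inc : I -> A -> B) :
  @is_coproduct PsTopCat I (fun=> psTop_of_top A) B inc ->
  @is_coproduct TopCat I (fun=> A) (tau B) inc.
Proof.
move=> [cinc Binc]; split=> [i|Z u cu]; first exact/tau_top_continuous/cinc.
have [|h [[ch hu] huniq]] := Binc (psTop_of_top Z) u.
  by move=> i; apply/pst_continuous_top/cu.
exists h; split; first by split=> //; apply/tau_continuousP.
by move=> h' [ch' hu']; apply: huniq; split=> //; apply/tau_continuousP.
Qed.

Lemma tau_pushout (A B X Y : psTop) (f : A -> X) (j : A -> B) (k : X -> Y)
    (g : B -> Y) :
  @is_pushout PsTopCat A B X Y f j k g ->
  @is_pushout TopCat (tau A) (tau B) (tau X) (tau Y) f j k g.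
Proof.
move=> [[cf cj] [ck cg] kf univ].
split=> //; try by split; exact: tau_map_continuous.
move=> Z u v cu cv uv.
have [||h [[ch hu hv] hl]] := univ (psTop_of_top Z) u v _ _ uv.
- exact/tau_continuousP.
- exact/tau_continuousP.
exists h; split; first by split=> //; apply/tau_continuousP.
by move=> h' [ch' hu' hv']; apply: hl; split=> //; apply/tau_continuousP.
Qed.

Lemma tau_sequential_colimit (X : nat -> psTop) (k : forall n, X n -> X n.+1)
    (Y : psTop) (inc : forall n, X n -> Y) :
  @is_sequential_colimit PsTopCat X k Y inc ->
  @is_sequential_colimit TopCat (fun n => tau (X n)) k (tau Y) inc.
Proof.
move=> [ck cinc inck univ]; split=> [n|n|//|Z u cu uk].
- exact: (tau_map_continuous (ck n)).
- exact: (tau_map_continuous (cinc n)).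
have [|h [[ch hu] hl]] := univ (psTop_of_top Z) u _ uk.
  by move=> n; exact/tau_continuousP/cu.
exists h; split; first by split=> //; apply/tau_continuousP.
by move=> h' [ch' hu']; apply: hl; split=> //; apply/tau_continuousP.
Qed.

Lemma tau_CW (R : realType) (X : psTop) :
  psTop_CW_complex R X -> top_CW_complex R (tau X).
Proof.
move=> [sk [k [inc [sk0 att colim]]]].
exists (fun n => tau (sk n)), k, inc; split=> // [n|]; last first.
  exact: tau_sequential_colimit.
have [I [SI [DI [inS [inD [j [phi [Phi [cS cD jin po]]]]]]]]] := att n.
exists I, (tau SI), (tau DI), inS, inD, j, phi, Phi; split=> //.
- exact: tau_coproduct.
- exact: tau_coproduct.
- exact: tau_pushout.
Qed.

(** * Euclidean geometry *)

Lemma cvg_mx (T : Type) (U : topologicalType) (m n : nat) (F : set_system T)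
    (f : T -> 'M[U]_(m, n)) (l : 'M[U]_(m, n)) : Filter F ->
  (forall i j, (fun x => f x i j) @ F --> l i j) -> f @ F --> l.
Proof.
move=> FF fl A [P lP PA].
have FP i j : \forall x \near F, P i j (f x i j) by exact: (fl i j _ (lP i j)).
apply: filterS (filter_forall FF (fun i => filter_forall FF (FP i))) => x Px.
by apply: PA => i j; exact: Px.
Qed.

Lemma mx_continuous (S U : topologicalType) (m n : nat) (f : S -> 'M[U]_(m, n)) :
  (forall i j, continuous (fun x => f x i j)) -> continuous f.
Proof. by move=> cf x; apply: cvg_mx => i j; exact: cf. Qed.

Lemma pst_cvg_val (T : topologicalType) (A : set T) (F : set_system A) (x : A) :
  ProperFilter F -> (fun y : A => val y : T) @ F --> (val x : T) ->
  @pst_cvg (psTop_of_top A) F x.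
Proof.
move=> FF Fx; split=> // B; rewrite nbhsE => -[_ [[C oC <-] Cx] CB].
apply: filterS CB _; apply: Fx.
exact: open_nbhs_nbhs.
Qed.

Lemma val_continuous (T : topologicalType) (A : set T) :
  continuous (fun y : A => val y : T).
Proof. exact: initial_continuous. Qed.

Lemma subtype_continuous (S T : topologicalType) (A : set T) (f : S -> A) :
  continuous (fun x => val (f x) : T) -> continuous f.
Proof. by move=> cf; exact: continuous_comp_initial. Qed.

Lemma compact_subtype (T : topologicalType) (A : set T) :
  compact A -> compact [set: A].
Proof.
rewrite !compact_ultra => cA U UU _.
have UA : fmap (fun y : A => val y : T) U A.
  by rewrite /fmap /=; apply: (@filterS _ U _ setT) => [y _|];
     [exact: set_valP|exact: filterT].
have [x [Ax Ux]] := cA _ (fmap_ultra _ UU) UA.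
exists (exist _ x (mem_set Ax)); split=> // B xB.
by have [_] := @pst_cvg_val _ A U (exist _ x (mem_set Ax)) _ Ux; exact.
Qed.

Lemma hausdorff_subtype (T : topologicalType) (A : set T) :
  hausdorff_space T -> hausdorff_space A.
Proof.
move=> hT x y xy; apply: val_inj; apply: hT => B C xB yC.
have [z [Bz Cz]] := xy _ _ (val_continuous xB) (val_continuous yC).
by exists (val z).
Qed.

Lemma cvg_divr (R : realType) (T : Type) (F : set_system T) (f g : T -> R) (a b : R) :
  Filter F -> f @ F --> a -> g @ F --> b -> b != 0 ->
  (fun t => f t / g t) @ F --> a / b.
Proof. by move=> FF fa gb b0; apply: cvgM fa (cvgV b0 gb). Qed.

Section norms.
Variable R : realType.

(** The Euclidean norm; the norm [|x|] of row vectors is the sup norm. Disks and spheres are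
    Euclidean while cubes are balls of the sup norm, so both are needed. *)
Definition nrm n (x : 'rV[R]_n) : R := Num.sqrt (\sum_i x ord0 i ^+ 2).

Lemma nrm_sqr n (x : 'rV[R]_n) : nrm x ^+ 2 = \sum_i x ord0 i ^+ 2.
Proof. by rewrite sqr_sqrtr// sumr_ge0// => i _; exact: sqr_ge0. Qed.

Lemma nrm_ge0 n (x : 'rV[R]_n) : 0 <= nrm x.
Proof. exact: sqrtr_ge0. Qed.

Lemma nrmZ n a (x : 'rV[R]_n) : nrm (a *: x) = `|a| * nrm x.
Proof.
rewrite /nrm -sqrtr_sqr -sqrtrM ?sqr_ge0//; congr Num.sqrt.
by rewrite mulr_sumr; apply: eq_bigr => i _; rewrite mxE exprMn.
Qed.

Lemma coord_le_nrm n (x : 'rV[R]_n) i : `|x ord0 i| <= nrm x.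
Proof.
rewrite -sqrtr_sqr ler_sqrt; last by rewrite sumr_ge0// => j _; exact: sqr_ge0.
by rewrite (bigD1 i)//= lerDl sumr_ge0// => j _; exact: sqr_ge0.
Qed.

Lemma coord_le_norm n (x : 'rV[R]_n) i : `|x ord0 i| <= `|x|.
Proof.
rewrite [leRHS]/Num.norm /= mx_normrE.
by apply/bigmax_geP; right; exists (ord0, i).
Qed.

Lemma norm_le_coord n (x : 'rV[R]_n) e : 0 <= e ->
  (forall i, `|x ord0 i| <= e) -> `|x| <= e.
Proof.
move=> e0 xe; rewrite [leLHS]/Num.norm /= mx_normrE.
by apply/bigmax_leP; split=> // -[i j] _ /=; rewrite (ord1 i).
Qed.

Lemma norm_coord n (x : 'rV[R]_n) : x != 0 -> exists i, `|x| = `|x ord0 i|.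
Proof.
rewrite -normr_eq0 => x0; have [[i j]] := mx_norm_neq0 x0.
by rewrite /= (ord1 i) => xij; exists j.
Qed.

Lemma norm_le_nrm n (x : 'rV[R]_n) : `|x| <= nrm x.
Proof. by apply: norm_le_coord => [|i]; [exact: nrm_ge0|exact: coord_le_nrm]. Qed.

Lemma nrm_le_norm n (x : 'rV[R]_n) : nrm x <= Num.sqrt n%:R * `|x|.
Proof.
rewrite -[X in _ * X]normr_id -sqrtr_sqr -sqrtrM ?ler0n// ler_sqrt; last first.
  by rewrite mulr_ge0 ?sqr_ge0// ler0n.
have : \sum_i x ord0 i ^+ 2 <= \sum_(i < n) `|x| ^+ 2.
  apply: ler_sum => i _; rewrite -real_normK ?num_real//.
  by rewrite lerXn2r ?nnegrE//; exact: coord_le_norm.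
by rewrite sumr_const card_ord mulr_natl.
Qed.

Lemma nrm_eq0 n (x : 'rV[R]_n) : nrm x = 0 -> x = 0.
Proof.
by move=> x0; apply/eqP; rewrite -normr_eq0 eq_le normr_ge0 andbT -x0 norm_le_nrm.
Qed.

Lemma nrm0 n : nrm (0 : 'rV[R]_n) = 0.
Proof. by rewrite -(scale0r 0) nrmZ normr0 mul0r. Qed.

Lemma nrm_continuous n : continuous (@nrm n).
Proof.
have c2 : continuous (fun x : 'rV[R]_n => \sum_i x ord0 i ^+ 2).
  apply: continuous_big => [|i _ y]; first exact: add_continuous.
  by apply: (@cvgM R _ (nbhs y)); exact: coord_continuous.
by move=> x; apply: continuous_comp (c2 x) _; exact: sqrt_continuous.
Qed.

Lemma diskE n (x : 'rV[R]_n) : disk R n x <-> nrm x <= 1.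
Proof.
rewrite /disk /= -nrm_sqr; split=> h; last by rewrite expr_le1 ?nrm_ge0.
have : nrm x ^+ 2 <= 1 ^+ 2 by rewrite expr1n.
by rewrite ler_pXn2r ?nnegrE ?nrm_ge0.
Qed.

Lemma sphereE n (x : 'rV[R]_n) : sphere R n x <-> nrm x = 1.
Proof.
rewrite /sphere /= -nrm_sqr; split=> [h|->]; last by rewrite expr1n.
by apply/eqP; rewrite -(@eqrXn2 _ 2) ?nrm_ge0// h expr1n.
Qed.

(** Convexity of the square, coordinate by coordinate: the defect is (1 - t) t (x_i - y_i)^2. No
    triangle inequality for [nrm] is involved. *)
Lemma nrm_conv_le1 n (x y : 'rV[R]_n) t : 0 <= t <= 1 ->
  nrm x <= 1 -> nrm y <= 1 -> nrm ((1 - t) *: x + t *: y) <= 1.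
Proof.
move=> /andP[t0 t1] /diskE x1 /diskE y1; apply/diskE; rewrite /disk /=.
apply: (@le_trans _ _ (\sum_i ((1 - t) * x ord0 i ^+ 2 + t * y ord0 i ^+ 2))).
  apply: ler_sum => i _; rewrite !mxE.
  have h : 0 <= (1 - t) * t * (x ord0 i - y ord0 i) ^+ 2.
    by rewrite mulr_ge0 ?sqr_ge0// mulr_ge0// subr_ge0.
  rewrite -subr_ge0; apply: le_trans h _.
  by rewrite le_eqVlt; apply/orP; left; apply/eqP; ring.
rewrite big_split /= -!mulr_sumr.
rewrite -[leRHS](subrK t) lerD//; [rewrite -[leRHS]mulr1|rewrite -[leRHS]mulr1].
  by rewrite ler_wpM2l ?subr_ge0.
by rewrite ler_wpM2l.
Qed.

Lemma rV_hausdorff n : hausdorff_space 'rV[R]_n.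
Proof. exact: norm_hausdorff. Qed.

Lemma disk_hausdorff n : hausdorff_space (disk R n).
Proof. exact/hausdorff_subtype/rV_hausdorff. Qed.

Lemma bounded_nrm n (A : set 'rV[R]_n) : (forall x, A x -> nrm x <= 1) ->
  bounded_set A.
Proof.
move=> A1; exists 1; split; first exact: num_real.
by move=> M M1 x /A1 x1; apply: le_trans (ltW M1); exact: le_trans (norm_le_nrm x) x1.
Qed.

Lemma disk_compact n : compact [set: disk R n].
Proof.
apply: compact_subtype; apply: bounded_closed_compact.
  by apply: bounded_nrm => x /diskE.
rewrite (_ : disk R n = @nrm n @^-1` [set r | r <= 1]).
  by apply: preimage_closed; [move=> x _; exact: nrm_continuous|exact: closed_le].
by apply/seteqP; split=> x /diskE.
Qed.

Lemma sphere_compact n : compact [set: sphere R n].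
Proof.
apply: compact_subtype; apply: bounded_closed_compact.
  by apply: bounded_nrm => x /sphereE ->.
rewrite (_ : sphere R n = @nrm n @^-1` [set r | r = 1]).
  by apply: preimage_closed; [move=> x _; exact: nrm_continuous|exact: closed_eq].
by apply/seteqP; split=> x /sphereE.
Qed.

Section radial.
Variables (n : nat) (p q : 'rV[R]_n -> R) (C : R).
Hypotheses (cp : continuous p) (cq : continuous q).
Hypotheses (pZ : forall a x, p (a *: x) = `|a| * p x)
  (qZ : forall a x, q (a *: x) = `|a| * q x).
Hypotheses (p0 : forall x, p x = 0 -> x = 0) (q0 : forall x, q x = 0 -> x = 0).
Hypotheses (p_ge0 : forall x, 0 <= p x) (q_ge0 : forall x, 0 <= q x).
Hypotheses (qC : forall x : 'rV[R]_n, `|x| <= C * q x).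

(** Rescales every ray so that the unit ball of [p] is carried to that of [q]. At 0 the quotient is
    a default value, harmless because it multiplies the zero vector. *)
Definition radial (x : 'rV[R]_n) := (p x / q x) *: x.

Let p00 : p 0 = 0. Proof. by rewrite -(scale0r 0) pZ normr0 mul0r. Qed.
Let q00 : q 0 = 0. Proof. by rewrite -(scale0r 0) qZ normr0 mul0r. Qed.

Lemma radial_val x : q (radial x) = p x.
Proof.
have [->|x0] := eqVneq x 0; first by rewrite /radial scaler0 p00 q00.
have qx0 : q x != 0 by apply/eqP => /q0 /eqP; exact/negP.
by rewrite qZ ger0_norm ?divfK// divr_ge0.
Qed.

(** Away from 0 this is continuity of quotients. At 0 the quotient p / q need not have a limit, but
    the bound by C gives [|radial x| <= C * p x]. *)
Lemma radial_continuous : continuous radial.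
Proof.
move=> x; have [->|x0] := eqVneq x 0; last first.
  have qx0 : q x != 0 by apply/eqP => /q0 /eqP; exact/negP.
  have cpq : (fun y => p y / q y) @ x --> p x / q x.
    exact: (cvg_divr _ (@cp x) (@cq x)).
  exact: cvgZ cpq cvg_id.
rewrite /continuous_at [radial 0]scaler0.
apply/(@norm_cvg0P _ _ _ (nbhs (0 : 'rV[R]_n))).
have h : (fun x : 'rV[R]_n => C * p x) @ (0 : 'rV[R]_n) --> (0 : R).
  rewrite -[X in _ --> X](mulr0 C) -p00.
  exact: cvgM (cvg_cst _) (@cp 0).
apply: squeeze_cvgr (cvg_cst (0 : R)) h.
apply: nearW => y; rewrite normr_ge0 /=.
have [->|y0] := eqVneq y 0.
  by rewrite /radial scaler0 normr0 p00 mulr0.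
have qy0 : q y != 0 by apply/eqP => /q0 /eqP; exact/negP.
rewrite normrZ ger0_norm ?divr_ge0//.
rewrite -[p y in leRHS](divfK qy0) mulrCA ler_wpM2l ?divr_ge0//.
Qed.

End radial.

Lemma radialK n (p q : 'rV[R]_n -> R) :
  (forall a x, p (a *: x) = `|a| * p x) -> (forall a x, q (a *: x) = `|a| * q x) ->
  (forall x, p x = 0 -> x = 0) -> (forall x, q x = 0 -> x = 0) ->
  (forall x, 0 <= p x) -> (forall x, 0 <= q x) ->
  cancel (radial p q) (radial q p).
Proof.
move=> pZ qZ p0 q0 p_ge0 q_ge0 x.
have [->|x0] := eqVneq x 0; first by rewrite /radial !scaler0.
have qx0 : q x != 0 by apply/eqP => /q0 /eqP; exact/negP.
have px0 : p x != 0 by apply/eqP => /p0 /eqP; exact/negP.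
rewrite {1}/radial (radial_val pZ qZ)// /radial pZ ger0_norm ?divr_ge0// scalerA.
rewrite (_ : _ * _ = 1) ?scale1r//.
by field; rewrite qx0 px0.
Qed.

End norms.

Definition set_sub (T : Type) (A : set T) (x : T) (Ax : x \in A) : A :=
  exist (fun x => x \in A) x Ax.

(** * Cubes and cylinders as disks *)

Section ball_homeo.
Variable R : realType.

Lemma coord_val_continuous n (A : set 'rV[R]_n) (j : 'I_n) :
  continuous (fun s : A => val s ord0 j).
Proof.
move=> s; apply: (@continuous_comp _ _ _ (fun s : A => val s)
  (fun x : 'rV[R]_n => x ord0 j)); first exact: val_continuous.
exact: coord_continuous.
Qed.

(** Carries lifting problems stated for a disk and its sphere over to cubes and to cylinders with
    their boundaries. *)
Record ball_homeo (T : topologicalType) (B : set T) (k : nat) := BallHomeo {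
  to_disk : T -> disk R k;
  of_disk : disk R k -> T;
  to_disk_continuous : continuous to_disk;
  of_disk_continuous : continuous of_disk;
  to_diskK : cancel to_disk of_disk;
  of_diskK : cancel of_disk to_disk;
  to_disk_boundary : forall s, B s <-> nrm (val (to_disk s)) = 1 }.

Definition to_euclid n := @radial R n (fun x => `|x|) (@nrm R n).
Definition to_sup n := @radial R n (@nrm R n) (fun x => `|x|).

Lemma nrm_to_euclid n (x : 'rV[R]_n) : nrm (to_euclid x) = `|x|.
Proof.
rewrite /to_euclid radial_val//; [exact: normrZ|exact: nrmZ|exact: nrm_eq0|].
exact: nrm_ge0.
Qed.

Lemma norm_to_sup n (x : 'rV[R]_n) : `|to_sup x| = nrm x.
Proof.
rewrite /to_sup (@radial_val _ _ _ (fun x => `|x|))//;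
  [exact: nrmZ|exact: normrZ|exact: normr0_eq0|exact: nrm_ge0].
Qed.

Lemma to_euclid_continuous n : continuous (@to_euclid n).
Proof.
apply: (@radial_continuous _ _ _ _ 1) => //.
- exact: norm_continuous.
- exact: nrm_continuous.
- exact: normrZ.
- exact: nrm_eq0.
- exact: nrm_ge0.
- by move=> x; rewrite mul1r; exact: norm_le_nrm.
Qed.

Lemma to_sup_continuous n : continuous (@to_sup n).
Proof.
apply: (@radial_continuous _ _ _ _ 1) => //.
- exact: nrm_continuous.
- exact: norm_continuous.
- exact: nrmZ.
- by move=> x /normr0_eq0.
- exact: nrm_ge0.
- by move=> x; rewrite mul1r.
Qed.

Lemma to_euclidK n : cancel (@to_euclid n) (@to_sup n).
Proof.
apply: radialK => //; [exact: normrZ|exact: nrmZ| |exact: nrm_eq0|exact: nrm_ge0].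
by move=> x /normr0_eq0.
Qed.

Lemma to_supK n : cancel (@to_sup n) (@to_euclid n).
Proof.
apply: radialK => //; [exact: nrmZ|exact: normrZ|exact: nrm_eq0| |exact: nrm_ge0].
by move=> x /normr0_eq0.
Qed.

(** The affine map from the cube to the unit ball of the sup norm; [to_euclid] then carries that
    ball to the disk. *)
Definition center n (x : 'rV[R]_n) : 'rV[R]_n := 2 *: x - const_mx 1.
Definition uncenter n (x : 'rV[R]_n) : 'rV[R]_n := 2^-1 *: (x + const_mx 1).

Lemma centerK n : cancel (@center n) (@uncenter n).
Proof.
move=> x; rewrite /center /uncenter subrK scalerA mulVf ?scale1r// pnatr_eq0.
Qed.

Lemma uncenterK n : cancel (@uncenter n) (@center n).
Proof.
move=> x; rewrite /center /uncenter scalerA mulfV ?scale1r ?addrK// pnatr_eq0.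
Qed.

Lemma center_continuous n : continuous (@center n).
Proof.
move=> x; apply: (@cvgB _ _ _ (nbhs (x : 'rV[R]_n))); last exact: cvg_cst.
by apply: (@cvgZ _ _ _ (nbhs (x : 'rV[R]_n))); [exact: cvg_cst|exact: cvg_id].
Qed.

Lemma uncenter_continuous n : continuous (@uncenter n).
Proof.
move=> x; apply: (@cvgZ _ _ _ (nbhs (x : 'rV[R]_n))); first exact: cvg_cst.
by apply: (@cvgD _ _ _ (nbhs (x : 'rV[R]_n))); [exact: cvg_id|exact: cvg_cst].
Qed.

Lemma center_coord n (x : 'rV[R]_n) i : center x ord0 i = 2 * x ord0 i - 1.
Proof. by rewrite !mxE. Qed.

Lemma center_coord_le1 n (x : 'rV[R]_n) i :
  (`|center x ord0 i| <= 1) = (0 <= x ord0 i <= 1).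
Proof.
rewrite center_coord ler_norml; apply/andP/andP => -[h1 h2]; split; lra.
Qed.

Lemma center_norm_le1 n (x : 'rV[R]_n) : `|center x| <= 1 <-> cube R n x.
Proof.
split=> [x1 i|x1]; last first.
  by apply: norm_le_coord => // i; rewrite center_coord_le1.
by rewrite -center_coord_le1; apply: le_trans x1; exact: coord_le_norm.
Qed.

Lemma center_norm_eq1 n (x : 'rV[R]_n) : cube R n x ->
  `|center x| = 1 <-> exists i, x ord0 i = 0 \/ x ord0 i = 1.
Proof.
move=> x01; split=> [x1|[i xi]].
  have x0 : center x != 0 by rewrite -normr_eq0 x1 oner_neq0.
  have [i] := norm_coord x0; rewrite x1 center_coord => /esym/eqP.
  by rewrite eqr_norml => /andP[/orP[] /eqP h _]; exists i; [right|left]; lra.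
apply/eqP; rewrite eq_le (center_norm_le1 x).2//=.
apply: le_trans (coord_le_norm _ i); rewrite center_coord.
by case: xi => ->; rewrite ?mulr0 ?mulr1 ?sub0r ?normrN ?normr1// addrK normr1.
Qed.

Lemma cube_to_disk_subproof n (s : cube R n) :
  to_euclid (center (val s)) \in disk R n.
Proof.
by apply/mem_set/diskE; rewrite nrm_to_euclid; apply/center_norm_le1; exact: set_valP.
Qed.

Lemma disk_to_cube_subproof n (d : disk R n) :
  uncenter (to_sup (val d)) \in cube R n.
Proof.
apply/mem_set/center_norm_le1; rewrite uncenterK norm_to_sup.
by apply/diskE; exact: set_valP.
Qed.

Lemma cube_ball n : ball_homeo (@cube_boundary R n) n.
Proof.
pose f (s : cube R n) : disk R n := set_sub (cube_to_disk_subproof s).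
pose g (d : disk R n) : cube R n := set_sub (disk_to_cube_subproof d).
apply: (@BallHomeo _ _ _ f g).
- apply: subtype_continuous => s.
  apply: (continuous_comp (f := fun s : cube R n => center (val s)));
    last exact: to_euclid_continuous.
  by apply: continuous_comp; [exact: val_continuous|exact: center_continuous].
- apply: subtype_continuous => d.
  apply: (continuous_comp (f := fun d : disk R n => to_sup (val d)));
    last exact: uncenter_continuous.
  by apply: continuous_comp; [exact: val_continuous|exact: to_sup_continuous].
- by move=> s; apply: val_inj; rewrite /= to_euclidK centerK.
- by move=> s; apply: val_inj; rewrite /= uncenterK to_supK.
- move=> s; rewrite /cube_boundary /= nrm_to_euclid; apply: iff_sym.
  by apply: center_norm_eq1; exact: set_valP.
Qed.

Definition cyl_boundary n : set (cube R n * unitI R)%type :=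
  [set p | cube_boundary p.1 \/ val p.2 = 0 \/ val p.2 = 1].

Lemma cyl_to_cube_subproof n (p : (cube R n * unitI R)%type) :
  (\row_(j < n.+1) if unlift ord0 j is Some i then val p.1 ord0 i else val p.2)
    \in cube R n.+1.
Proof.
apply/mem_set => j; rewrite mxE; case: unliftP => [i _|_].
  exact: (set_valP p.1).
by have := set_valP p.2; rewrite /unitI /= in_itv.
Qed.

Lemma cube_tail_subproof n (s : cube R n.+1) :
  (\row_(i < n) val s ord0 (lift ord0 i)) \in cube R n.
Proof. by apply/mem_set => i; rewrite mxE; exact: (set_valP s). Qed.

Lemma cube_head_subproof n (s : cube R n.+1) : val s ord0 ord0 \in unitI R.
Proof. by apply/mem_set; rewrite /unitI /= in_itv /=; exact: (set_valP s). Qed.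

(** The cylinder over an n-cube is an (n + 1)-cube with time as coordinate [ord0]. The two ends and
    the side together are the boundary of that cube. *)
Lemma cyl_ball n : ball_homeo (@cyl_boundary n) n.+1.
Proof.
have h := cube_ball n.+1.
pose f (p : (cube R n * unitI R)%type) : cube R n.+1 :=
  set_sub (cyl_to_cube_subproof p).
pose g (s : cube R n.+1) : (cube R n * unitI R)%type :=
  (set_sub (cube_tail_subproof s), set_sub (cube_head_subproof s)).
have fK : cancel f g.
  move=> [s t]; congr pair; apply: val_inj => /=.
    by apply/rowP => i; rewrite !mxE liftK.
  by rewrite !mxE unlift_none.
have gK : cancel g f.
  move=> s; apply: val_inj => /=; apply/rowP => j; rewrite !mxE.
  by case: unliftP => [i ->|->] //=; rewrite mxE.
have cf : continuous f.
  apply: subtype_continuous => p; apply: cvg_mx => i j.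
  under eq_fun do rewrite mxE.
  rewrite mxE; case: unliftP => [i' _|_].
    apply: (@continuous_comp _ _ _ (fun p : (cube R n * unitI R)%type => val p.1)
      (fun x : 'rV[R]_n => x ord0 i')).
      by apply: continuous_comp; [exact: cvg_fst|exact: val_continuous].
    exact: coord_continuous.
  by apply: continuous_comp; [exact: cvg_snd|exact: val_continuous].
have cg1 : continuous (fun s => (g s).1).
  apply: subtype_continuous; apply: mx_continuous => i j.
  under eq_fun do rewrite mxE.
  exact: coord_val_continuous.
have cg2 : continuous (fun s => (g s).2).
  exact/subtype_continuous/coord_val_continuous.
have cg : continuous g by move=> s; exact: (cvg_pair (@cg1 s) (@cg2 s)).
apply: (@BallHomeo _ _ _ (to_disk h \o f) (g \o of_disk h)).
- by move=> p; apply: continuous_comp; [exact: cf|exact: to_disk_continuous].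
- by move=> p; apply: continuous_comp; [exact: of_disk_continuous|exact: cg].
- by move=> p /=; rewrite to_diskK fK.
- by move=> d /=; rewrite gK of_diskK.
- move=> p; rewrite /= -to_disk_boundary /cyl_boundary /cube_boundary /=; split.
    case=> [[i pi]|pt]; first by exists (lift ord0 i); rewrite mxE liftK.
    by exists ord0; rewrite mxE unlift_none.
  by case=> j; rewrite mxE; case: unliftP => [i _ pi|_ pt]; [left; exists i|right].
Qed.

End ball_homeo.

(** * Homotopies *)

(** Continuity of the restriction to [A], expressed with ultrafilters on [T] that contain [A]. Maps
    stay total, and their values off [A] are irrelevant. *)
Definition cont_on (T : topologicalType) (X : psTop) (A : set T) (f : T -> X) :=
  forall U x, UltraFilter U -> U A -> A x -> @pst_cvg (psTop_of_top T) U x ->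
    pst_cvg (fmap f U) (f x).

Section cont_on.
Variables (T : topologicalType) (X : psTop).
Implicit Types (A C : set T) (f g : T -> X).

Lemma cont_onT f : cont_on setT f <-> @pst_continuous (psTop_of_top T) X f.
Proof.
split=> [cf|/pst_continuousP cf U x UU _ _]; last exact: cf.
by apply/pst_continuousP => U x UU; apply: cf => //; exact: filterT.
Qed.

Lemma cont_onS A C f : A `<=` C -> cont_on C f -> cont_on A f.
Proof.
move=> AC cf U x UU UA Ax; apply: cf => //; last exact: (AC x Ax).
exact: filterS AC UA.
Qed.

Lemma pst_cont_on A f : @pst_continuous (psTop_of_top T) X f -> cont_on A f.
Proof. by move=> /cont_onT; exact: cont_onS. Qed.

Lemma cont_on_eq A f g : (forall x, A x -> f x = g x) -> cont_on A f -> cont_on A g.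
Proof.
move=> fg cf U x UU UA Ax Ux; rewrite -fg// (_ : fmap g U = fmap f U).
  exact: cf.
by apply: (fmap_eq_on _ UA) => y Ay; rewrite fg.
Qed.

(** An ultrafilter contains [A] or [C], and its limit lies in the same set because that set is
    closed. *)
Lemma cont_on_glue A C D f : closed A -> closed C -> A `|` C = setT ->
  cont_on (D `&` A) f -> cont_on (D `&` C) f -> cont_on D f.
Proof.
move=> cA cC AC fA fC U x UU UD Dx Ux.
have [UA|UC] : U A \/ U C by apply: ultra_setU; rewrite AC; exact: filterT.
  apply: fA => //; first exact: filterI.
  by split=> //; exact: closed_pst_cvg Ux UA.
apply: fC => //; first exact: filterI.
by split=> //; exact: closed_pst_cvg Ux UC.
Qed.

Lemma pst_glue A C f g h : closed A -> closed C -> A `|` C = setT ->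
  @pst_continuous (psTop_of_top T) X f -> @pst_continuous (psTop_of_top T) X g ->
  (forall x, A x -> f x = h x) -> (forall x, C x -> g x = h x) ->
  @pst_continuous (psTop_of_top T) X h.
Proof.
move=> cA cC AC cf cg fh gh; apply/cont_onT.
apply: (cont_on_glue cA cC AC); rewrite setTI.
  by apply: cont_on_eq fh _; exact: pst_cont_on.
by apply: cont_on_eq gh _; exact: pst_cont_on.
Qed.

End cont_on.

Lemma pst_comp_top (S T : topologicalType) (X : psTop) (f : S -> T) (g : T -> X) :
  continuous f -> @pst_continuous (psTop_of_top T) X g ->
  @pst_continuous (psTop_of_top S) X (fun s => g (f s)).
Proof.
by move=> cf; apply: pst_continuous_comp; apply/pst_continuous_top.
Qed.

Lemma pair_continuous (S T U : topologicalType) (f : S -> T) (g : S -> U) :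
  continuous f -> continuous g -> continuous (fun s => (f s, g s)).
Proof. by move=> cf cg s; exact: (cvg_pair (@cf s) (@cg s)). Qed.

Lemma closed_le_fun (R : realType) (T : topologicalType) (f g : T -> R) :
  continuous f -> continuous g -> closed [set x | f x <= g x].
Proof.
move=> cf cg; rewrite (_ : [set _ | _] = (fun x => f x - g x) @^-1` [set r | r <= 0]).
  apply: preimage_closed; last exact: closed_le.
  by move=> x _; exact: (cvgB (@cf x) (@cg x)).
by apply/seteqP; split=> x /=; rewrite subr_le0.
Qed.

Section unit_interval.
Variable R : realType.

(** This is min(max(r, 0), 1), written with absolute values so that continuity is immediate. *)
Definition clampr (r : R) : R := 2^-1 * (1 + `|r| - `|1 - r|).

Lemma clampr_id r : 0 <= r <= 1 -> clampr r = r.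
Proof.
move=> /andP[r0 r1]; rewrite /clampr ger0_norm// ger0_norm ?subr_ge0//; by field.
Qed.

Lemma clampr_in r : clampr r \in unitI R.
Proof.
apply/mem_set; rewrite /unitI /= in_itv /= /clampr.
by case: (ger0P r) => r0; case: (ger0P (1 - r)) => r1; apply/andP; split; lra.
Qed.

Definition clampI (r : R) : unitI R := set_sub (clampr_in r).

Lemma unitIP (t : unitI R) : 0 <= val t <= 1.
Proof. by have := set_valP t; rewrite /unitI /= in_itv. Qed.

Lemma val_clampI r : 0 <= r <= 1 -> val (clampI r) = r.
Proof. exact: clampr_id. Qed.

Lemma clampI_continuous : continuous clampI.
Proof.
apply: subtype_continuous => r; apply: cvgM; first exact: cvg_cst.
apply: cvgB; last by apply: cvg_norm; apply: cvgB; [exact: cvg_cst|exact: cvg_id].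
by apply: cvgD; [exact: cvg_cst|apply: cvg_norm; exact: cvg_id].
Qed.

(** Homotopy relative to [B]. In contrast with [homotopic], the maps need not be constant on [B],
    and [B] may be empty; paths, free homotopies and homotopies of loops are all instances. *)
Definition hrel (T : topologicalType) (B : set T) (X : psTop) (a b : T -> X) :=
  exists H : (T * unitI R)%type -> X,
    [/\ @pst_continuous (psTop_of_top (T * unitI R)%type) X H,
      forall s t, val t = 0 -> H (s, t) = a s,
      forall s t, val t = 1 -> H (s, t) = b s &
      forall s t, B s -> H (s, t) = a s].

Section hrel.
Variables (T : topologicalType) (B : set T) (X : psTop).
Implicit Types a b c : T -> X.

Let snd_cont : continuous (fun p : T * unitI R => val p.2).
Proof. by move=> p; apply: continuous_comp; [exact: cvg_snd|exact: val_continuous]. Qed.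

Let fst_cont : continuous (@fst T (unitI R)).
Proof. by move=> p; exact: cvg_fst. Qed.

Lemma hrel_refl a : @pst_continuous (psTop_of_top T) X a -> hrel B a a.
Proof.
by move=> ca; exists (a \o fst); split=> //; exact: (pst_comp_top fst_cont ca).
Qed.

Lemma hrel_continuous a b : hrel B a b ->
  @pst_continuous (psTop_of_top T) X a /\ @pst_continuous (psTop_of_top T) X b.
Proof.
move=> [H [cH H0 H1 _]]; split.
  apply: (@pst_continuous_eq (psTop_of_top T) _ (fun s : T => H (s, clampI 0))).
    by move=> s; rewrite H0// val_clampI// lexx ler01.
  by apply: pst_comp_top cH; apply: pair_continuous => s; [exact: cvg_id|exact: cvg_cst].
apply: (@pst_continuous_eq (psTop_of_top T) _ (fun s : T => H (s, clampI 1))).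
  by move=> s; rewrite H1// val_clampI// lexx ler01.
by apply: pst_comp_top cH; apply: pair_continuous => s; [exact: cvg_id|exact: cvg_cst].
Qed.

Lemma hrel_eq_on a b s : hrel B a b -> B s -> a s = b s.
Proof.
move=> [H [_ _ H1 HB]] Bs; rewrite -(HB s (clampI 1) Bs) H1//.
by rewrite val_clampI// lexx ler01.
Qed.

Lemma hrel_sym a b : hrel B a b -> hrel B b a.
Proof.
move=> ab; have := ab; move=> [H [cH H0 H1 HB]].
exists (fun p => H (p.1, clampI (1 - val p.2))); split=> [|s t t0|s t t1|s t Bs] /=.
- apply: pst_comp_top cH; apply: pair_continuous => // p.
  apply: continuous_comp; last exact: clampI_continuous.
  by apply: (@cvgB _ _ _ (nbhs (p : (T * unitI R)%type))); [exact: cvg_cst|exact: snd_cont].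
- by rewrite H1// t0 subr0 val_clampI// lexx ler01.
- by rewrite H0// t1 subrr val_clampI// lexx ler01.
- by rewrite HB// (hrel_eq_on ab Bs).
Qed.

Lemma hrel_trans a b c : hrel B a b -> hrel B b c -> hrel B a c.
Proof.
move=> ab; have := ab; move=> [H [cH H0 H1 HB]] [K [cK K0 K1 KB]].
pose L (p : T * unitI R) := if val p.2 <= 2^-1 then H (p.1, clampI (2 * val p.2))
            else K (p.1, clampI (2 * val p.2 - 1)).
have half_cont : continuous (fun p : T * unitI R => 2 * val p.2).
  move=> p; apply: (@cvgM _ _ (nbhs (p : (T * unitI R)%type))); first exact: cvg_cst.
  exact: snd_cont.
exists L; split=> [|s t t0|s t t1|s t Bs]; rewrite /L /=.
- apply: (@pst_glue _ _ [set p : T * unitI R | val p.2 <= 2^-1]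
    [set p : T * unitI R | 2^-1 <= val p.2]
    (fun p => H (p.1, clampI (2 * val p.2)))
    (fun p => K (p.1, clampI (2 * val p.2 - 1)))).
  + by apply: closed_le_fun => // p; exact: cvg_cst.
  + by apply: closed_le_fun => // p; exact: cvg_cst.
  + apply/seteqP; split=> // p _ /=; case: (lerP (val p.2) 2^-1) => h; [by left|right].
    exact: ltW.
  + apply: pst_comp_top cH; apply: pair_continuous => // p.
    by apply: continuous_comp; [exact: half_cont|exact: clampI_continuous].
  + apply: pst_comp_top cK; apply: pair_continuous => // p.
    apply: continuous_comp; last exact: clampI_continuous.
    by apply: (@cvgB _ _ _ (nbhs (p : (T * unitI R)%type))); [exact: half_cont|exact: cvg_cst].
  + by move=> p /= ->.
  + move=> [s t] /= th; case: ifPn => // th'.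
    have -> : val t = 2^-1 by apply/le_anti/andP.
    by rewrite divff ?pnatr_eq0// subrr H1 ?K0// val_clampI// lexx ler01.
- by rewrite t0 invr_ge0 ler0n mulr0 H0// val_clampI// lexx ler01.
- rewrite t1 ifN; last by rewrite -ltNge invf_lt1// ltr1n.
  by rewrite K1// val_clampI; lra.
- by case: ifP => _; [rewrite HB|rewrite KB// (hrel_eq_on ab)].
Qed.

Lemma hrel_comp (Y : psTop) (f : X -> Y) a b : pst_continuous f ->
  hrel B a b -> hrel B (f \o a) (f \o b).
Proof.
move=> cf [H [cH H0 H1 HB]]; exists (f \o H); split.
- exact: pst_continuous_comp cH cf.
- by move=> s t t0 /=; rewrite H0.
- by move=> s t t1 /=; rewrite H1.
- by move=> s t Bs /=; rewrite HB.
Qed.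

End hrel.

Lemma hrel_pre (S T : topologicalType) (B : set T) (X : psTop) (a b : T -> X)
    (C : set S) (g : S -> T) : continuous g -> (forall s, C s -> B (g s)) ->
  hrel B a b -> hrel C (a \o g) (b \o g).
Proof.
move=> cg CB [H [cH H0 H1 HB]]; exists (fun p => H (g p.1, p.2)); split.
- apply: pst_comp_top cH; apply: pair_continuous => p; last exact: cvg_snd.
  by apply: continuous_comp; [exact: cvg_fst|exact: cg].
- by move=> s t t0 /=; rewrite H0.
- by move=> s t t1 /=; rewrite H1.
- by move=> s t Cs /=; rewrite HB//; exact: CB.
Qed.

End unit_interval.

(** * The weak lifting property and what it implies *)

Section criterion.
Variable R : realType.

Definition disk_boundary k : set (disk R k) := [set d | nrm (val d) = 1].
Arguments disk_boundary : clear implicits.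

Lemma disk_boundary_sphere k (s : sphere R k) :
  disk_boundary k (sphere_disk s).
Proof. by apply/sphereE; exact: (set_valP s). Qed.

Lemma disk_boundaryP k (d : disk R k) :
  disk_boundary k d -> exists s : sphere R k, sphere_disk s = d.
Proof.
move=> d1; have ds : val d \in sphere R k by apply/mem_set/sphereE.
by exists (set_sub ds); apply: val_inj.
Qed.

Definition weak_lift (X Y : psTop) (f : Y -> X) : Prop :=
  forall k (a : sphere R k -> Y) (H : disk R k -> X),
    @pst_continuous (psTop_of_top (sphere R k)) Y a ->
    @pst_continuous (psTop_of_top (disk R k)) X H ->
    (forall s, H (sphere_disk s) = f (a s)) ->
    exists G : disk R k -> Y,
      [/\ @pst_continuous (psTop_of_top (disk R k)) Y G,
        forall s, G (sphere_disk s) = a s &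
        hrel R (disk_boundary k) (f \o G) H].

Section weak_lift.
Variables (X Y : psTop) (f : Y -> X).
Hypotheses (cf : pst_continuous f) (lf : weak_lift f).

Lemma weak_lift_ball (T : topologicalType) (B : set T) k (a : T -> Y) (H : T -> X) :
  ball_homeo R B k -> cont_on B a -> @pst_continuous (psTop_of_top T) X H ->
  (forall s, B s -> H s = f (a s)) ->
  exists G : T -> Y, [/\ @pst_continuous (psTop_of_top T) Y G,
    forall s, B s -> G s = a s & hrel R B (f \o G) H].
Proof.
move=> h ca cH Ha.
have Bof (s : sphere R k) : B (of_disk h (sphere_disk s)).
  by apply/(to_disk_boundary h); rewrite of_diskK; exact: disk_boundary_sphere.
have cof : continuous (fun s : sphere R k => of_disk h (sphere_disk s)).
  have /pst_continuous_top csd := @sphere_disk_continuous R k.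
  by move=> s; apply: continuous_comp; [exact: csd|exact: of_disk_continuous].
have [||s|G [cG Ga GH]] := @lf k (fun s => a (of_disk h (sphere_disk s)))
    (H \o of_disk h).
- apply/pst_continuousP => U s UU Us.
  rewrite (_ : fmap _ U = fmap a (fmap (fun s => of_disk h (sphere_disk s)) U))//.
  apply: ca => //.
  + exact: fmap_ultra.
  + by apply: (@filterS _ U _ setT) => [t _|]; [exact: Bof|exact: filterT].
  + by move/pst_continuous_top: cof; exact.
- exact: pst_comp_top (@of_disk_continuous _ _ _ _ h) cH.
- by rewrite /= Ha.
exists (G \o to_disk h); split.
- exact: pst_comp_top (@to_disk_continuous _ _ _ _ h) cG.
- move=> s Bs; have [t ts] := disk_boundaryP ((to_disk_boundary h s).1 Bs).
  by rewrite /= -ts Ga ts to_diskK.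
have -> : H = (H \o of_disk h) \o to_disk h.
  by apply/funext => s /=; rewrite to_diskK.
apply: hrel_pre GH; first exact: to_disk_continuous.
by move=> s /(to_disk_boundary h).
Qed.

(** The 0-cube is a point without boundary, so a path is a homotopy of constant maps. Symmetry and
    transitivity of paths then follow from those of [hrel]. *)
Lemma path_relatedP (Z : psTop) (x y : Z) : path_related R x y <->
  hrel R set0 (fun _ : cube R 0 => x) (fun=> y).
Proof.
split=> [[g [cg g0 g1]]|[H [cH H0 H1 _]]].
  exists (g \o snd); split=> [|s t t0|s t t1|s t []]; [|exact: g0|exact: g1].
  by apply: pst_comp_top cg => p; exact: cvg_snd.
have s0 : (0 : 'rV[R]_0) \in cube R 0 by apply/mem_set => -[].
exists (fun t => H (set_sub s0, t)); split; [|exact: H0|exact: H1].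
apply: pst_comp_top cH; apply: pair_continuous; first exact: cst_continuous.
by move=> t; exact: cvg_id.
Qed.

Lemma path_refl (Z : psTop) (x : Z) : path_related R x x.
Proof. by apply/path_relatedP/hrel_refl; exact: pst_continuous_cst. Qed.

Lemma path_related_eq (Z : psTop) (x y : Z) :
  path_related R x y <-> path_related R x = path_related R y.
Proof.
split=> [/path_relatedP xy|->]; last exact: path_refl.
apply/seteqP; split=> z /path_relatedP h; apply/path_relatedP.
  exact: hrel_trans (hrel_sym xy) h.
exact: hrel_trans xy h.
Qed.

Lemma path_related_map (x y : Y) : path_related R x y -> path_related R (f x) (f y).
Proof. by move=> /path_relatedP xy; apply/path_relatedP; exact: (hrel_comp cf xy). Qed.

Lemma path_components_map_class (x : Y) :
  path_components_map R f (path_related R x) = path_related R (f x).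
Proof.
apply/seteqP; split=> [z [y xy fyz]|z fxz]; last by exists x => //; exact: path_refl.
by move/path_related_map/path_related_eq : xy => ->.
Qed.

(** The path downstairs is a lifting problem on the cylinder over the 0-cube, with [x] and [y]
    prescribed at the two ends. *)
Lemma weak_lift_path x y : path_related R (f x) (f y) -> path_related R x y.
Proof.
move=> [g [cg g0 g1]].
(* Only the values at the two ends count. They lie on different sides of time 1/2, so on the
   boundary [a] is glued from two constant maps. *)
pose a (p : cube R 0 * unitI R) := if val p.2 == 0 then x else y.
have half0 : (0 : R) < 2^-1 by rewrite invr_gt0.
have half1 : 2^-1 < (1 : R) by rewrite invf_lt1 ?ltr1n.
have Bp (p : cube R 0 * unitI R) : cyl_boundary p -> val p.2 = 0 \/ val p.2 = 1.
  by move=> [[[]]|].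
have [| |p Bpp|G [cG GB _]] := @weak_lift_ball _ _ _ a (g \o snd) (cyl_ball R 0).
- apply: (@cont_on_glue _ _ [set p : cube R 0 * unitI R | val p.2 <= 2^-1]
    [set p : cube R 0 * unitI R | 2^-1 <= val p.2]) => //.
  + apply: closed_le_fun => p; last exact: cvg_cst.
    by apply: continuous_comp; [exact: cvg_snd|exact: val_continuous].
  + apply: closed_le_fun => p; first exact: cvg_cst.
    by apply: continuous_comp; [exact: cvg_snd|exact: val_continuous].
  + apply/seteqP; split=> // p _ /=; case: (lerP (val p.2) 2^-1) => h; [by left|right].
    exact: ltW.
  + apply: (@cont_on_eq _ _ _ (fun=> x)); last exact/pst_cont_on/pst_continuous_cst.
    move=> p [/Bp[p0|p1] /= ple]; first by rewrite /a p0 eqxx.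
    by move: ple; rewrite p1 leNgt half1.
  + apply: (@cont_on_eq _ _ _ (fun=> y)); last exact/pst_cont_on/pst_continuous_cst.
    move=> p [/Bp[p0|p1] /= ple]; last by rewrite /a p1 oner_eq0.
    by move: ple; rewrite p0 leNgt half0.
- by apply: pst_comp_top cg => p; exact: cvg_snd.
- rewrite /a /=; case: (Bp _ Bpp) => p01; rewrite p01 ?eqxx ?oner_eq0.
    by rewrite g0.
  by rewrite g1.
apply/path_relatedP; exists G; split=> //.
- by move=> s t t0; rewrite GB /a ?t0 ?eqxx//; right; left.
- by move=> s t t1; rewrite GB /a ?t1 ?oner_eq0//; right; right.
Qed.

(** The case k = 0: the sphere is empty, and a point [z] of [X] is a disk of dimension 0. *)
Lemma weak_lift_point z : exists y, path_related R (f y) z.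
Proof.
have no (s : sphere R 0) : False.
  by have := set_valP s; rewrite /sphere /= big_ord0 => /eqP; rewrite eq_sym oner_eq0.
have [||s|G [cG _ Gz]] := @lf 0%N (fun s => False_rect Y (no s)) (fun=> z).
- by apply/pst_continuousP => U s; case: (no s).
- exact: pst_continuous_cst.
- by case: (no s).
have d0 : (0 : 'rV[R]_0) \in disk R 0.
  by apply/mem_set; rewrite /disk /= big_ord0 ler01.
exists (G (set_sub d0)); apply/path_relatedP.
have := @hrel_pre R (cube R 0) _ (disk_boundary 0) _ _ _ set0 (fun=> set_sub d0) _ _ Gz.
by apply=> //; exact: cst_continuous.
Qed.

End weak_lift.

End criterion.

(** * Homotopy classes and concatenation of loops *)

Section homotopy_classes.
Variables (R : realType) (n : nat).

Lemma homotopicP (X : psTop) (x : X) (a b : cube R n -> X) : homotopic x a b <->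
  hrel R (@cube_boundary R n) a b /\ forall s, cube_boundary s -> a s = x.
Proof.
split=> [[H [cH H0 H1 HB]]|[[H [cH H0 H1 HB]] ax]]; last first.
  by exists H; split=> // s t Bs; rewrite HB// ax.
have ax s : cube_boundary s -> a s = x.
  by move=> Bs; rewrite -(HB s (clampI 0) Bs) H0// val_clampI// lexx ler01.
by split=> //; exists H; split=> // s t Bs; rewrite HB// ax.
Qed.

Lemma homotopic_loop (X : psTop) (x : X) (a b : cube R n -> X) :
  homotopic x a b -> loop R n x a /\ loop R n x b.
Proof.
move=> /homotopicP[ab ax]; have [ca cb] := hrel_continuous ab.
by split; split=> // s Bs; rewrite -?(hrel_eq_on ab Bs) ax.
Qed.

Lemma homotopic_refl (X : psTop) (x : X) (a : cube R n -> X) :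
  loop R n x a -> homotopic x a a.
Proof. by move=> [ca ax]; apply/homotopicP; split=> //; exact: hrel_refl. Qed.

Lemma homotopic_sym (X : psTop) (x : X) (a b : cube R n -> X) :
  homotopic x a b -> homotopic x b a.
Proof.
move=> ab; have [_ [_ bx]] := homotopic_loop ab.
by move/homotopicP : ab => [ab _]; apply/homotopicP; split=> //; exact: hrel_sym.
Qed.

Lemma homotopic_trans (X : psTop) (x : X) (a b c : cube R n -> X) :
  homotopic x a b -> homotopic x b c -> homotopic x a c.
Proof.
move=> /homotopicP[ab ax] /homotopicP[bc _].
by apply/homotopicP; split=> //; exact: hrel_trans ab bc.
Qed.

Lemma homotopic_class (X : psTop) (x : X) (a b : cube R n -> X) :
  homotopic x a b -> homotopic x a = homotopic x b.
Proof.
move=> ab; apply/seteqP; split=> c; last exact: homotopic_trans.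
exact: homotopic_trans (homotopic_sym ab).
Qed.

Lemma homotopic_comp (X Y : psTop) (f : Y -> X) (y : Y) (a b : cube R n -> Y) :
  pst_continuous f -> homotopic y a b -> homotopic (f y) (f \o a) (f \o b).
Proof.
move=> cf /homotopicP[ab ax]; apply/homotopicP; split; first exact: hrel_comp.
by move=> s Bs /=; rewrite ax.
Qed.

Lemma homotopy_group_map_class (X Y : psTop) (f : Y -> X) (y : Y)
    (a : cube R n -> Y) : pst_continuous f -> loop R n y a ->
  homotopy_group_map f y (homotopic y a) = homotopic (f y) (f \o a).
Proof.
move=> cf la; apply/seteqP; split=> [b [a' aa' fa'b]|b fab].
  exact: homotopic_trans (homotopic_comp cf aa') fa'b.
by exists a => //; exact: homotopic_refl.
Qed.

Lemma loop_comp (X Y : psTop) (f : Y -> X) (y : Y) (a : cube R n -> Y) :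
  pst_continuous f -> loop R n y a -> loop R n (f y) (f \o a).
Proof.
move=> cf [ca ay]; split; first exact: pst_continuous_comp ca cf.
by move=> s Bs /=; rewrite ay.
Qed.

End homotopy_classes.

Section concatenation.
Variables (R : realType) (n : nat) (X : psTop) (x : X).

Lemma set_coord0_subproof (s : cube R n.+1) (t : unitI R) :
  set_coord0 (val s) (val t) \in cube R n.+1.
Proof.
apply/mem_set => j; rewrite mxE; case: ifP => _; first exact: unitIP.
exact: (set_valP s).
Qed.

(** A total version of the [insubd] in [concat]: clamping replaces the default value, so that the
    result is continuous in [s] and [r] without side conditions. *)
Definition reparam (s : cube R n.+1) (r : R) : cube R n.+1 :=
  set_sub (set_coord0_subproof s (clampI r)).

Lemma insubd_reparam (s : cube R n.+1) r : 0 <= r <= 1 ->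
  insubd s (set_coord0 (val s) r) = reparam s r.
Proof.
move=> r01; apply: val_inj; rewrite val_insubd -{1 2}[r](val_clampI r01).
by rewrite set_coord0_subproof.
Qed.

Lemma reparam_boundary (s : cube R n.+1) r : cube_boundary s ->
  (val s ord0 ord0 = 0 -> r = 0 \/ r = 1) -> (val s ord0 ord0 = 1 -> r = 0 \/ r = 1) ->
  cube_boundary (reparam s r).
Proof.
move=> [i si] h0 h1; rewrite /cube_boundary /=.
have [i0|i0] := eqVneq i ord0; last first.
  by exists i; rewrite !mxE (negbTE i0).
rewrite i0 in si; exists ord0; rewrite !mxE eqxx.
have {}si : r = 0 \/ r = 1 by case: si => [/h0|/h1].
by case: si => ->; rewrite -[clampr _]/(val (clampI _)) val_clampI ?lexx ?ler01//; [left|right].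
Qed.

Lemma reparam_end (s : cube R n.+1) r : r = 0 \/ r = 1 -> cube_boundary (reparam s r).
Proof.
move=> r01; rewrite /cube_boundary /=; exists ord0; rewrite !mxE eqxx.
by case: r01 => ->; rewrite -[clampr _]/(val (clampI _)) val_clampI ?lexx ?ler01//; [left|right].
Qed.

Lemma reparam_continuous (T : topologicalType) (f : T -> cube R n.+1) (g : T -> R) :
  continuous f -> continuous g -> continuous (fun p => reparam (f p) (g p)).
Proof.
move=> cf cg; apply: subtype_continuous; apply: mx_continuous => i j /=.
have [->|/negbTE j0] := eqVneq j ord0.
  under eq_fun do rewrite mxE eqxx.
  move=> p; apply: (@continuous_comp _ _ _ (fun p => clampI (g p))
    (fun t : unitI R => val t)); last exact: val_continuous.
  by apply: continuous_comp; [exact: cg|exact: clampI_continuous].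
under eq_fun do rewrite mxE j0.
move=> p; apply: (@continuous_comp _ _ _ f (fun s : cube R n.+1 => val s ord0 j)).
  exact: cf.
exact: coord_val_continuous.
Qed.

(** The two homotopies are concatenated at each time. On the wall where coordinate 0 equals 1/2,
    both rescaled points are on the boundary, where both homotopies take the value [x]. *)
Lemma concat_homotopic (a a' b b' : cube R n.+1 -> X) :
  homotopic x a a' -> homotopic x b b' ->
  homotopic x (concat a b) (concat a' b').
Proof.
move=> aa' bb'; have [[ca ax] [_ a'x]] := homotopic_loop aa'.
have [[cb bx] [_ b'x]] := homotopic_loop bb'.
have [H [cH H0 H1 HB]] := aa'; have [K [cK K0 K1 KB]] := bb'.
have c0 : continuous (fun p : cube R n.+1 * unitI R => val p.1 ord0 ord0).
  move=> p; apply: (@continuous_comp _ _ _ (fun p : cube R n.+1 * unitI R => p.1)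
    (fun s : cube R n.+1 => val s ord0 ord0)); first exact: cvg_fst.
  exact: coord_val_continuous.
have cm : continuous (fun p : cube R n.+1 * unitI R => 2 * val p.1 ord0 ord0).
  by move=> p; exact: cvgM (cvg_cst _) (@c0 p).
have cm1 : continuous (fun p : cube R n.+1 * unitI R => 2 * val p.1 ord0 ord0 - 1).
  by move=> p; exact: cvgB (@cm p) (cvg_cst _).
have c1 : continuous (@fst (cube R n.+1) (unitI R)) by move=> p; exact: cvg_fst.
have c2 : continuous (@snd (cube R n.+1) (unitI R)) by move=> p; exact: cvg_snd.
have s01 (s : cube R n.+1) : 0 <= val s ord0 ord0 <= 1 by exact: (set_valP s).
pose L (p : cube R n.+1 * unitI R) :=
  concat (fun s => H (s, p.2)) (fun s => K (s, p.2)) p.1.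
have L1 (p : cube R n.+1 * unitI R) : val p.1 ord0 ord0 <= 2^-1 ->
    L p = H (reparam p.1 (2 * val p.1 ord0 ord0), p.2).
  move=> h; rewrite /L /concat h insubd_reparam//.
  by have := s01 p.1; move: h => /=; lra.
have L2 (p : cube R n.+1 * unitI R) : 2^-1 <= val p.1 ord0 ord0 ->
    L p = K (reparam p.1 (2 * val p.1 ord0 ord0 - 1), p.2).
  move=> h; have [h'|h'] := lerP (val p.1 ord0 ord0) 2^-1; last first.
    rewrite /L /concat leNgt h' /= insubd_reparam//.
    by have := s01 p.1; move: h' => /=; lra.
  have e : val p.1 ord0 ord0 = 2^-1 by apply/le_anti/andP.
  rewrite L1// e divff ?pnatr_eq0// subrr HB ?KB//; apply: reparam_end; [by left|by right].
exists L; split=> [|s t t0|s t t1|s t Bs].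
- apply: (@pst_glue _ _ [set p : cube R n.+1 * unitI R | val p.1 ord0 ord0 <= 2^-1]
    [set p : cube R n.+1 * unitI R | 2^-1 <= val p.1 ord0 ord0]
    (fun p => H (reparam p.1 (2 * val p.1 ord0 ord0), p.2))
    (fun p => K (reparam p.1 (2 * val p.1 ord0 ord0 - 1), p.2))).
  + by apply: closed_le_fun => //; exact: cst_continuous.
  + by apply: closed_le_fun => //; exact: cst_continuous.
  + apply/seteqP; split=> // p _ /=.
    by case: (lerP (val p.1 ord0 ord0) 2^-1) => h; [by left|right; exact: ltW].
  + by apply: pst_comp_top cH; apply: pair_continuous => //; exact: reparam_continuous.
  + by apply: pst_comp_top cK; apply: pair_continuous => //; exact: reparam_continuous.
  + by move=> p /= /L1.
  + by move=> p /= /L2.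
- by rewrite /L /concat /= H0// K0.
- by rewrite /L /concat /= H1// K1.
- have [h|/ltW h] := lerP (val s ord0 ord0) 2^-1.
    rewrite L1// HB//; apply: reparam_boundary => //= e; rewrite e ?mulr0; first by left.
    by move: h; rewrite e; lra.
  rewrite L2// KB//; apply: reparam_boundary => //= e; last by right; rewrite e; lra.
  by move: h; rewrite e; lra.
Qed.

End concatenation.

Section weak_lift_whe.
Variables (R : realType) (X Y : psTop) (f : Y -> X).
Hypotheses (cf : pst_continuous f).

Lemma concat_comp n (a b : cube R n.+1 -> Y) :
  f \o concat a b = concat (f \o a) (f \o b).
Proof. by apply/funext => s; rewrite /concat /=; case: ifP. Qed.

Lemma homotopy_group_map_mul n (y : Y) (c d : set (cube R n.+1 -> Y)) :
  homotopy_group R n.+1 y c -> homotopy_group R n.+1 y d ->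
  homotopy_group_map f y (homotopy_group_mul y c d) =
  homotopy_group_mul (f y) (homotopy_group_map f y c) (homotopy_group_map f y d).
Proof.
move=> [a0 la0 <-] [b0 lb0 <-].
apply/seteqP; split=> [l [m [a [b [aa0 bb0 abm]]] fml]|l [a' [b' [[a aa0 aa']]]]].
  exists (f \o a), (f \o b); split.
  - exists a => //; apply: homotopic_refl; apply: loop_comp => //.
    by have [] := homotopic_loop aa0.
  - exists b => //; apply: homotopic_refl; apply: loop_comp => //.
    by have [] := homotopic_loop bb0.
  - by rewrite -concat_comp; apply: homotopic_trans fml; exact: homotopic_comp.
move=> [b bb0 bb'] ab'l.
have [_ la] := homotopic_loop aa0; have [_ lb] := homotopic_loop bb0.
exists (concat a b).
  exists a, b; split=> //.
  by apply: concat_homotopic; exact: homotopic_refl.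
rewrite concat_comp; apply: homotopic_trans ab'l.
exact: concat_homotopic.
Qed.

Hypothesis lf : weak_lift R f.

(** The homotopy downstairs is lifted over the cylinder with [a], [b] and the base point prescribed
    on its boundary. Only the strict equality on the boundary is used; that the lift covers [H] up
    to homotopy is dropped. *)
Lemma weak_lift_homotopic n (y : Y) (a b : cube R n -> Y) :
  loop R n y a -> loop R n y b -> homotopic (f y) (f \o a) (f \o b) ->
  homotopic y a b.
Proof.
move=> [ca ay] [cb by_] [H [cH H0 H1 HB]].
(* Jumping from [a] to [b] at time 1/2 is continuous on the boundary of the cylinder, because on its
   side both are constant equal to [y]. *)
pose c (p : cube R n * unitI R) := if val p.2 <= 2^-1 then a p.1 else b p.1.
have half0 : (0 : R) < 2^-1 by rewrite invr_gt0.
have half1 : 2^-1 < (1 : R) by rewrite invf_lt1 ?ltr1n.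
have c0 s t : val t = 0 -> c (s, t) = a s by move=> t0; rewrite /c /= t0 ltW.
have c1 s t : val t = 1 -> c (s, t) = b s.
  by move=> t1; rewrite /c /= t1 leNgt half1.
have cB s t : cube_boundary s -> c (s, t) = y.
  by move=> Bs; rewrite /c /=; case: ifP => _; rewrite ?ay ?by_.
have fst_cont : continuous (@fst (cube R n) (unitI R)) by move=> p; exact: cvg_fst.
have snd_cont : continuous (fun p : cube R n * unitI R => val p.2).
  by move=> p; apply: continuous_comp; [exact: cvg_snd|exact: val_continuous].
have [||[s t]|G [cG GB _]] := weak_lift_ball lf (a := c) (H := H) (cyl_ball R n).
- apply: (@cont_on_glue _ _ [set p : cube R n * unitI R | val p.2 <= 2^-1]
    [set p : cube R n * unitI R | 2^-1 <= val p.2]).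
  + by apply: closed_le_fun => //; exact: cst_continuous.
  + by apply: closed_le_fun => //; exact: cst_continuous.
  + apply/seteqP; split=> // p _ /=; case: (lerP (val p.2) 2^-1) => h; [by left|right].
    exact: ltW.
  + apply: (@cont_on_eq _ _ _ (fun p => a p.1)).
      by move=> p [_ /= h]; rewrite /c h.
    exact/pst_cont_on/(pst_comp_top fst_cont ca).
  + apply: (@cont_on_eq _ _ _ (fun p => b p.1)).
      move=> [s t] [Bp /= h]; case: Bp => [Bs|[t0|t1]].
      - by rewrite cB// by_.
      - by move: h; rewrite t0 leNgt half0.
      - by rewrite c1.
    exact/pst_cont_on/(pst_comp_top fst_cont cb).
- exact: cH.
- case=> [Bs|[t0|t1]].
  + by rewrite HB// cB.
  + by rewrite H0// c0.
  + by rewrite H1// c1.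
exists G; split=> // [s t t0|s t t1|s t Bs].
- by rewrite GB ?c0//; right; left.
- by rewrite GB ?c1//; right; right.
- by rewrite GB ?cB//; left.
Qed.

(** For homotopy groups, injectivity is [weak_lift_homotopic]. For surjectivity a loop is lifted
    over the cube with the constant map on its boundary; the homotopy relative to the boundary is
    then a homotopy of loops. *)
Lemma weak_lift_whe : weak_homotopy_equivalence R f.
Proof.
split=> //.
  split.
  - by move=> _ [y _ <-]; rewrite path_components_map_class//; exists (f y).
  - move=> _ _ /set_mem[y _ <-] /set_mem[z _ <-].
    rewrite !path_components_map_class// => /path_related_eq yz.
    by apply/path_related_eq; exact: (weak_lift_path lf yz).
  - move=> _ [z _ <-]; have [y yz] := weak_lift_point lf z.
    exists (path_related R y); first by exists y.
    by rewrite path_components_map_class//; apply/path_related_eq.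
move=> n y; split; last by move=> c d; exact: homotopy_group_map_mul.
split.
- move=> _ [a la <-]; rewrite homotopy_group_map_class//; exists (f \o a) => //.
  exact: loop_comp.
- move=> _ _ /set_mem[a la <-] /set_mem[b lb <-].
  rewrite !homotopy_group_map_class// => ab; apply: homotopic_class.
  apply: weak_lift_homotopic => //; rewrite ab.
  by apply: homotopic_refl; exact: loop_comp.
- move=> _ [b [cb bx] <-].
  have [||s Bs|G [cG GB fGb]] :=
    weak_lift_ball lf (a := fun=> y) (H := b) (cube_ball R n.+1).
  + exact/pst_cont_on/pst_continuous_cst.
  + exact: cb.
  + exact: bx.
  have lG : loop R n.+1 y G by [].
  exists (homotopic y G); first by exists G.
  rewrite homotopy_group_map_class//; apply: homotopic_class.
  by apply/homotopicP; split=> // s Bs /=; rewrite GB.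
Qed.

End weak_lift_whe.

(** * Compact subsets of the skeletal filtration *)

Lemma fmap_inj (A B : Type) (f : A -> B) (U V : set_system A) :
  injective f -> Filter U -> Filter V -> fmap f U = fmap f V -> U = V.
Proof.
move=> f_inj FU FV UV.
have pre (P : set A) : f @^-1` (f @` P) = P.
  by apply/seteqP; split=> [x [y Py /f_inj <-]|x Px] //; exists x.
have UVE (P : set A) : U P = V P.
  by rewrite -[P]pre -[U _]/(fmap f U (f @` P)) UV.
by apply/seteqP; split=> P; rewrite UVE.
Qed.

(** The ultrafilter comes from one on the sphere, which has a limit by compactness; this limit is
    [d] because the disk is Hausdorff. *)
Lemma sphere_ultra (R : realType) n (V : set_system (disk R n)) (d : disk R n) :
  UltraFilter V -> V (range (@sphere_disk R n)) ->
  @pst_cvg (psTop_of_top (disk R n)) V d ->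
  exists W s, [/\ UltraFilter W, @pst_cvg (psTop_of_top (sphere R n)) W s,
    fmap (@sphere_disk R n) W = V & sphere_disk s = d].
Proof.
move=> UV Vs Vd; have [W UW WV] := ultra_lift_range UV Vs.
have [s Ws] := compact_pst_cvg (@sphere_compact R n) UW.
exists W, s; split=> //.
apply: (hausdorff_pst_cvg (@disk_hausdorff R n) _ Vd).
by rewrite -WV; exact: sphere_disk_continuous.
Qed.

Section embedding.
Variables (R : realType) (X : psTop).
Local Notation sk := (skeleton R X).
Local Notation cw := (cw_approx R X).

Lemma cell_char_incl n (i : cells R X n) s :
  cell_char i (sphere_disk s) = inl (cell_att i s).
Proof. exact/char_map_incl/sphere_disk_inj. Qed.

Lemma cell_char_open n (o : cell_points R X n) :
  cell_char (sval o).1 (sval o).2 = inr o.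
Proof. exact: char_map_open. Qed.

Lemma cell_char_continuous n (i : cells R X n) :
  @pst_continuous (psTop_of_top (disk R n)) (sk n.+1) (cell_char i).
Proof. exact: char_map_continuous. Qed.

Lemma skeleton_incl_continuous n : pst_continuous (@skeleton_incl R X n).
Proof. exact: attach_inl_continuous. Qed.

Lemma skeleton_in_continuous n : @pst_continuous (sk n) cw (skeleton_in n).
Proof. exact: (@final_continuous _ sk _ (@skeleton_in R X) n). Qed.

Lemma skeleton_cvgP n (V : set_system (sk n.+1)) (z : sk n.+1) :
  UltraFilter V -> pst_cvg V z ->
  (exists U y, [/\ UltraFilter U, @pst_cvg (sk n) U y,
      fmap (@skeleton_incl R X n) U = V & skeleton_incl y = z]) \/
  (exists (i : cells R X n) U d,
     [/\ UltraFilter U, @pst_cvg (psTop_of_top (disk R n)) U d,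
      fmap (cell_char i) U = V & cell_char i d = z]).
Proof. exact: attach_cvgP. Qed.

(** In a closed cell, being over the lower skeleton means being on the boundary sphere. The
    ultrafilter thus factors through the attaching map and already converges one stage below. *)
Lemma cell_ultra n (i : cells R X n) (V : set_system (disk R n)) (d : disk R n) :
  UltraFilter V -> V (cell_char i @^-1` range (@skeleton_incl R X n)) ->
  @pst_cvg (psTop_of_top (disk R n)) V d ->
  exists U y, [/\ UltraFilter U, @pst_cvg (sk n) U y,
    fmap (@skeleton_incl R X n) U = fmap (cell_char i) V &
    skeleton_incl y = cell_char i d].
Proof.
move=> UV Vi Vd; have Vs : V (range (@sphere_disk R n)).
  apply: (@filterS _ V _ _ _ _ Vi) => e [y _ /esym/char_map_inl[s se _]].
  by exists s.
have [W [s [UW Ws WV sd]]] := sphere_ultra UV Vs Vd.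
exists (fmap (cell_att i) W), (cell_att i s); split.
- exact: fmap_ultra.
- exact: cell_att_continuous.
- by rewrite -WV; apply/seteqP; split=> P; rewrite /fmap /= => WP;
    apply: (@filterS _ W _ _ _ _ WP) => t /=; rewrite cell_char_incl.
- by rewrite -sd cell_char_incl.
Qed.

Lemma skeleton_incl_inj n : injective (@skeleton_incl R X n).
Proof. by move=> y z []. Qed.

(** Attaching cells does not add convergence to the old stage: a convergent ultrafilter that enters
    through a closed cell can be rerouted through its attaching map. *)
Lemma skeleton_incl_embed n (V : set_system (sk n)) (y : sk n) : UltraFilter V ->
  pst_cvg (fmap (@skeleton_incl R X n) V) (skeleton_incl y) -> pst_cvg V y.
Proof.
move=> UV /(skeleton_cvgP (fmap_ultra _ UV)) Vy.
suff [U [z [UU Uz UV' zy]]] : exists U z, [/\ UltraFilter U, @pst_cvg (sk n) U z,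
    fmap (@skeleton_incl R X n) U = fmap (@skeleton_incl R X n) V &
    skeleton_incl z = skeleton_incl y].
  by rewrite -(fmap_inj (@skeleton_incl_inj n) _ _ UV') -(skeleton_incl_inj zy).
case: Vy => [//|[i [U [d [UU Ud UV' dy]]]]].
rewrite -dy -UV'; apply: cell_ultra => //.
rewrite -[U _]/(fmap (cell_char i) U _) UV' /fmap /=.
by apply: (@filterS _ V _ setT) => [z _|]; [exists z|exact: filterT].
Qed.

Lemma skeleton_in_tag n (y : sk n) : (projT1 (skeleton_in n y) < n)%N.
Proof. by elim: n y => [[]|n IHn] [y|o] //=; rewrite ltnS ltnW. Qed.

Lemma skeleton_in_inj n : injective (@skeleton_in R X n : sk n -> cw).
Proof.
elim: n => [[]|n IHn] [y|o] [z|o'] //=.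
- by move=> /IHn->.
- by move=> yo; have := skeleton_in_tag y; rewrite yo ltnn.
- by move=> oz; have := skeleton_in_tag z; rewrite -oz ltnn.
- move=> h; congr inr.
  by apply: Eqdep_dec.inj_pair2_eq_dec h; exact: PeanoNat.Nat.eq_dec.
Qed.

Lemma cw_point_in (p : cw) : skeleton_in (projT1 p).+1 (inr (projT2 p)) = p.
Proof. by case: p. Qed.

(** Convergence in the colimit witnessed at stage [n]. The witnessing stage can be raised freely,
    and lowered as long as the ultrafilter and its limit stay in the smaller skeleton. *)
Definition cvg_at n (V : set_system cw) (p : cw) : Prop :=
  exists U z, [/\ UltraFilter U, @pst_cvg (sk n) U z,
    fmap (skeleton_in n) U = V & skeleton_in n z = p].

Lemma cw_cvgP (V : set_system cw) (p : cw) : UltraFilter V -> pst_cvg V p ->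
  exists n, cvg_at n V p.
Proof.
move=> UV /(ultra_psTopP _ UV)[->|[n [U [z [UU Uz UV' zp]]]]].
  exists (projT1 p).+1, (principal_filter (inr (projT2 p))), (inr (projT2 p)).
  split; [exact: principal_filter_ultra|exact: pst_cvg_principal| |].
    by rewrite fmap_principal cw_point_in.
  exact: cw_point_in.
by exists n, U, z.
Qed.

Lemma cvg_at_up n m (V : set_system cw) p : cvg_at n V p -> cvg_at (m + n) V p.
Proof.
move=> Vp; elim: m => [//|m [U [z [UU Uz UV zp]]]].
exists (fmap (@skeleton_incl R X _) U), (skeleton_incl z); split=> //.
- exact: fmap_ultra.
- exact: skeleton_incl_continuous.
Qed.

Lemma cvg_at_down n (V : set_system cw) p : cvg_at n.+1 V p ->
  V [set q | (projT1 q < n)%N] -> (projT1 p < n)%N -> cvg_at n V p.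
Proof.
move=> [U [z [UU Uz UV zp]]] Vn pn.
have old (y : sk n.+1) : (projT1 (skeleton_in n.+1 y) < n)%N ->
    range (@skeleton_incl R X n) y.
  by case: y => [y _|o] /=; [exists y|rewrite ltnn].
have Ui : U (range (@skeleton_incl R X n)).
  by move: Vn; rewrite -UV /fmap /=; apply: filterS => y /old.
have [W UW WU] := ultra_lift_range UU Ui.
have [y _ yz] : range (@skeleton_incl R X n) z by apply: old; rewrite zp.
exists W, y; split=> //.
- by apply: skeleton_incl_embed => //; rewrite WU yz.
- by rewrite -UV -WU.
- by rewrite -zp -yz.
Qed.

Lemma cw_cvg_at n (V : set_system cw) p : UltraFilter V -> pst_cvg V p ->
  V [set q | (projT1 q < n)%N] -> (projT1 p < n)%N -> cvg_at n V p.
Proof.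
move=> UV /(cw_cvgP UV)[m Vp] Vn pn.
have [mn|/ltnW nm] := leqP m n; first by rewrite -(subnK mn); exact: cvg_at_up.
move: Vp; rewrite -(subnK nm); elim: (m - n)%N => [//|k IHk] Vp; apply: IHk.
apply: cvg_at_down => //; last exact: leq_trans (leq_addl _ _).
by apply: (@filterS _ V _ _ _ _ Vn) => q /= qn; exact: leq_trans (leq_addl _ _).
Qed.

Lemma skeleton_in_embed n (U : set_system (sk n)) (z : sk n) : UltraFilter U ->
  @pst_cvg cw (fmap (skeleton_in n) U) (skeleton_in n z) -> pst_cvg U z.
Proof.
move=> UU Uz; have UU' := fmap_ultra (skeleton_in n) UU.
have [||W [y [UW Wy WU yz]]] := @cw_cvg_at n _ _ UU' Uz.
- rewrite /fmap /=; apply: (@filterS _ U _ setT) => [y _|]; last exact: filterT.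
  exact: skeleton_in_tag.
- exact: skeleton_in_tag.
by rewrite -(fmap_inj (@skeleton_in_inj n) _ _ WU) -(skeleton_in_inj yz).
Qed.

Lemma compact_skeleton (K : topologicalType) (g : K -> cw) :
  compact [set: K] -> @pst_continuous (psTop_of_top K) cw g ->
  exists n (h : K -> sk n), @pst_continuous (psTop_of_top K) (sk n) h /\
    forall x, skeleton_in n (h x) = g x.
Proof.
move=> cK cg.
have [n gn] : exists n, forall x, (projT1 (g x) < n)%N.
  apply: contrapT => /forallNP no.
  have {}no n : exists x, (n <= projT1 (g x))%N.
    by have /existsNP[x /negP] := no n; rewrite -leqNgt => h; exists x.
  (* If dimensions were unbounded, the points sent to cells of dimension at least n, for all n,
     would lie in one ultrafilter. It converges by compactness, so its image comes from a single
     stage, where dimensions are bounded. *)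
  pose F := filter_from [set: nat] (fun n => [set x | (n <= projT1 (g x))%N]).
  have FF : ProperFilter F.
    apply: filter_from_proper; last by move=> n _; have [x] := no n; exists x.
    apply: filter_from_filter; first by exists 0%N.
    move=> m n _ _; exists (maxn m n) => // x /=.
    by rewrite geq_max => /andP[].
  have [U [UU FU]] := ultraFilterLemma FF.
  have [x Ux] := compact_pst_cvg cK UU.
  have [m [W [z [UW Wz WU zx]]]] := cw_cvgP (fmap_ultra g UU) (cg _ _ Ux).
  have Um : U [set x | (projT1 (g x) < m)%N].
    rewrite -[U _]/(fmap g U [set p | (projT1 p < m)%N]) -WU /fmap /=.
    apply: (@filterS _ W _ setT) => [y _|]; last exact: filterT.
    exact: skeleton_in_tag.
  have Um' : U [set x | (m <= projT1 (g x))%N] by apply: FU; exists m.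
  have [y [/= h1 h2]] := filter_ex (filterI Um Um').
  by move: h2; rewrite leqNgt h1.
have in_sk x : exists y : sk n, skeleton_in n y = g x.
  have := gn x; elim: (n) => // m IHm; rewrite ltnS leq_eqVlt => /orP[/eqP e|].
    by move: e; case: (g x) => k o /= e; move: o; rewrite e => o; exists (inr o).
  by move=> /IHm[y yx]; exists (skeleton_incl y).
pose h x := projT1 (cid (in_sk x)).
have hg x : skeleton_in n (h x) = g x by rewrite /h; case: cid.
exists n, h; split=> //; apply/pst_continuousP => U x UU Ux.
apply: skeleton_in_embed; first exact: fmap_ultra.
rewrite hg (_ : fmap _ _ = fmap g U); first exact: cg.
by congr (fmap _ U); apply/funext => y /=; exact: hg.
Qed.

End embedding.

(** * Radial projection to the sphere *)

Section direction.
Variables (R : realType) (n : nat).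

Lemma sphere_base_subproof : (delta_mx 0 0 : 'rV[R]_n.+1) \in sphere R n.+1.
Proof.
apply/mem_set; rewrite /sphere /= (bigD1 ord0)//= big1 ?addr0.
  by rewrite mxE !eqxx expr1n.
by move=> i /negbTE i0; rewrite mxE i0 andbF expr0n.
Qed.

(* The base point is a junk value, taken only at 0. *)
Definition sdir (x : 'rV[R]_n.+1) : sphere R n.+1 :=
  insubd (set_sub sphere_base_subproof) ((nrm x)^-1 *: x).

Lemma val_sdir x : x != 0 -> val (sdir x) = (nrm x)^-1 *: x.
Proof.
move=> x0; rewrite val_insubd ifT//; apply/mem_set/sphereE.
have nx0 : nrm x != 0 by apply: contra_neq x0; exact: nrm_eq0.
by rewrite nrmZ ger0_norm ?mulVf// invr_ge0 nrm_ge0.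
Qed.

Lemma sdir_scale x : x = nrm x *: val (sdir x).
Proof.
have [->|x0] := eqVneq x 0; first by rewrite nrm0 scale0r.
have nx0 : nrm x != 0 by apply: contra_neq x0; exact: nrm_eq0.
by rewrite val_sdir// scalerA mulfV ?scale1r.
Qed.

Lemma sdir_sphere (s : sphere R n.+1) : sdir (val s) = s.
Proof.
have s1 : nrm (val s) = 1 by apply/sphereE; exact: (set_valP s).
have s0 : val s != 0.
  by apply: contra_eq_neq s1 => ->; rewrite nrm0 eq_sym oner_neq0.
by apply: val_inj; rewrite [LHS]val_sdir// s1 invr1 scale1r.
Qed.

Lemma sdir_continuous (x : 'rV[R]_n.+1) : x != 0 -> sdir @ x --> sdir x.
Proof.
move=> x0; have nx0 : nrm x != 0 by apply: contra_neq x0; exact: nrm_eq0.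
move=> B; rewrite nbhsE => -[_ [[C oC <-] Cx] CB].
have cvgx : (fun y : 'rV[R]_n.+1 => (nrm y)^-1 *: y) @ x --> (nrm x)^-1 *: x.
  by apply: (cvgZ _ cvg_id); apply: (cvgV nx0); exact: nrm_continuous.
have near0 : \forall y \near x, y != 0.
  have : open [set y : 'rV[R]_n.+1 | y != 0].
    rewrite (_ : [set _ | _] = ~` [set 0]); last by apply/seteqP; split=> y /= /eqP.
    apply: closed_openC; apply: accessible_closed_set1.
    exact: hausdorff_accessible (@rV_hausdorff R n.+1).
  by move=> o; exact: open_nbhs_nbhs.
have nearC : \forall y \near x, C ((nrm y)^-1 *: y).
  by apply: cvgx; apply: open_nbhs_nbhs; split=> //; move: Cx; rewrite /= -val_sdir.
rewrite /fmap /=; apply: filterS (filterI near0 nearC) => y [y0 Cy].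
have {}Cy : C (val (sdir y)) by rewrite val_sdir.
exact: CB.
Qed.

End direction.

(** * Comparison with the topological modification *)

Section radial_ext.
Variable R : realType.

(** The extension that is homogeneous of degree one. In dimension 0 the sphere is empty and 0 is
    taken. *)
Definition radial_ext n : (sphere R n -> R) -> disk R n -> R :=
  match n with
  | 0%N => fun _ _ => 0
  | m.+1 => fun v d => nrm (val d) * v (sdir (val d))
  end.

Lemma radial_ext_sphere n (v : sphere R n -> R) s :
  radial_ext v (sphere_disk s) = v s.
Proof.
have s1 : nrm (val s) = 1 by apply/sphereE; exact: (set_valP s).
case: n v s s1 => [|n] v s s1; last by rewrite /= sdir_sphere s1 mul1r.
by move/eqP: s1; rewrite /nrm big_ord0 sqrtr0 eq_sym oner_eq0.
Qed.

Lemma radial_ext_bound n (v : sphere R n -> R) C d : 0 <= C ->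
  (forall s, `|v s| <= C) -> `|radial_ext v d| <= C * nrm (val d).
Proof.
case: n v d => [|n] v d C0 vC; first by rewrite normr0 mulr_ge0// nrm_ge0.
by rewrite /= normrM ger0_norm ?nrm_ge0// mulrC ler_wpM2r ?nrm_ge0.
Qed.

Lemma radial_ext0 n (v : sphere R n -> R) d :
  (forall s, v s = 0) -> radial_ext v d = 0.
Proof. by case: n v d => //= n v d ->; rewrite mulr0. Qed.

Lemma nrm_val_continuous n (A : set 'rV[R]_n) :
  continuous (fun d : A => nrm (val d)).
Proof.
move=> d; apply: (@continuous_comp _ _ _ (fun d : A => val d) (@nrm R n)).
  exact: val_continuous.
exact: nrm_continuous.
Qed.

Lemma radial_ext_continuous n (v : sphere R n -> R) C : 0 <= C ->
  continuous v -> (forall s, `|v s| <= C) -> continuous (radial_ext v).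
Proof.
move=> C0 cv vC; case: n v cv vC => [|n] v cv vC; first exact: cst_continuous.
move=> d; have [d0|d0] := eqVneq (val d) 0.
  rewrite /continuous_at [X in _ --> X](_ : _ = 0); last first.
    by rewrite /radial_ext d0 nrm0 mul0r.
  apply/(@norm_cvg0P _ _ _ (nbhs (d : disk R n.+1))).
  have h : (fun d : disk R n.+1 => C * nrm (val d)) @ (d : disk R n.+1) --> (0 : R).
    rewrite -[X in _ --> X](mulr0 C) -(nrm0 R n.+1) -d0.
    exact: cvgM (cvg_cst _) (@nrm_val_continuous _ _ d).
  apply: squeeze_cvgr (cvg_cst (0 : R)) h.
  by apply: nearW => y; rewrite normr_ge0 (radial_ext_bound _ C0).
have cs : (fun d : disk R n.+1 => sdir (val d)) @ (d : disk R n.+1) --> sdir (val d).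
  exact: cvg_comp (@val_continuous _ _ d) (sdir_continuous d0).
suff : (fun d : disk R n.+1 => nrm (val d) * v (sdir (val d))) @ (d : disk R n.+1) -->
  nrm (val d) * v (sdir (val d)) by [].
have cvs : (fun d : disk R n.+1 => v (sdir (val d))) @ (d : disk R n.+1) -->
    v (sdir (val d)) by exact: cvg_comp cs (@cv _).
have cn : (fun d : disk R n.+1 => nrm (val d)) @ (d : disk R n.+1) --> nrm (val d).
  exact: nrm_val_continuous.
exact: cvgM cn cvs.
Qed.

End radial_ext.

Section bumps.
Variables (R : realType) (X : psTop).
Local Notation sk := (skeleton R X).
Local Notation cw := (cw_approx R X).
Local Notation real_line := (psTop_of_top (Real.sort R)).

Section bump_family.
Variable B : forall m, cells R X m -> disk R m -> R.
Hypothesis B_continuous : forall m i, continuous (@B m i).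
Hypothesis B_boundary : forall m i s, @B m i (sphere_disk s) = 0.
Hypothesis B_bound : forall m i d, `|@B m i d| <= 1.

(* A function on the boundary of a cell extends radially to the cell, so bumps
   prescribed in single open cells extend over all later skeleta. *)
Fixpoint bump_fun m : sk m -> R :=
  match m with
  | 0%N => of_void R
  | k.+1 => fun y => match y with
    | inl z => bump_fun z
    | inr o => radial_ext (fun s => bump_fun (cell_att (sval o).1 s)) (sval o).2
               + B (sval o).1 (sval o).2
    end
  end.

Lemma bump_fun_char m (i : cells R X m) d : bump_fun (cell_char i d : sk m.+1) =
  radial_ext (fun s => bump_fun (cell_att i s)) d + B i d.
Proof.
case E : (cell_char i d) => [y|o] /=.
  have [s <- <-] := char_map_inl E.
  by rewrite (radial_ext_sphere (fun s => bump_fun (cell_att i s))) B_boundary addr0.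
by have := char_map_inr E; move=> ->.
Qed.

(** Each stage adds at most 1. The bound is what makes the next radial extension continuous at the
    centers of the cells. *)
Lemma bump_fun_bound m (y : sk m) : `|bump_fun y| <= m%:R.
Proof.
elim: m y => [[]|m IHm] [y|o] /=.
  by apply: le_trans (IHm y) _; rewrite ler_nat.
apply: le_trans (ler_normD _ _) _; rewrite -natr1 lerD ?B_bound//.
apply: le_trans (radial_ext_bound _ (ler0n R m) (fun s => IHm _)) _.
by rewrite ler_piMr ?ler0n//; apply/diskE; exact: (set_valP (sval o).2).
Qed.

Lemma bump_fun_continuous m : @pst_continuous (sk m) real_line (@bump_fun m).
Proof.
elim: m => [|m IHm]; first by move=> F [].
apply/attach_continuousP; split=> [//|i].
apply: (@pst_continuous_eq (psTop_of_top (disk R m)) real_line (fun d =>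
    radial_ext (fun s => bump_fun (cell_att i s)) d + B i d)).
  by move=> d; rewrite -bump_fun_char.
have cr : continuous (radial_ext (fun s => bump_fun (cell_att i s))); last first.
  by apply/pst_continuous_top => d; exact: cvgD (@cr d) (@B_continuous _ _ d).
apply: (radial_ext_continuous (ler0n R m)) => [|s]; last exact: bump_fun_bound.
by apply/pst_continuous_top/(pst_continuous_comp (cell_att_continuous i))/IHm.
Qed.

Lemma bump_fun_eq0 n m (y : sk m) : (m <= n)%N ->
  (forall k i d, (k < n)%N -> @B k i d = 0) -> bump_fun y = 0.
Proof.
move=> mn B0; elim: m y mn => [[]|m IHm] [y|o] mn /=; first by rewrite IHm// ltnW.
by rewrite B0// radial_ext0 ?addr0// => s; rewrite IHm// ltnW.
Qed.

Definition bump_cw (p : cw) : R := bump_fun (inr (projT2 p) : sk (projT1 p).+1).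

Lemma bump_cw_continuous : @pst_continuous cw real_line bump_cw.
Proof.
have bump_in n (y : sk n) : bump_cw (skeleton_in n y) = bump_fun y.
  by elim: n y => [[]|n IHn] [y|o] //=; exact: IHn.
apply/final_continuousP => n.
apply: (@pst_continuous_eq (sk n) real_line (@bump_fun n)); last exact: bump_fun_continuous.
by move=> y /=; rewrite bump_in.
Qed.

End bump_family.

Definition cell_of (p : cw) : {n & cells R X n} :=
  existT _ (projT1 p) (sval (projT2 p)).1.

Definition closed_cell (c : {n & cells R X n}) (d : disk R (projT1 c)) : cw :=
  skeleton_in (projT1 c).+1 (cell_char (projT2 c) d).

Lemma closed_cell_of p : exists d, closed_cell (c := cell_of p) d = p.
Proof.
exists (sval (projT2 p)).2; rewrite /closed_cell /= cell_char_open.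
exact: cw_point_in.
Qed.

Lemma closed_cell_continuous c :
  @pst_continuous (psTop_of_top (disk R (projT1 c))) cw (@closed_cell c).
Proof.
apply: pst_continuous_comp; first exact: cell_char_continuous.
exact: skeleton_in_continuous.
Qed.

Section one_cell_bump.
Variables (c : {n & cells R X n}) (h : forall m, disk R m -> R).
Hypothesis h_continuous : forall m, continuous (@h m).
Hypothesis h_bound : forall m d, `|@h m d| <= 1.

(** The factor 1 - |d|^2 vanishes on the sphere and nowhere else. [h] is given on disks of all
    dimensions, so nothing has to be transported along the equality of the cell with [c]. *)
Definition cell_bump m (i : cells R X m) (d : disk R m) : R :=
  if `[< existT _ m i = c >] then (1 - nrm (val d) ^+ 2) * h d else 0.

Lemma one_minus_nrm (m : nat) (d : disk R m) : 0 <= 1 - nrm (val d) ^+ 2 <= 1.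
Proof.
have d1 : nrm (val d) <= 1 by apply/diskE; exact: (set_valP d).
by rewrite subr_ge0 expr_le1 ?nrm_ge0// d1 lerBlDr lerDl sqr_ge0.
Qed.

Lemma cell_bump_continuous m i : continuous (@cell_bump m i).
Proof.
rewrite /cell_bump; case: asboolP => _; last exact: cst_continuous.
have cn : continuous (fun d : disk R m => nrm (val d)) by exact: nrm_val_continuous.
have c1 : continuous (fun d : disk R m => 1 - nrm (val d) ^+ 2).
  by move=> d; exact: cvgB (cvg_cst _) (cvgM (@cn d) (@cn d)).
by move=> d; exact: cvgM (@c1 d) (@h_continuous _ d).
Qed.

Lemma cell_bump_boundary m i s : @cell_bump m i (sphere_disk s) = 0.
Proof.
rewrite /cell_bump; case: asboolP => // _.
have -> : nrm (val (sphere_disk s)) = 1 by exact: disk_boundary_sphere.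
by rewrite expr1n subrr mul0r.
Qed.

Lemma cell_bump_bound m i d : `|@cell_bump m i d| <= 1.
Proof.
rewrite /cell_bump; case: asboolP => _; last by rewrite normr0.
have /andP[d0 d1] := one_minus_nrm d.
by rewrite normrM (ger0_norm d0) mulr_ile1.
Qed.

(** Up to the dimension of [c], boundaries of cells lie in skeleta where the bump function is still
    0, so the radial part contributes nothing. *)
Lemma bump_cw_cell (p : cw) : (projT1 p <= projT1 c)%N ->
  bump_cw cell_bump p = @cell_bump _ (sval (projT2 p)).1 (sval (projT2 p)).2.
Proof.
move=> pc; rewrite /bump_cw /= radial_ext0 ?add0r// => s.
apply: (@bump_fun_eq0 _ (projT1 c)) => // k i d kc; rewrite /cell_bump.
by case: asboolP => // ic; move: kc; rewrite -ic ltnn.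
Qed.

Lemma cell_bump_cw_continuous : @pst_continuous cw real_line (bump_cw cell_bump).
Proof.
apply: bump_cw_continuous; [exact: cell_bump_continuous|
  exact: cell_bump_boundary|exact: cell_bump_bound].
Qed.

End one_cell_bump.

Lemma cell_point_lt1 n (o : cell_points R X n) :
  1 - nrm (val (sval o).2) ^+ 2 != 0 :> R.
Proof.
rewrite subr_eq0 eq_sym; apply/eqP => o1.
have /disk_boundaryP[s so] : disk_boundary (sval o).2.
  by apply/eqP; rewrite /= -(@eqrXn2 _ 2) ?nrm_ge0// o1 expr1n.
by have := svalP o; apply; exists s.
Qed.

Definition disk_coord (j : nat) m (d : disk R m) : R :=
  if insub j is Some j' then val d ord0 j' else 0.

Lemma disk_coord_continuous j m : continuous (@disk_coord j m).
Proof.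
rewrite /disk_coord; case: insubP => [j' _ _|_]; last exact: cst_continuous.
exact: coord_val_continuous.
Qed.

Lemma disk_coord_bound j m d : `|@disk_coord j m d| <= 1.
Proof.
rewrite /disk_coord; case: insubP => [j' _ _|_]; last by rewrite normr0.
by apply: le_trans (coord_le_nrm _ _) _; apply/diskE; exact: (set_valP d).
Qed.

(** Take [p] in the larger dimension and use bumps on its cell. The bump with [h] equal to 1 shows
    that [q] is in the same cell and has the same factor 1 - |d|^2; bumps with [h] a coordinate then
    recover the coordinates. *)
Lemma cw_separated (p q : cw) :
  (forall u : cw -> R, @pst_continuous cw real_line u -> u p = u q) -> p = q.
Proof.
wlog qp : p q / (projT1 q <= projT1 p)%N.
  move=> wl; have [|/ltnW pq] := leqP (projT1 q) (projT1 p); first exact: wl.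
  by move=> pq'; apply/esym/(wl _ _ pq) => u cu; rewrite pq'.
move=> pq.
pose h1 m (d : disk R m) : R := 1.
have h1c m : continuous (@h1 m) by exact: cst_continuous.
have h1b m d : `|@h1 m d| <= 1 by rewrite normr1.
have bp (h : forall m, disk R m -> R) :
    cell_bump (cell_of p) h (sval (projT2 p)).1 (sval (projT2 p)).2 =
    (1 - nrm (val (sval (projT2 p)).2) ^+ 2) * h _ (sval (projT2 p)).2.
  by rewrite /cell_bump; case: asboolP.
have bpq (h : forall m, disk R m -> R) (hc : forall m, continuous (h m))
    (hb : forall m (d : disk R m), `|h m d| <= 1) :
    (1 - nrm (val (sval (projT2 p)).2) ^+ 2) * h _ (sval (projT2 p)).2 =
    cell_bump (cell_of p) h (sval (projT2 q)).1 (sval (projT2 q)).2.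
  rewrite -bp -!bump_cw_cell//; apply: pq.
  exact: cell_bump_cw_continuous.
have [cpq|cpq] := pselect (cell_of q = cell_of p); last first.
  have := bpq _ h1c h1b; rewrite /cell_bump; case: asboolP => // _.
  by move/eqP; rewrite mulr1 (negbTE (cell_point_lt1 _)).
have {}bpq (h : forall m, disk R m -> R) (hc : forall m, continuous (h m))
    (hb : forall m (d : disk R m), `|h m d| <= 1) :
    (1 - nrm (val (sval (projT2 p)).2) ^+ 2) * h _ (sval (projT2 p)).2 =
    (1 - nrm (val (sval (projT2 q)).2) ^+ 2) * h _ (sval (projT2 q)).2.
  by rewrite bpq//; rewrite /cell_bump; case: asboolP.
move: bpq cpq; case: p {bp qp pq} => n o; case: q => m o' /= bpq.
move=> cpq; have nm : m = n by case: cpq.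
case: _ / nm o bpq cpq => o bpq cpq.
have e1 : (sval o').1 = (sval o).1.
  by apply: Eqdep_dec.inj_pair2_eq_dec cpq; exact: PeanoNat.Nat.eq_dec.
have e2 : (sval o').2 = (sval o).2.
  apply: val_inj; apply/rowP => j; apply/esym.
  have := bpq _ h1c h1b; rewrite !mulr1 => nn.
  have := bpq _ (@disk_coord_continuous j) (@disk_coord_bound j).
  rewrite -nn => /(mulfI (cell_point_lt1 _)).
  by rewrite /disk_coord; case: insubP => [j' _ /val_inj->|]; rewrite ?ltn_ord.
congr existT; case: o o' e1 e2 {bpq cpq} => [[i d] od] [[i' d'] od'] /= ei ed.
by move: od od'; rewrite ei ed => od od'; congr exist; exact: Prop_irrelevance.
Qed.

End bumps.

Lemma filter_ultraP (T : Type) (F : set_system T) (A : set T) : ProperFilter F ->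
  (forall U, UltraFilter U -> F `<=` U -> U A) -> F A.
Proof.
move=> FF FU; apply: contrapT => nFA.
have GF : ProperFilter (filter_from F (fun B => B `\` A)).
  apply: filter_from_proper.
    apply: filter_from_filter; first by exists setT; exact: filterT.
    by move=> B C FB FC; exists (B `&` C) => [|y [[]]//]; exact: filterI.
  move=> B FB; apply/set0P/eqP => BA; apply: nFA.
  by apply: filterS FB; rewrite -setD_eq0.
have [U [UU GU]] := ultraFilterLemma GF.
have UA : U A by apply: FU => // B FB; apply: GU; exists B => // y [].
have UnA : U (~` A) by apply: GU; exists setT; [exact: filterT|move=> y []].
by apply: (@filter_not_empty _ U); rewrite -(setICr A); exact: filterI.
Qed.

Lemma ultra_finite_fiber (T I : Type) (U : set_system T) (c : T -> I) (C : set I) :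
  UltraFilter U -> finite_set C -> U (c @^-1` C) -> exists i, U [set t | c t = i].
Proof.
move=> UU /(@finite_seqP {classic I})[s ->]; elim: s => [|i s IHs] Us.
  by have [t] := filter_ex Us; rewrite /= in_nil.
have [Ui|] : U [set t | c t = i] \/ U (c @^-1` [set` s]).
  apply: ultra_setU; apply: filterS Us => t /=; rewrite in_cons => /orP[/eqP|]; by [left|right].
- by exists i.
- exact: IHs.
Qed.

Section tau_compare.
Variables (R : realType) (X : psTop).
Local Notation sk := (skeleton R X).
Local Notation cw := (cw_approx R X).

(** Induction on the stage where the ultrafilter converges. In a closed cell it either lives on the
    sphere, hence one stage below, or on the open cell, where [T] has at most one point and the
    ultrafilter is principal. *)
Lemma transversal_closed (T : set cw) :
  (forall p q, T p -> T q -> cell_of p = cell_of q -> p = q) ->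
  forall V p, UltraFilter V -> pst_cvg V p -> V T -> T p.
Proof.
move=> Tinj V p UV /(cw_cvgP UV)[n]; elim: n V p UV => [|n IHn] V p UV.
  by move=> [U [[]]].
move=> [U [z [UU Uz <- <-]]] UT.
have sub (W : set_system (sk n)) (y : sk n) : UltraFilter W -> pst_cvg W y ->
    W [set y | T (skeleton_in n y)] -> T (skeleton_in n y).
  move=> UW Wy WT; apply: (IHn (fmap (skeleton_in n) W)) => //.
    exact: fmap_ultra.
  by exists W, y.
case: (skeleton_cvgP UU Uz) => [[W [y [UW Wy WU <-]]]|[i [W [d [UW Wd WU <-]]]]].
  by apply: sub Wy _ => //; move: UT; rewrite -WU.
have WT : W [set d | T (skeleton_in n.+1 (cell_char i d))] by move: UT; rewrite -WU.
have [Ws|Ws] := in_ultra_setVsetC (range (@sphere_disk R n)) UW.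
  have [W' [s [UW' Ws' WW sd]]] := sphere_ultra UW Ws Wd.
  rewrite -sd cell_char_incl; apply: (sub (fmap (cell_att i) W')).
  - exact: fmap_ultra.
  - exact: cell_att_continuous.
  - move: WT; rewrite -WW /fmap /=; apply: filterS => t /=.
    by rewrite cell_char_incl.
have WI : W ([set d | T (skeleton_in n.+1 (cell_char i d))] `&`
    ~` range (@sphere_disk R n)) by exact: filterI.
have cell_i e : ~ range (@sphere_disk R n) e -> exists o,
    [/\ cell_char i e = inr o & sval o = (i, e)].
  move=> es; case E : (cell_char i e) => [y|o].
    by have [s se _] := char_map_inl E; case: es; exists s.
  by exists o; rewrite (char_map_inr E).
have [e [Te es]] := filter_ex WI.
have We : W [set e].
  apply: filterS WI => e' [Te' es'].
  have [w [ieo oe]] := cell_i _ es; have [w' [ieo' oe']] := cell_i _ es'.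
  move: Te Te'; rewrite /= ieo ieo' => Te Te'.
  have cc : cell_of (existT _ n w' : cw) = cell_of (existT _ n w : cw).
    by rewrite /cell_of /= oe oe'.
  have h := Tinj _ _ Te' Te cc.
  have : w' = w by apply: Eqdep_dec.inj_pair2_eq_dec h; exact: PeanoNat.Nat.eq_dec.
  by move=> oo; move: oe'; rewrite oo oe => -[].
suff -> : d = e by [].
apply: (hausdorff_pst_cvg (@disk_hausdorff R n) Wd).
rewrite (ultra_set1 UW We); exact: (@pst_cvg_principal (psTop_of_top _)).
Qed.

Lemma transversal_tau_closed (T : set cw) :
  (forall p q, T p -> T q -> cell_of p = cell_of q -> p = q) ->
  closed (T : set (tau cw)).
Proof.
move=> Tinj; rewrite -[T]setCK; apply: open_closedC.
rewrite tau_openE => F p Fp nTp; have FF := pst_cvg_filter Fp.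
apply: filter_ultraP => U UU FU.
have [UT|//] := in_ultra_setVsetC T UU.
by case: nTp; exact: (transversal_closed Tinj UU (pst_cvg_sub Fp _ FU) UT).
Qed.

(** The classical argument: one point chosen in each cell that is met gives a set all of whose
    subsets are closed, and compactness of the source makes it finite. *)
Lemma compact_finite_cells (K : topologicalType) (g : K -> cw) :
  compact [set: K] -> @pst_continuous (psTop_of_top K) (psTop_of_top (tau cw)) g ->
  finite_set (range (@cell_of R X \o g)).
Proof.
move=> cK cg; set C := range _; apply: contrapT => Cinf.
(* Options are used because a value is needed for every cell, also for those not met, and [K] might
   be empty. *)
have /choice[r rC] : forall c : {n & cells R X n}, exists x : option K,
    C c -> exists2 y, x = Some y & cell_of (g y) = c.
  move=> c; have [[y _ yc]|nc] := pselect (C c); last by exists None.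
  by exists (Some y) => _; exists y.
pose T S := [set p | exists c x, [/\ C c, ~ S c, r c = Some x & g x = p]].
have Tcell p c x : C c -> r c = Some x -> g x = p -> cell_of p = c.
  by move=> /rC[y -> <-] [<-] <-.
have Tinj S p q : T S p -> T S q -> cell_of p = cell_of q -> p = q.
  move=> [c [x [Cc _ rx <-]]] [c' [x' [Cc' _ rx' <-]]].
  rewrite (Tcell _ _ _ Cc rx erefl) (Tcell _ _ _ Cc' rx' erefl) => cc.
  by move: rx'; rewrite -cc rx => -[->].
pose F := filter_from [set S : set {n & cells R X n} | finite_set S]
  (fun S => g @^-1` T S).
have FF : ProperFilter F.
  apply: filter_from_proper.
    apply: filter_from_filter; first by exists set0; exact: finite_set0.
    move=> S S' fS fS'; exists (S `|` S'); first by rewrite /= finite_setU.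
    by move=> x [c [y [Cc nS ry yx]]]; split; exists c, y; split=> // Sc; apply: nS;
      [left|right].
  move=> S fS; have [c [Cc nSc]] : (C `\` S) !=set0.
    apply/set0P/negP => /eqP CS; apply: Cinf; apply: sub_finite_set fS.
    by rewrite -setD_eq0.
  by have [x rx xc] := rC _ Cc; exists x, c, x.
have [U [UU FU]] := ultraFilterLemma FF.
have [x Ux] := compact_pst_cvg cK UU.
(* The limit is forced into the chosen points of cells other than its own, since removing one cell
   still leaves a closed set of the ultrafilter. *)
pose S := [set cell_of (g x)].
have : T S (g x).
  apply: (closed_pst_cvg (transversal_tau_closed (Tinj S)) (cg _ _ Ux)).
  by apply: FU; exists S => //; exact: finite_set1.
move=> [c [y [Cc nS ry yx]]]; apply: nS.
by rewrite /S /= (Tcell _ _ _ Cc ry yx).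
Qed.

(** Finiteness puts the image ultrafilter into one closed cell, where compactness of the disk
    provides a limit in the complex itself. Real functions continuous on the complex are continuous
    on the modification too, and they identify this limit with [g x]. *)
Lemma compact_tau_continuous (K : topologicalType) (g : K -> cw) :
  compact [set: K] -> @pst_continuous (psTop_of_top K) (psTop_of_top (tau cw)) g ->
  @pst_continuous (psTop_of_top K) cw g.
Proof.
move=> cK cg; apply/pst_continuousP => U x UU Ux.
have [c Uc] : exists c, U [set t | cell_of (g t) = c].
  apply: (ultra_finite_fiber UU (compact_finite_cells cK cg)).
  by apply: (@filterS _ U _ setT) => [t _|]; [exists t|exact: filterT].
have UgU := fmap_ultra g UU.
have gUc : fmap g U (range (@closed_cell R X c)).
  rewrite /fmap /=; apply: filterS Uc => t <-.
  by have [d dt] := closed_cell_of (g t); exists d.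
have [V UV Vg] := ultra_lift_range UgU gUc.
have [d Vd] := compact_pst_cvg (@disk_compact R (projT1 c)) UV.
have gd : pst_cvg (fmap g U) (closed_cell (c := c) d).
  by rewrite -Vg; exact: closed_cell_continuous.
suff -> : g x = closed_cell (c := c) d by [].
apply: cw_separated => u cu.
have cu' : @pst_continuous (psTop_of_top (tau cw)) (psTop_of_top (Real.sort R)) u.
  by apply/pst_continuous_top/tau_continuousP.
apply: (@hausdorff_pst_cvg (Real.sort R) (fmap u (fmap g U))).
- exact: norm_hausdorff.
- exact: cu' (cg _ _ Ux).
- exact: cu gd.
Qed.

Lemma tau_unit_weak_lift :
  @weak_lift R (psTop_of_top (tau cw)) cw (fun p => p).
Proof.
move=> k a H ca cH aH; exists H; split=> //.
- by apply: compact_tau_continuous => //; exact: disk_compact.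
- exact: hrel_refl.
Qed.

End tau_compare.

(** * Maps from a sphere to a space of larger dimension can avoid the origin *)

Section perturbation.
Variable R : realType.

(** The pairs at which the bound fails form, up to closure, a decreasing sequence of closed sets in
    a compact space. A common pair would have equal images under [iota], hence equal points, which
    the case M = 0 excludes. *)
Lemma uniform_lower_bound (L : topologicalType) (V : normedModType R)
    (iota : L -> V) (psi : L -> R) (e : R) : compact [set: L] ->
  continuous iota -> injective iota -> continuous psi -> 0 < e ->
  exists M : nat, forall x y, psi x - e <= psi y + M%:R * `|iota x - iota y|.
Proof.
move=> cL ci ii cpsi e0; apply: contrapT => /forallNP no.
pose A (M : nat) := [set p : L * L |
  psi p.2 + M%:R * `|iota p.1 - iota p.2| <= psi p.1 - e].
have cfst : continuous (@fst L L) by move=> p; exact: cvg_fst.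
have csnd : continuous (@snd L L) by move=> p; exact: cvg_snd.
have c1 : continuous (fun p : L * L => psi p.1).
  by move=> p; exact: cvg_comp (@cfst p) (@cpsi _).
have c2 : continuous (fun p : L * L => psi p.2).
  by move=> p; exact: cvg_comp (@csnd p) (@cpsi _).
have i1 : continuous (fun p : L * L => iota p.1).
  by move=> p; exact: cvg_comp (@cfst p) (@ci _).
have i2 : continuous (fun p : L * L => iota p.2).
  by move=> p; exact: cvg_comp (@csnd p) (@ci _).
have cA M : closed (A M).
  apply: closed_le_fun => p.
    apply: cvgD; first exact: c2.
    exact: cvgM (cvg_cst _) (cvg_norm (cvgB (@i1 p) (@i2 p))).
  exact: cvgB (@c1 p) (cvg_cst _).
have FF : ProperFilter (filter_from [set: nat] A).
  apply: filter_from_proper.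
    apply: filter_from_filter; first by exists 0%N.
    move=> m n _ _; exists (maxn m n) => // p Ap; split; apply: le_trans Ap;
      by rewrite lerD2l ler_wpM2r// ler_nat ?leq_maxl ?leq_maxr.
  move=> M _; have /existsNP[x /existsNP[y xy]] := no M.
  by exists (x, y); apply/ltW; rewrite ltNge; apply/negP.
have [U [UU FU]] := ultraFilterLemma FF.
have cLL : compact [set: L * L] by rewrite -setXTT; exact: compact_setX.
have [p Up] := compact_pst_cvg cLL UU.
have pA M : A M p by apply: closed_pst_cvg Up _ => //; apply: FU; exists M.
have [d0|d0] := eqVneq (`|iota p.1 - iota p.2|) 0.
  have := pA 0%N; rewrite /A /= mul0r addr0.
  by have -> : p.1 = p.2; [apply: ii; apply/eqP; rewrite -subr_eq0 -normr_eq0 d0|lra].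
have dp : 0 < `|iota p.1 - iota p.2| by rewrite lt_def d0 normr_ge0.
pose B := `|psi p.1 - e - psi p.2| / `|iota p.1 - iota p.2|.
have B0 : 0 <= B by rewrite divr_ge0.
have := pA (Num.bound B); rewrite /A /=.
have := archi_boundP B0; rewrite ltr_pdivrMr// => h1 h2.
have := ler_norm (psi p.1 - e - psi p.2); lra.
Qed.

(** The approximation is the inf-convolution x -> inf_y (psi y + M |iota x - iota y|). It is
    M-Lipschitz, at most [psi] by taking y = x, and at least psi - e by the preceding bound. *)
Lemma lipschitz_approx (L : topologicalType) (V : normedModType R)
    (iota : L -> V) (psi : L -> R) (e : R) : compact [set: L] ->
  continuous iota -> injective iota -> continuous psi -> 0 < e ->
  exists (M : nat) (phi : L -> R),
    (forall x y, `|phi x - phi y| <= M%:R * `|iota x - iota y|) /\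
    (forall x, `|phi x - psi x| <= e).
Proof.
move=> cL ci ii cpsi e0.
have [M MP] := uniform_lower_bound cL ci ii cpsi e0.
pose E x := [set psi y + M%:R * `|iota x - iota y| | y in [set: L]].
have lbE x : lbound (E x) (psi x - e) by move=> _ [y _ <-]; exact: MP.
have Ex x y : E x (psi y + M%:R * `|iota x - iota y|) by exists y.
have iE x y : inf (E x) <= psi y + M%:R * `|iota x - iota y|.
  by apply: ge_inf => //; exists (psi x - e).
have Ei x r : lbound (E x) r -> r <= inf (E x).
  by apply: lb_le_inf; exists (psi x + M%:R * `|iota x - iota x|).
exists M, (fun x => inf (E x)); split=> [x y|x].
  have half x' y' : inf (E x') - inf (E y') <= M%:R * `|iota x' - iota y'|.
    rewrite lerBlDl -lerBlDr; apply: Ei => _ [z _ <-].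
    rewrite lerBlDr; apply: le_trans (iE x' z) _.
    rewrite -addrA lerD2l -mulrDr ler_wpM2l ?ler0n//.
    by rewrite [leRHS]addrC; exact: ler_distD.
  rewrite ler_norml half andbT lerNl opprB.
  by rewrite (distrC (iota x)); exact: half.
have h1 := Ei _ _ (lbE x); have h2 := iE x x.
move: h2; rewrite subrr normr0 mulr0 addr0 => h2.
rewrite ler_norml; apply/andP; split; lra.
Qed.

Lemma lipschitz_continuous (L : topologicalType) (V : normedModType R)
    (iota : L -> V) (phi : L -> R) (M : R) : continuous iota ->
  (forall x y, `|phi x - phi y| <= M * `|iota x - iota y|) -> continuous phi.
Proof.
move=> ci lip x; apply/subr_cvg0.
apply/(@norm_cvg0P _ _ _ (nbhs (x : L))).
have h : (fun y => M * `|iota y - iota x|) @ (x : L) --> (0 : R).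
  rewrite -[X in _ --> X](mulr0 M) -[X in M * X](normr0 V) -(subrr (iota x)).
  exact: cvgM (cvg_cst _) (cvg_norm (cvgB (@ci x) (cvg_cst _))).
apply: squeeze_cvgr (cvg_cst (0 : R)) h.
by apply: nearW => y; rewrite normr_ge0 lip.
Qed.

(* A point is coded by a face of the cube containing it, given by a coordinate and
   its sign, and by the rounded remaining coordinates. That the number of codes
   grows like [N ^ k] and not [N ^ k.+1] is what the pigeonhole argument needs. *)
Lemma sup_sphere_cover k (N : nat) : (0 < N)%N ->
  exists code : 'rV[R]_k.+1 -> 'I_k.+1 * bool * {ffun 'I_k -> 'I_(2 * N).+1},
    forall x y, `|x| = 1 -> `|y| = 1 -> code x = code y -> `|x - y| <= N%:R^-1.
Proof.
move=> N0; have N0' : (0 : R) < N%:R by rewrite ltr0n.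
have /choice[face faceP] : forall x : 'rV[R]_k.+1, exists i, `|x| = 1 -> `|x ord0 i| = 1.
  move=> x; have [x0|/norm_coord[i xi]] := eqVneq x 0.
    by exists ord0; rewrite x0 normr0 => /eqP; rewrite eq_sym oner_eq0.
  by exists i => <-.
(* Coordinates lie between -1 and 1, so the scaled value is between 0 and 2 N and there are 2 N + 1
   levels. *)
pose level (r : R) : nat := Num.truncn (N%:R * (r + 1)).
exists (fun x => (face x, x ord0 (face x) == 1,
  [ffun l => inord (level (x ord0 (lift (face x) l)))])) => x y x1 y1.
case=> fxy sxy /ffunP lxy.
have N1 : (0 : R) <= N%:R^-1 by rewrite invr_ge0 ltW.
apply: norm_le_coord => // j; rewrite !mxE.
have [l ->|->] := unliftP (face x) j; last first.
  have := faceP y y1; have := faceP x x1; rewrite -fxy in sxy *.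
  rewrite /eqP => /eqP; rewrite eqr_norml => /andP[hx _] /eqP; rewrite eqr_norml => /andP[hy _].
  move: sxy hx hy; case: eqP => [->|_]; case: eqP => [->|_] //= _; rewrite ?subrr ?normr0//.
  by move=> /eqP-> /eqP->; rewrite subrr normr0.
have lev (z : 'rV[R]_k.+1) i : `|z| = 1 -> (level (z ord0 i) <= 2 * N)%N /\
    (level (z ord0 i))%:R <= N%:R * (z ord0 i + 1) < (level (z ord0 i)).+1%:R.
  move=> z1; have : `|z ord0 i| <= 1 by rewrite -z1 coord_le_norm.
  rewrite ler_norml => /andP[za zb].
  have z0 : 0 <= N%:R * (z ord0 i + 1) by rewrite mulr_ge0 ?ler0n//; lra.
  have tr := truncn_itv z0; split=> //.
  rewrite -(ler_nat R); apply: le_trans (andP tr).1 _.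
  by rewrite natrM mulrC ler_wpM2r ?ler0n//; lra.
have := lxy l; rewrite !ffunE -fxy => /(congr1 val).
have [bx /andP[x_lo x_hi]] := lev x (lift (face x) l) x1.
have [by_ /andP[y_lo y_hi]] := lev y (lift (face x) l) y1.
rewrite /= !inordK ?ltnS// => e; rewrite e in x_lo x_hi.
rewrite -(@ler_pM2l _ N%:R)// mulfV ?gt_eqF// -[N%:R in leLHS]gtr0_norm//.
rewrite -normrM ler_norml; move: x_lo x_hi y_lo y_hi; rewrite -natr1 => *.
apply/andP; split; lra.
Qed.

(** If all of the small cube were hit, choose a preimage for each of the G^n points of a grid of
    mesh h / G. Preimages with the same code would have images closer than the mesh, so there must
    be at least G^n codes; but there are fewer, because k < n. *)
Lemma lipschitz_misses k n (L : Type) (iota : L -> 'rV[R]_k.+1)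
    (phi : L -> 'rV[R]_n) (M : nat) (h : R) : (k < n)%N -> 0 < h ->
  (forall x, `|iota x| = 1) ->
  (forall x y j, `|phi x ord0 j - phi y ord0 j| <= M%:R * `|iota x - iota y|) ->
  exists p : 'rV[R]_n, (forall j, 0 <= p ord0 j <= h) /\ forall x, phi x != p.
Proof.
move=> kn h0 iota1 lip; apply: contrapT => /forallNP no.
have {no}hit (p : 'rV[R]_n) : (forall j, 0 <= p ord0 j <= h) -> exists x, phi x = p.
  move=> ph; have := no p; move=> /not_andP[//|/existsNP[x /negP]].
  by rewrite negbK => /eqP xp; exists x.
pose c := (Num.bound (M%:R / h)).+1.
have cM : M%:R < c%:R * h.
  rewrite -ltr_pdivrMr//; apply: lt_trans (archi_boundP _) _.
    by rewrite divr_ge0 ?ler0n// ltW.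
  by rewrite ltr_nat.
(* With N = c G, a common code gives images within M / N, which is less than h / G by the choice of
   c. The number of codes is 2 (k + 1) (2 N + 1)^k, at most 2 (k + 1) (3 c)^k G^k since 2 N + 1 <= 3
   N; [G] is one more than the factor in front of G^k. *)
pose G := (2 * k.+1 * (3 * c) ^ k).+1; pose N := (c * G)%N.
have G0 : (0 : R) < G%:R by rewrite ltr0n.
have N0 : (0 < N)%N by rewrite muln_gt0.
have [code codeP] := sup_sphere_cover k N0.
have /choice[pt ptP] : forall g : {ffun 'I_n -> 'I_G}, exists x,
    phi x = \row_j (h * (g j)%:R / G%:R).
  move=> g; apply: hit => j; rewrite mxE; apply/andP; split.
    by rewrite divr_ge0 ?mulr_ge0 ?ler0n// ltW.
  by rewrite ler_pdivrMr// ler_wpM2l ?(ltW h0)// ler_nat ltnW.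
have inj : injective (fun g => code (iota (pt g))).
  move=> g g' /codeP => /(_ (iota1 _) (iota1 _)) gg'.
  apply/ffunP => j; apply/val_inj/eqP; apply: contraT => gj.
  have := lip (pt g) (pt g') j; rewrite !ptP !mxE -mulrBl -mulrBr.
  rewrite !normrM normfV (gtr0_norm h0) (gtr0_norm G0) => hl.
  have h1 : (1 : R) <= `|(g j)%:R - (g' j)%:R|.
    move: gj; rewrite neq_ltn => /orP[]; rewrite -(ltr_nat R) => lt; move: (lt);
      rewrite ltr_nat -(ler_nat R) -natr1 => le.
      by rewrite ltr0_norm ?subr_lt0//; lra.
    by rewrite gtr0_norm ?subr_gt0//; lra.
  have h2 : h / G%:R <= M%:R / N%:R.
    apply: le_trans (_ : _ <= h * `|(g j)%:R - (g' j)%:R| / G%:R) _.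
      by rewrite ler_wpM2r ?invr_ge0 ?(ltW G0)// ler_peMr// ltW.
    by apply: le_trans hl _; rewrite ler_wpM2l.
  move: h2; rewrite /N natrM invfM mulrA ler_pM2r ?invr_gt0//.
  by rewrite ler_pdivlMr ?ltr0n// leNgt mulrC cM.
have := leq_card _ inj; rewrite !card_prod !card_ffun !card_ord card_bool => le1.
have le2 : (G ^ k.+1 <= G ^ n)%N by rewrite leq_pexp2l.
have le3 : ((2 * N).+1 ^ k <= (3 * c) ^ k * G ^ k)%N.
  have [->|k0] := posnP k; first by rewrite !expn0.
  by rewrite -expnMn leq_exp2r// -mulnA -/N; lia.
have le4 : (G * G ^ k <= (2 * k.+1 * (3 * c) ^ k) * G ^ k)%N.
  rewrite -expnS; apply: leq_trans le2 (leq_trans le1 _).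
  by rewrite (mulnC 2 k.+1) -[leqRHS]mulnA leq_mul2l le3 orbT.
by move: le4; rewrite leq_pmul2r ?expn_gt0// ltnn.
Qed.

(** A Lipschitz approximation misses some value near 0; subtracting it gives a map without zeros.
    Each of the two modifications costs e / 2. *)
Lemma perturb_nonzero k n (psi : sphere R k -> 'rV[R]_n) (e : R) :
  (k <= n)%N -> 0 < e -> continuous psi ->
  exists phi : sphere R k -> 'rV[R]_n, [/\ continuous phi,
    forall s, phi s != 0 & forall s j, `|phi s ord0 j - psi s ord0 j| <= e].
Proof.
case: k psi => [|k] psi kn e0 cpsi.
  exists psi; split=> // s; last by move=> j; rewrite subrr normr0 ltW.
  by have := set_valP s; rewrite /sphere /= big_ord0 => /eqP; rewrite eq_sym oner_eq0.
(* The codes live on the sphere of the sup norm, hence the rescaling. *)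
pose iota (s : sphere R k.+1) := to_sup (val s).
have iota1 s : `|iota s| = 1.
  by rewrite norm_to_sup; apply/sphereE; exact: (set_valP s).
have ci : continuous iota.
  move=> s; apply: (@continuous_comp _ _ _ (fun s : sphere R k.+1 => val s)).
    exact: val_continuous.
  exact: to_sup_continuous.
have ii : injective iota.
  by move=> s t /(can_inj (@to_supK R k.+1)) st; exact: val_inj.
have e2 : 0 < e / 2 by rewrite divr_gt0.
have cpsij j : continuous (fun s => psi s ord0 j).
  move=> s; apply: (@continuous_comp _ _ _ psi (fun x : 'rV[R]_n => x ord0 j)).
    exact: cpsi.
  exact: coord_continuous.
have /choice[M /choice[phi phiP]] := fun j => lipschitz_approx
  (@sphere_compact R k.+1) ci ii (@cpsij j) e2.
pose phi0 s : 'rV[R]_n := \row_j phi j s.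
have lip x y j : `|phi0 x ord0 j - phi0 y ord0 j| <=
    (\sum_j M j)%:R * `|iota x - iota y|.
  rewrite !mxE; apply: le_trans ((phiP j).1 x y) _.
  by rewrite ler_wpM2r// ler_nat (bigD1 j)//= leq_addr.
have [p [pe pP]] := lipschitz_misses kn e2 iota1 lip.
exists (fun s => phi0 s - p); split.
- apply: mx_continuous => i j; rewrite (ord1 i).
  apply: (lipschitz_continuous ci (M := (\sum_j M j)%:R)) => x y.
  by have := lip x y j; rewrite !mxE; congr (`|_| <= _); ring.
- by move=> s; rewrite subr_eq0.
- move=> s j; have /andP[p0 p1] := pe j; have := (phiP j).2 s; rewrite !mxE.
  rewrite !ler_norml => /andP[h1 h2]; apply/andP; split; lra.
Qed.

End perturbation.

(** * Pushing spheres down to lower skeleta *)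

Section compression.
Variables (R : realType) (X : psTop).
Local Notation sk := (skeleton R X).
Local Notation cw := (cw_approx R X).

(** A cutoff: 1 on the half disk, 0 on the sphere, linear in the radius between. *)
Definition plateau n (d : disk R n) : R := val (clampI (2 - 2 * nrm (val d))).

Lemma plateau_continuous n : continuous (@plateau n).
Proof.
have cn : continuous (fun d : disk R n => nrm (val d)) by exact: nrm_val_continuous.
have c2 : continuous (fun d : disk R n => 2 - 2 * nrm (val d)).
  by move=> d; exact: cvgB (cvg_cst _) (cvgM (cvg_cst _) (@cn d)).
move=> d; apply: (@continuous_comp _ _ _ (fun d : disk R n => clampI (2 - 2 * nrm (val d)))
  (fun t : unitI R => val t)); last exact: val_continuous.
exact: cvg_comp (@c2 d) (@clampI_continuous R _).
Qed.

Lemma plateau_boundary n (d : disk R n) : nrm (val d) = 1 -> plateau d = 0.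
Proof. by move=> d1; rewrite /plateau d1 mulr1 subrr val_clampI// lexx ler01. Qed.

Lemma plateau_center n (d : disk R n) : nrm (val d) <= 2^-1 -> plateau d = 1.
Proof.
move=> d1; rewrite /plateau /= /clampr; have := nrm_ge0 (val d) => d0.
by rewrite ger0_norm ?ler0_norm; lra.
Qed.

Section cell_coordinate.
Variables (n : nat) (i : cells R X n).

(** The coordinate in the open cell [i], cut off so that it extends by 0 to the whole skeleton. On
    the half disk it is the true coordinate. *)
Definition cell_coord (z : sk n.+1) : 'rV[R]_n :=
  match z with
  | inl _ => 0
  | inr o => if `[< (sval o).1 = i >] then plateau (sval o).2 *: val (sval o).2
             else 0
  end.

Lemma cell_coord_char (i' : cells R X n) d : cell_coord (cell_char i' d) =
  if `[< i' = i >] then plateau d *: val d else 0.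
Proof.
case E : (cell_char i' d) => [y|o] /=; last by rewrite (char_map_inr E).
have [s <- _] := char_map_inl E; case: asboolP => // _.
by rewrite plateau_boundary ?scale0r//; exact: disk_boundary_sphere.
Qed.

Lemma cell_coord_continuous :
  @pst_continuous (sk n.+1) (psTop_of_top 'rV[R]_n) cell_coord.
Proof.
apply/attach_continuousP; split; first exact: pst_continuous_cst.
move=> i'; apply: (@pst_continuous_eq (psTop_of_top (disk R n)) (psTop_of_top 'rV[R]_n)
  (fun d => if `[< i' = i >] then plateau d *: val d else 0)).
  by move=> d; rewrite -cell_coord_char.
apply/pst_continuous_top; case: asboolP => _; last exact: cst_continuous.
by move=> d; exact: cvgZ (@plateau_continuous _ d) (@val_continuous _ _ d).
Qed.

End cell_coordinate.

(* In each cell, [g] is perturbed near the center so as to miss the center, and is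
   then pushed radially to the boundary. All cells are treated at once: a convergent
   ultrafilter only sees one closed cell. *)
Lemma compress_step k n (g : sphere R k -> sk n.+1) : (k <= n)%N ->
  @pst_continuous (psTop_of_top (sphere R k)) (sk n.+1) g ->
  exists h : sphere R k -> sk n,
    @pst_continuous (psTop_of_top (sphere R k)) (sk n) h /\
    hrel R set0 g (@skeleton_incl R X n \o h).
Proof.
(* For n = 0 also k = 0, and the sphere is empty; [sdir] needs positive dimension. *)
case: n g => [|n] g kn cg.
  have k0 : k = 0%N by apply/eqP; rewrite -leqn0.
  have no (s : sphere R k) : False.
    move: s; rewrite k0 => s; have := set_valP s.
    by rewrite /sphere /= big_ord0 => /eqP; rewrite eq_sym oner_eq0.
  exists (fun s => False_rect _ (no s)); split.
    by apply/pst_continuousP => U s; case: (no s).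
  exists (fun p => False_rect _ (no p.1)); split=> [|s|s|s]; try by case: (no s).
  by apply/pst_continuousP => U [s ?]; case: (no s).
(* Chosen so that a vector of sup norm at most [e] has Euclidean norm less than 1/2. *)
pose e : R := (2 * (Num.sqrt n.+1%:R + 1))^-1.
have sq0 : 0 <= Num.sqrt n.+1%:R :> R by exact: sqrtr_ge0.
have e0 : 0 < e by rewrite invr_gt0; lra.
have /choice[phi phiP] : forall i : cells R X n.+1,
    exists phi : sphere R k -> 'rV[R]_n.+1, [/\ continuous phi,
      forall s, phi s != 0 &
      forall s j, `|phi s ord0 j - cell_coord i (g s) ord0 j| <= e].
  move=> i; apply: perturb_nonzero => //.
  by apply/pst_continuous_top/(pst_continuous_comp cg)/cell_coord_continuous.
(* On the half disk the shifted point is [phi i x], which is not 0; on the sphere it is the point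
   itself. In between it moves by at most [e] in each coordinate, too little to reach 0. *)
pose shift i x (d : disk R n.+1) : 'rV[R]_n.+1 :=
  val d + plateau d *: (phi i x - cell_coord i (g x)).
have shift_neq0 i x d : g x = cell_char i d -> shift i x d != 0.
  move=> gx; have [_ phi0 phie] := phiP i.
  have [d2|d2] := lerP (nrm (val d)) 2^-1.
    rewrite /shift gx cell_coord_char; case: asboolP => // _.
    by rewrite plateau_center// !scale1r addrC subrK.
  apply/eqP => s0; have de : `|val d| <= e.
    apply: norm_le_coord => [|j]; first exact: ltW.
    have -> : val d = - (plateau d *: (phi i x - cell_coord i (g x))).
      by apply/eqP; rewrite -addr_eq0 -[_ + _]/(shift i x d) s0.
    have := phie x j; rewrite !mxE normrN normrM => h; apply: le_trans h.
    by rewrite ler_piMl// ger0_norm; have := unitIP (clampI (2 - 2 * nrm (val d))) => /andP[].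
  have := le_trans (nrm_le_norm (val d)) (ler_wpM2l sq0 de).
  rewrite leNgt => /negP; apply; apply: le_lt_trans d2.
  by rewrite /e ler_pdivrMr; lra.
have shift_boundary i x d : nrm (val d) = 1 -> shift i x d = val d.
  by move=> d1; rewrite /shift plateau_boundary// scale0r addr0.
have push_subproof (t : unitI R) (d : disk R n.+1) (s : sphere R n.+1) :
    (1 - val t) *: val d + val t *: val s \in disk R n.+1.
  apply/mem_set/diskE; apply: nrm_conv_le1; first exact: unitIP.
    by apply/diskE; exact: (set_valP d).
  by have /sphereE -> := set_valP s.
(* The segment from [d] to the radial projection of its shift; it stays in the disk by convexity and
   fixes the sphere. *)
pose push i x d t : disk R n.+1 := set_sub (push_subproof t d (sdir (shift i x d))).
have push0 i x d (t : unitI R) : val t = 0 -> push i x d t = d.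
  by move=> t0; apply: val_inj; rewrite /= -[sval t]/(val t) t0 subr0 scale1r scale0r addr0.
have push1 i x d (t : unitI R) : val t = 1 -> push i x d t = sphere_disk (sdir (shift i x d)).
  by move=> t1; apply: val_inj; rewrite /= -[sval t]/(val t) t1 subrr scale1r scale0r add0r.
have push_boundary i x (s : sphere R n.+1) t : push i x (sphere_disk s) t = sphere_disk s.
  apply: val_inj; rewrite /= shift_boundary; last exact: disk_boundary_sphere.
  by rewrite sdir_sphere -scalerDl subrK scale1r.
pose A (p : (sphere R k * unitI R)%type) : sk n.+2 :=
  match g p.1 with
  | inl y => inl y
  | inr o => cell_char (sval o).1 (push (sval o).1 p.1 (sval o).2 p.2)
  end.
have A_char x t i d : g x = cell_char i d -> A (x, t) = cell_char i (push i x d t).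
  move=> gx; rewrite /A /= gx; case E : (cell_char i d) => [y|o]; last first.
    by rewrite (char_map_inr E).
  have [s sd ys] := char_map_inl E.
  by rewrite -sd push_boundary cell_char_incl ys.
have A0 x (t : unitI R) : val t = 0 -> A (x, t) = g x.
  move=> t0; rewrite /A /=; case: (g x) => // o.
  by rewrite push0// cell_char_open.
pose h x : sk n.+1 := match g x with
  | inl y => y
  | inr o => cell_att (sval o).1 (sdir (shift (sval o).1 x (sval o).2))
  end.
have A1 x (t : unitI R) : val t = 1 -> A (x, t) = skeleton_incl (h x).
  move=> t1; rewrite /A /h /=; case: (g x) => // o.
  by rewrite push1// cell_char_incl.
have cA : @pst_continuous (psTop_of_top (sphere R k * unitI R)%type) (sk n.+2) A.
  apply/pst_continuousP => U [x t] UU Uxt.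
  have Ux : @pst_cvg (psTop_of_top (sphere R k)) (fmap fst U) x.
    have /pst_continuous_top cfst : continuous (@fst (sphere R k) (unitI R)).
      by move=> p; exact: cvg_fst.
    exact: cfst Uxt.
  have Ut : @pst_cvg (psTop_of_top (unitI R)) (fmap snd U) t.
    have /pst_continuous_top csnd : continuous (@snd (sphere R k) (unitI R)).
      by move=> p; exact: cvg_snd.
    exact: csnd Uxt.
  have UgU : UltraFilter (fmap (g \o fst) U) by exact: fmap_ultra.
  have gUx : pst_cvg (fmap (g \o fst) U) (g x) by exact: cg Ux.
  have [[W [y [UW Wy WU yx]]]|[i [V [d [UV Vd VU dx]]]]] := skeleton_cvgP UgU gUx.
    have Ui : U [set p | exists y, g p.1 = inl y].
      rewrite -[U _]/(fmap (g \o fst) U [set z | exists y : sk n.+1, z = inl y]) -WU.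
      by rewrite /fmap /=; apply: (@filterS _ W _ setT) => [z _|]; [exists z|exact: filterT].
    have -> : A (x, t) = g x by rewrite /A /= -yx.
    rewrite (fmap_eq_on (g := g \o fst) _ Ui) => // -[x' t'] [y' /= xy'].
    by rewrite /A /= xy'.
  (* An ultrafilter of triples (x, t, d), with [d] a cell coordinate of [g x]. Along it the homotopy
     is an explicit formula, even where [d] is on the sphere. *)
  have [W' [UW' W'U W'V W'g]] := ultra_pullback UU UV (esym VU).
  rewrite (A_char x t i d)// -W'U.
  have -> : fmap A (fmap fst W') =
      fmap (fun p => cell_char i (push i p.1.1 p.2 p.1.2)) W'.
    apply: (fmap_eq_on (f := A \o fst) _ W'g) => -[[x' t'] d'] /= gx'.
    exact: A_char.
  have W'x : (fun p : sphere R k * unitI R * disk R n.+1 => p.1.1) @ W' --> x.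
    have [_ xU] := Ux; apply: subset_trans xU _ => B.
    by rewrite -W'U.
  have W't : (fun p : sphere R k * unitI R * disk R n.+1 => p.1.2) @ W' --> t.
    have [_ tU] := Ut; apply: subset_trans tU _ => B.
    by rewrite -W'U.
  have W'd : (fun p : sphere R k * unitI R * disk R n.+1 => p.2) @ W' --> d.
    have [_ dV] := Vd; apply: subset_trans dV _ => B.
    by rewrite -W'V.
  have W'vt : (fun p : sphere R k * unitI R * disk R n.+1 => val p.1.2 : R) @ W' --> val t.
    exact: cvg_comp W't (@val_continuous _ _ t).
  have W'vd : (fun p : sphere R k * unitI R * disk R n.+1 => val p.2 : 'rV[R]_n.+1) @ W'
      --> val d by exact: cvg_comp W'd (@val_continuous _ _ d).
  have [cphi _ _] := phiP i.
  have ccoord : continuous (fun x => cell_coord i (g x)).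
    by apply/pst_continuous_top/(pst_continuous_comp cg)/cell_coord_continuous.
  have cshift : (fun p : sphere R k * unitI R * disk R n.+1 => shift i p.1.1 p.2) @ W'
      --> shift i x d.
    apply: cvgD; first exact: W'vd.
    apply: cvgZ; first exact: cvg_comp W'd (@plateau_continuous _ d).
    by apply: cvgB; [exact: cvg_comp W'x (@cphi x)|exact: cvg_comp W'x (@ccoord x)].
  have cdir : (fun p : sphere R k * unitI R * disk R n.+1 => sdir (shift i p.1.1 p.2)) @ W'
      --> sdir (shift i x d).
    exact: (cvg_comp _ _ cshift (sdir_continuous (shift_neq0 _ _ _ (esym dx)))).
  have cvdir : (fun p : sphere R k * unitI R * disk R n.+1 =>
      val (sdir (shift i p.1.1 p.2)) : 'rV[R]_n.+1) @ W' --> val (sdir (shift i x d)).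
    exact: cvg_comp cdir (@val_continuous _ _ (sdir (shift i x d))).
  apply: (@cell_char_continuous _ _ _ i (fmap (fun p => push i p.1.1 p.2 p.1.2) W')).
  apply: pst_cvg_val.
  suff : (fun p : sphere R k * unitI R * disk R n.+1 => (1 - val p.1.2) *: val p.2 +
      val p.1.2 *: val (sdir (shift i p.1.1 p.2)) : 'rV[R]_n.+1) @ W' -->
    (1 - val t) *: val d + val t *: val (sdir (shift i x d)) by [].
  apply: cvgD; last exact: cvgZ W'vt cvdir.
  by apply: cvgZ; [apply: cvgB; [exact: cvg_cst|exact: W'vt]|exact: W'vd].
have hA : hrel R set0 g (@skeleton_incl R X n.+1 \o h).
  by exists A; split.
exists h; split=> //; apply/pst_continuousP => U x UU Ux.
(* The end of the homotopy is continuous into the larger skeleton, and the smaller one is embedded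
   in it. *)
apply: skeleton_incl_embed; first exact: fmap_ultra.
have [_ ch] := hrel_continuous hA.
exact: ch Ux.
Qed.

(** Compactness of the sphere gives some finite stage. From a stage above [k] one descends by
    [compress_step], and from a stage below one includes. *)
Lemma compress k (a : sphere R k -> cw) :
  @pst_continuous (psTop_of_top (sphere R k)) cw a ->
  exists h : sphere R k -> sk k,
    @pst_continuous (psTop_of_top (sphere R k)) (sk k) h /\
    hrel R set0 a (fun s => skeleton_in k (h s)).
Proof.
move=> ca; have [m [g [cg ga]]] := compact_skeleton (@sphere_compact R k) ca.
have {}ga : a = (fun s => skeleton_in m (g s)) by apply/funext => s; rewrite ga.
rewrite ga; elim: m g cg {a ca ga} => [|m IHm] g cg.
  have [h [ch hg]] : exists h : sphere R k -> sk k,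
      @pst_continuous (psTop_of_top (sphere R k)) (sk k) h /\
      forall s, skeleton_in k (h s) = skeleton_in 0 (g s).
    by exists (fun s => of_void _ (g s)); split=> [|s]; [|case: (g s)];
      apply/pst_continuousP => U s; case: (g s).
  exists h; split=> //; rewrite (_ : (fun s => _) = fun s => skeleton_in 0 (g s)).
    by apply: hrel_refl; exact: (pst_continuous_comp cg (@skeleton_in_continuous R X 0)).
  by apply/funext => s; rewrite hg.
have [km|mk] := leqP k m; last first.
  (* The index [j + m.+1] is in this order so that its successor computes and [skeleton_incl]
     applies without a cast. *)
  have up j : (m.+1 + j <= k)%N -> exists h : sphere R k -> sk (j + m.+1),
      @pst_continuous (psTop_of_top (sphere R k)) (sk (j + m.+1)) h /\
      forall s, skeleton_in _ (h s) = skeleton_in m.+1 (g s).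
    elim: j => [|j IHj] jk; first by exists g.
    have [|h [ch hg]] := IHj; first by apply: leq_trans jk; rewrite leq_add2l.
    exists (fun s => skeleton_incl (h s)); split=> //.
    exact: (pst_continuous_comp ch (@skeleton_incl_continuous R X _)).
  have [|h] := up (k - m.+1)%N; first by rewrite subnKC.
  move: h; rewrite subnK// => h [ch hg].
  exists h; split=> //; rewrite (_ : (fun s => skeleton_in k _) = fun s => skeleton_in m.+1 (g s)).
    by apply: hrel_refl; exact: (pst_continuous_comp cg (@skeleton_in_continuous R X m.+1)).
  by apply/funext => s; rewrite hg.
have [g' [cg' gg']] := compress_step km cg.
have [h [ch g'h]] := IHm g' cg'; exists h; split=> //.
apply: hrel_trans g'h.
exact: (hrel_comp (@skeleton_in_continuous R X m.+1) gg').
Qed.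

End compression.

(** * Collars and the lifting property *)

Section collar.
Variables (R : realType) (n : nat) (Z : psTop).
Variables (P : disk R n.+1 -> Z) (Q : (sphere R n.+1 * unitI R)%type -> Z).
Hypotheses (cP : @pst_continuous (psTop_of_top (disk R n.+1)) Z P)
  (cQ : @pst_continuous (psTop_of_top (sphere R n.+1 * unitI R)%type) Z Q).
Hypothesis PQ : forall s (t : unitI R), val t = 0 -> P (sphere_disk s) = Q (s, t).

Lemma disk0_subproof : (0 : 'rV[R]_n.+1) \in disk R n.+1.
Proof. by apply/mem_set/diskE; rewrite nrm0 ler01. Qed.

Definition to_disk_total (x : 'rV[R]_n.+1) : disk R n.+1 :=
  insubd (set_sub disk0_subproof) x.

Lemma val_to_disk_total x : nrm x <= 1 -> val (to_disk_total x) = x.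
Proof. by move=> x1; rewrite val_insubd ifT//; apply/mem_set/diskE. Qed.

Lemma to_disk_total_val (d : disk R n.+1) : to_disk_total (val d) = d.
Proof.
by apply: val_inj; rewrite [LHS]val_to_disk_total//; apply/diskE; exact: (set_valP d).
Qed.

(** [P] on the unit ball, then [Q] on the shell of radii 1 to 2 with radius minus 1 as time, and
    constant on rays beyond. Being defined on all vectors, it can be precomposed with any
    rescaling. *)
Definition collar (x : 'rV[R]_n.+1) : Z :=
  if nrm x <= 1 then P (to_disk_total x) else Q (sdir x, clampI (nrm x - 1)).

Lemma collar_in (d : disk R n.+1) : collar (val d) = P d.
Proof.
rewrite /collar to_disk_total_val ifT//.
by apply/diskE; exact: (set_valP d).
Qed.

Lemma collar_out x : 1 <= nrm x -> collar x = Q (sdir x, clampI (nrm x - 1)).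
Proof.
move=> x1; rewrite /collar; case: ifPn => // x1'.
have {x1'} x1 : nrm x = 1 by apply/le_anti/andP.
have xs : x = val (sdir x) by rewrite [LHS]sdir_scale x1 scale1r.
rewrite x1 -PQ; last by rewrite subrr val_clampI// lexx ler01.
congr P; apply: val_inj.
by rewrite [LHS]val_to_disk_total ?x1//.
Qed.

Lemma collar_continuous : @pst_continuous (psTop_of_top 'rV[R]_n.+1) Z collar.
Proof.
apply/cont_onT; apply: (@cont_on_glue _ _ [set x : 'rV[R]_n.+1 | nrm x <= 1]
  [set x : 'rV[R]_n.+1 | 1 <= nrm x]).
- by apply: closed_le_fun; [exact: nrm_continuous|exact: cst_continuous].
- by apply: closed_le_fun; [exact: cst_continuous|exact: nrm_continuous].
- apply/seteqP; split=> // x _ /=.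
  by case: (lerP (nrm x) 1) => h; [left|right; exact: ltW].
- rewrite setTI; apply: (@cont_on_eq _ _ _ (fun x => P (to_disk_total x))).
    by move=> x /= x1; rewrite /collar x1.
  move=> U x UU U1 /= x1 [_ Ux]; apply: (cP (F := fmap to_disk_total U)).
  apply: pst_cvg_val; rewrite val_to_disk_total//.
  rewrite -[X in X --> _]/(fmap (fun y => val (to_disk_total y)) U).
  rewrite (fmap_eq_on (g := id) _ U1)// => y /= y1.
  exact: val_to_disk_total.
- rewrite setTI; apply: (@cont_on_eq _ _ _ (fun x => Q (sdir x, clampI (nrm x - 1)))).
    by move=> x /= x1; rewrite collar_out.
  move=> U x UU U1 /= x1 [_ Ux].
  have x0 : x != 0 by apply/eqP => x0; move: x1; rewrite x0 nrm0 ler10.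
  apply: (cQ (F := fmap (fun x => (sdir x, clampI (nrm x - 1))) U)); split.
    exact: fmap_proper_filter.
  have c1 : (fun y : 'rV[R]_n.+1 => sdir y) @ U --> sdir x.
    exact: cvg_comp Ux (sdir_continuous x0).
  have cn : (fun y : 'rV[R]_n.+1 => nrm y - 1) @ U --> nrm x - 1.
    apply: cvgB; last exact: cvg_cst.
    exact: cvg_comp Ux (@nrm_continuous _ _ x).
  have c2 : (fun y : 'rV[R]_n.+1 => clampI (nrm y - 1)) @ U --> clampI (nrm x - 1).
    exact: cvg_comp cn (@clampI_continuous R _).
  exact: cvg_pair c1 c2.
Qed.

Lemma collar_scale_continuous (f : disk R n.+1 -> R) : continuous f ->
  @pst_continuous (psTop_of_top (disk R n.+1)) Z (fun d => collar (f d *: val d)).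
Proof.
move=> cf; apply: pst_comp_top collar_continuous => d.
exact: cvgZ (@cf d) (@val_continuous _ _ d).
Qed.

End collar.

Lemma sdir_pscale (R : realType) n (c : R) (x : 'rV[R]_n.+1) : 0 < c ->
  sdir (c *: x) = sdir x.
Proof.
move=> c0; rewrite /sdir nrmZ gtr0_norm// scalerA invfM mulrAC mulVf ?gt_eqF//.
by rewrite mul1r.
Qed.

Section lifting.
Variables (R : realType) (X : psTop).
Local Notation sk := (skeleton R X).
Local Notation cw := (cw_approx R X).
Local Notation f := (@cw_approx_map R X).

Lemma cw_approx_map_char n (i : cells R X n) d :
  f (skeleton_in n.+1 (cell_char i d)) = cell_ext i d.
Proof. by rewrite cw_approx_map_in; exact: attach_map_char. Qed.

Lemma cell_fill n (a : sphere R n -> sk n) (H : disk R n -> X) :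
  @pst_continuous (psTop_of_top (sphere R n)) (sk n) a ->
  @pst_continuous (psTop_of_top (disk R n)) X H ->
  (forall s, H (sphere_disk s) = skeleton_map n (a s)) ->
  exists G : disk R n -> cw,
    [/\ @pst_continuous (psTop_of_top (disk R n)) cw G,
      forall s, G (sphere_disk s) = skeleton_in n (a s) &
      forall d, f (G d) = H d].
Proof.
move=> ca cH aH; pose i : cells R X n := CellProblem ca cH aH.
exists (fun d => skeleton_in n.+1 (cell_char i d)); split.
- exact: (pst_continuous_comp (@cell_char_continuous R X n i)
    (@skeleton_in_continuous R X n.+1)).
- by move=> s; rewrite cell_char_incl.
- by move=> d; rewrite cw_approx_map_char.
Qed.

(* A sphere in the complex is deformed into the skeleton where it bounds a cell
   by construction; the deformation is undone on a collar of that cell. *)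
Lemma cw_approx_weak_lift : weak_lift R f.
Proof.
move=> k a H ca cH aH; have [h [ch [A [cA A0 A1 _]]]] := compress ca.
have cf := @cw_approx_map_continuous R X.
case: k a H ca cH aH h ch A cA A0 A1 => [|k] a H ca cH aH h ch A cA A0 A1.
  have no (s : sphere R 0) : False.
    by have := set_valP s; rewrite /sphere /= big_ord0 => /eqP; rewrite eq_sym oner_eq0.
  have [|G [cG _ fG]] := cell_fill ch cH; first by move=> s; case: (no s).
  exists G; split=> [//|s|]; first by case: (no s).
  have -> : f \o G = H by apply/funext.
  exact: hrel_refl.
have cfA := pst_continuous_comp cA cf.
(* At radius 2 this ends at the image of the compressed sphere, so doubling turns it into a square
   that a cell of the complex fills. *)
pose HA := collar H (f \o A).
have HAP s (t : unitI R) : val t = 0 -> H (sphere_disk s) = (f \o A) (s, t).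
  by move=> t0; rewrite /= A0// aH.
have cHA (c : disk R k.+1 -> R) : continuous c -> @pst_continuous (psTop_of_top (disk R k.+1)) X
    (fun d => HA (c d *: val d)).
  by move=> cc; exact: collar_scale_continuous.
have nS (s : sphere R k.+1) : nrm (val (sphere_disk s)) = 1.
  exact: disk_boundary_sphere.
have sdS (s : sphere R k.+1) : sdir (val (sphere_disk s)) = s by exact: sdir_sphere.
have [||G1 [cG1 G1h fG1]] := cell_fill ch (H := fun d => HA (2 *: val d)).
- exact: (cHA (fun=> 2) (@cst_continuous _ _ _)).
- move=> s; rewrite /HA collar_out//; last by rewrite nrmZ nS ger0_norm; lra.
  rewrite sdir_pscale// sdS nrmZ nS ger0_norm// mulr1 /= A1; last first.
    by rewrite val_clampI; lra.
  exact: cw_approx_map_in.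
(* The deformation run backwards, from the compressed sphere back to [a]. *)
pose Q (p : (sphere R k.+1 * unitI R)%type) := A (p.1, clampI (1 - val p.2)).
have cQ : @pst_continuous (psTop_of_top (sphere R k.+1 * unitI R)%type) cw Q.
  apply: pst_comp_top cA; apply: pair_continuous => p; first exact: cvg_fst.
  apply: (@continuous_comp _ _ _ (fun p : sphere R k.+1 * unitI R => 1 - val p.2));
    last exact: clampI_continuous.
  have csnd : continuous (fun p : sphere R k.+1 * unitI R => val p.2).
    by move=> q; apply: continuous_comp; [exact: cvg_snd|exact: val_continuous].
  exact: cvgB (cvg_cst _) (@csnd p).
have QP s (t : unitI R) : val t = 0 -> G1 (sphere_disk s) = Q (s, t).
  by move=> t0; rewrite G1h /Q /= -[sval t]/(val t) t0 subr0 A1// val_clampI// lexx ler01.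
pose GA := collar G1 Q.
(* This is 3 / max(|d|, 1/2) - 2, the factor with which the image of the lift is [HA] at a multiple
   of [d]. Two doublings give 4 on the half disk; outside, the reversed collar at radius 2|d| is
   [HA] at radius 3 - 2|d|. On the sphere the factor is 1. *)
pose w0 (d : disk R k.+1) : R :=
  3 / ((nrm (val d) + 2^-1 + `|nrm (val d) - 2^-1|) / 2) - 2.
have w0_in (d : disk R k.+1) : nrm (val d) <= 2^-1 -> w0 d = 4.
  move=> d2; rewrite /w0 ler0_norm ?subr_le0// (_ : (_ + _ + _) / 2 = 2^-1); last by lra.
  by rewrite invrK; lra.
have w0_out (d : disk R k.+1) : 2^-1 <= nrm (val d) -> w0 d = 3 / nrm (val d) - 2.
  by move=> d2; rewrite /w0 ger0_norm ?subr_ge0//; congr (3 / _ - 2); lra.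
have cw0 : continuous w0.
  have cn : continuous (fun d : disk R k.+1 => nrm (val d)) by exact: nrm_val_continuous.
  have cm : continuous (fun d : disk R k.+1 =>
      (nrm (val d) + 2^-1 + `|nrm (val d) - 2^-1|) / 2).
    move=> d; exact: cvgM (cvgD (cvgD (@cn d) (cvg_cst _))
      (cvg_norm (cvgB (@cn d) (cvg_cst _)))) (cvg_cst _).
  move=> d; apply: (@cvgB _ _ _ (nbhs (d : disk R k.+1))); last exact: cvg_cst.
  apply: (cvg_divr _ (cvg_cst (3 : R)) (@cm d)).
  have := nrm_ge0 (val d); have := normr_ge0 (nrm (val d) - 2^-1) => h1 h2.
  by apply: lt0r_neq0; lra.
have fGA (d : disk R k.+1) : f (GA (2 *: val d)) = HA (w0 d *: val d).
  have d1 : nrm (val d) <= 1 by apply/diskE; exact: (set_valP d).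
  have [d2|/ltW d2] := lerP (nrm (val d)) 2^-1.
    have d2' : nrm (2 *: val d) <= 1 by rewrite nrmZ ger0_norm//; lra.
    rewrite w0_in// -(val_to_disk_total d2') /GA collar_in fG1.
    by rewrite val_to_disk_total// scalerA; congr (HA (_ *: _)); lra.
  have d0 : 0 < nrm (val d) by apply: lt_le_trans d2; rewrite invr_gt0.
  have w0d : w0 d * nrm (val d) = 3 - 2 * nrm (val d).
    by rewrite w0_out// mulrBl divfK ?gt_eqF.
  have w00 : 0 < w0 d by rewrite -(pmulr_lgt0 _ d0) w0d; lra.
  rewrite /GA collar_out//; last by rewrite nrmZ ger0_norm//; lra.
  rewrite /HA collar_out//; last by rewrite nrmZ gtr0_norm// w0d; lra.
  rewrite !sdir_pscale// !nrmZ (gtr0_norm w00) w0d ger0_norm// /Q /=.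
  congr (f (A (_, clampI _))).
  by rewrite -[clampr _]/(val (clampI _)) val_clampI; lra.
exists (fun d => GA (2 *: val d)); split.
- by apply: collar_scale_continuous => //; exact: cst_continuous.
- move=> s; rewrite /GA collar_out//; last by rewrite nrmZ nS ger0_norm; lra.
  rewrite sdir_pscale// sdS nrmZ nS ger0_norm// mulr1 /Q /= A0//.
  by rewrite -[clampr _]/(val (clampI _)) !val_clampI; lra.
(* The image of the lift and [H] differ only by the scaling in [HA], so the factor [w0] is moved
   linearly to 1; on the sphere it is 1 all along. *)
exists (fun p => HA (((1 - val p.2) * w0 p.1 + val p.2) *: val p.1)); split.
- apply: (@pst_comp_top _ _ _ (fun p : disk R k.+1 * unitI R =>
      ((1 - val p.2) * w0 p.1 + val p.2) *: val p.1) HA); last exact: collar_continuous.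
  have c1 : continuous (fun p : disk R k.+1 * unitI R => val p.1).
    by move=> p; apply: continuous_comp; [exact: cvg_fst|exact: val_continuous].
  have c2 : continuous (fun p : disk R k.+1 * unitI R => val p.2).
    by move=> p; apply: continuous_comp; [exact: cvg_snd|exact: val_continuous].
  have cw1 : continuous (fun p : disk R k.+1 * unitI R => w0 p.1).
    by move=> p; apply: continuous_comp; [exact: cvg_fst|exact: cw0].
  move=> p.
  exact: cvgZ (cvgD (cvgM (cvgB (cvg_cst _) (@c2 p)) (@cw1 p)) (@c2 p)) (@c1 p).
- by move=> d t t0; rewrite /= -[sval t]/(val t) t0 subr0 mul1r addr0 fGA.
- move=> d t t1; rewrite /= -[sval t]/(val t) t1 subrr mul0r add0r scale1r.
  exact: collar_in.
- move=> d t d1; rewrite /= fGA w0_out; last by rewrite d1; lra.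
  by rewrite d1 divr1; congr (HA (_ *: _)); ring.
Qed.

End lifting.

Theorem theorem3p17 (R : realType) :
  (forall X : psTop, exists Y : psTop,
     psTop_CW_complex R Y /\ weak_homotopy_equivalent R X Y) /\
  (forall X : psTop, exists Z : topologicalType,
     top_CW_complex R Z /\ weak_homotopy_equivalent R X (psTop_of_top Z)).
Proof.
have XY X : weak_homotopy_equivalent R X (cw_approx R X).
  apply/rst_sym/rst_step; exists (@cw_approx_map R X); apply: weak_lift_whe.
    exact: cw_approx_map_continuous.
  exact: cw_approx_weak_lift.
split=> X.
  by exists (cw_approx R X); split; [exact: cw_approx_CW|exact: XY].
exists (tau (cw_approx R X)); split; first exact/tau_CW/cw_approx_CW.
(* The complex maps to [X] and to its own modification; the zigzag consists of these two maps. *)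
apply: rst_trans (XY X) _; apply: rst_step; exists (fun p => p).
by apply: weak_lift_whe; [exact: tau_unit_continuous|exact: tau_unit_weak_lift].
Qed.
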